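(* Let $\{w_i\}_{i=1}^n$ be a basis of $\mathbb{R}^n$ and let $S\subseteq[n]$ have cardinality $|S|=d$. Let $(S_1,\dots,S_m)$ form a uniform cover of $S$ with weights $(p_1,\dots,p_m)$. Let $H=\mathrm{span}\{w_k : k\in S\}$, $H_j=\mathrm{span}\{w_k : k\in S_j\}$, $\widetilde{H}_j=\mathrm{span}\{w_k : k\in S\setminus S_j\}$, $d_j=\dim H_j=|S_j|$ and $p=\sum_{j=1}^m p_j$. Put $$BL_1:=\frac{\prod_{j=1}^m|\wedge_{k\in S\setminus S_j}w_k|^{p_j}}{|\wedge_{i\in S}w_i|^{p-1}},\qquad BL_2:=\frac{\prod_{j=1}^m|\wedge_{k\in S_j}w_k|^{p_j}}{|\wedge_{i\in S}w_i|}.$$ Then for every convex body $K\subseteq\mathbb{R}^n$ the following four inequalities hold: $$|P_{H^\perp}K|^{p-1}|K|\leqslant BL_1\cdot\frac{\prod_{j=1}^m\binom{n-d+d_j}{d_j}^{p_j}}{\binom{n}{d}}\prod_{j=1}^m|P_{\widetilde{H}_j^\perp}K|^{p_j},$$ $$|P_{H^\perp}K||K|^{p-1}\leqslant BL_2\cdot\frac{\prod_{j=1}^m\binom{n-d_j}{n-d}^{p_j}}{\binom{n}{d}^{p-1}}\prod_{j=1}^m|P_{H_j^\perp}K|^{p_j},$$ $$|P_{H^\perp}K|^{p-1}|K|\leqslant BL_2\cdot\frac{\prod_{j=1}^m\binom{n-d+d_j}{d_j}^{p_j}}{\binom{n}{d}}\prod_{j=1}^m|P_{H_j\oplus H^\perp}K|^{p_j},$$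 $$|P_{H^\perp}K||K|^{p-1}\leqslant BL_1\cdot\frac{\prod_{j=1}^m\binom{n-d_j}{n-d}^{p_j}}{\binom{n}{d}^{p-1}}\prod_{j=1}^m|P_{\widetilde{H}_j\oplus H^\perp}K|^{p_j}.$$
   Context: $[n]=\{1,\dots,n\}$. For $m\geqslant1$, subsets $S_1,\dots,S_m\subseteq S$ (not necessarily distinct) form a uniform cover of $S\subseteq[n]$ with weights $(p_1,\dots,p_m)$, $p_j>0$ for all $j$, if $\sum_{j=1}^m p_j\chi_{S_j}(i)=1$ for every $i\in S$. For vectors $u_1,\dots,u_k$, $|\wedge_{i=1}^k u_i|$ is the $k$-dimensional volume of the parallelepiped they span (equal to $1$ for the empty family). A convex body is a compact convex set with non-empty interior. $P_F$ is the orthogonal projection onto the linear subspace $F$ of $\mathbb{R}^n$, $F^\perp$ is its orthogonal complement in $\mathbb{R}^n$, and $|\cdot|$ of a set denotes Lebesgue measure in the corresponding subspace (unit point mass on $\{0\}$). *)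

(* Defs.v *)
From HB Require Import structures.
From mathcomp Require Import all_boot all_order all_algebra.
From mathcomp Require Import all_classical all_reals all_analysis.

Set Implicit Arguments.
Unset Strict Implicit.
Unset Printing Implicit Defensive.

Import Order.TTheory GRing.Theory Num.Theory numFieldNormedType.Exports.

Local Open Scope classical_set_scope.
Local Open Scope ring_scope.

Section lebesgue_tuple.
Variable R : realType.
Local Notation mR := (measurableTypeR R).

Definition tuple_cons k (x : mR * k.-tuple mR) : k.+1.-tuple mR :=
  [tuple of x.1 :: x.2].

Lemma measurable_tuple_cons k :
  measurable_fun [set: mR * k.-tuple mR] (@tuple_cons k).
Proof.
by apply: measurable_cons; [exact: measurable_fst | exact: measurable_snd].
Qed.

Section step.
Variables (k : nat) (mu : {sigma_finite_measure set (k.-tuple mR) -> \bar R}).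

Definition lebesgue_cons : set (k.+1.-tuple mR) -> \bar R :=
  pushforward (@lebesgue_measure R \x mu)%E (@tuple_cons k).

Let lebesgue_consK : exists nu : {measure set (k.+1.-tuple mR) -> \bar R},
  nu = lebesgue_cons :> (set _ -> _).
Proof.
exists (measure_function_pushforward__canonical__measure_function_Measure
  (@lebesgue_measure R \x mu)%E (@measurable_tuple_cons k)).
by [].
Qed.

Let lebesgue_cons0 : lebesgue_cons set0 = 0%E.
Proof. by have [nu <-] := lebesgue_consK; exact: measure0. Qed.

Let lebesgue_cons_ge0 A : (0 <= lebesgue_cons A)%E.
Proof. by have [nu <-] := lebesgue_consK; exact: measure_ge0. Qed.

Let lebesgue_cons_sigma_additive : semi_sigma_additive lebesgue_cons.
Proof.
by have [nu <-] := lebesgue_consK; exact: measure_semi_sigma_additive.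
Qed.

HB.instance Definition _ := isMeasure.Build _ _ _ lebesgue_cons
  lebesgue_cons0 lebesgue_cons_ge0 lebesgue_cons_sigma_additive.

Let lebesgue_cons_sigma_finite : sigma_finite setT lebesgue_cons.
Proof.
pose g (t : k.+1.-tuple mR) : mR * k.-tuple mR := (thead t, [tuple of behead t]).
have mg : measurable_fun [set: k.+1.-tuple mR] g.
  apply: measurable_fun_pair; first exact: measurable_tnth.
  exact: measurable_behead.
have consK : cancel (@tuple_cons k) g.
  by move=> [x t]; congr pair; exact/val_inj.
have [F FT Ffin] : sigma_finite setT (@lebesgue_measure R \x mu)%E.
  have /sigma_finiteP[G [TG ndG Goo]] := sigma_finiteT (@lebesgue_measure R).
  have /sigma_finiteP[H [TH ndH Hoo]] := sigma_finiteT mu.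
  exists (fun i => G i `*` H i) => [|i].
    rewrite -setXTT TG TH predeqE => -[x y]; split.
      move=> [/= [i _ Gix] [j _ Hjy]]; exists (maxn i j) => //; split.
      - by move: x Gix; exact/subsetPset/ndG/leq_maxl.
      - by move: y Hjy; exact/subsetPset/ndH/leq_maxr.
    by move=> [i _ []/= ? ?]; split; exists i.
  have [? ?] := Goo i; have [? ?] := Hoo i; split; first exact: measurableX.
  by rewrite product_measure1E// lte_mul_pinfty// ge0_fin_numE.
exists (fun i => g @^-1` F i).
  by rewrite -preimage_bigcup -FT preimage_setT.
move=> i; have [mF Fi] := Ffin i; split.
  by rewrite -[X in measurable X]setTI; exact: mg.
rewrite /lebesgue_cons /pushforward (_ : _ @^-1` _ = F i)//.
by apply/seteqP; split=> x; rewrite /preimage/= consK.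
Qed.

HB.instance Definition _ := @Measure_isSigmaFinite.Build _ _ _ lebesgue_cons
  lebesgue_cons_sigma_finite.

End step.

(* The k-fold product of the one-dimensional Lebesgue measure; for k = 0 it is
   the unit mass on the empty tuple. *)
Fixpoint lebesgue_tuple k : {sigma_finite_measure set (k.-tuple mR) -> \bar R} :=
  if k is k'.+1 then lebesgue_cons (lebesgue_tuple k') else dirac [tuple].

Lemma lebesgue_tuple_box k (A : 'I_k -> set mR) :
  (forall i, measurable (A i)) ->
  lebesgue_tuple k [set t | forall i, A i (tnth t i)] =
  (\prod_(i < k) lebesgue_measure (A i))%E.
Proof.
elim: k A => [|k IH] A mA /=.
  by rewrite big_ord0 diracE mem_set// => -[].
rewrite /lebesgue_cons /pushforward big_ord_recl -IH//.
set B := (X in _ = (_ * lebesgue_tuple k X)%E).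
have mB : measurable B.
  rewrite (_ : B = \bigcap_(i in [set: 'I_k])
      ((@tnth _ mR ^~ i) @^-1` A (lift ord0 i))).
    apply: fin_bigcap_measurable => // i _.
    by rewrite -[X in measurable X]setTI; exact: measurable_tnth.
  by apply/seteqP; split=> t /= h i => [_|]; exact: h.
rewrite -product_measure1E//; congr ((_ \x _)%E _).
apply/seteqP; split => -[x t] /=.
  move=> h; split; first by have := h ord0; rewrite tnth0.
  by move=> i; have := h (lift ord0 i); rewrite tnthS.
move=> [h0 hS] i; case: (unliftP ord0 i) => [j ->|->].
  by rewrite tnthS; exact: hS.
by rewrite tnth0.
Qed.

End lebesgue_tuple.

Section euclidean_space.
Variables (R : realType) (n : nat).
Local Notation V := 'rV[R]_n.
Implicit Types (u v : V) (F : {vspace V}) (A : set V).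

Definition dotv u v : R := (u *m v^T) 0 0.

Lemma dotvE u v : dotv u v = \sum_i u 0 i * v 0 i.
Proof. by rewrite /dotv mxE; apply: eq_bigr => i _; rewrite mxE. Qed.

Let dotv_bilinear : bilinear_for
  (GRing.Scale.Law.clone _ _ *%R _) (GRing.Scale.Law.clone _ _ (idfun \; *%R) _)
  dotv.
Proof.
split=> [v|u] a x y /=.
  by rewrite /dotv mulmxDl -scalemxAl !mxE.
by rewrite /dotv linearP /= mulmxDr -scalemxAr !mxE.
Qed.

HB.instance Definition _ := bilinear_isBilinear.Build R V V R^o
  (GRing.Scale.Law.clone _ _ *%R _) (GRing.Scale.Law.clone _ _ (idfun \; *%R) _)
  dotv dotv_bilinear.

Let dotvC u v : dotv u v = (-1) ^+ false * idfun (dotv v u).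
Proof.
by rewrite expr0 mul1r !dotvE; apply: eq_bigr => i _; rewrite mulrC.
Qed.

HB.instance Definition _ :=
  isHermitianSesquilinear.Build R V false idfun dotv dotvC.

Let dotv_gt0 u : u != 0 -> 0 < dotv u u.
Proof.
move=> u0; rewrite lt_neqAle dotvE sumr_ge0 => [|i _]; last first.
  by rewrite -expr2 sqr_ge0.
rewrite andbT eq_sym; apply: contra u0 => /eqP u0; apply/eqP/rowP => i.
have sq_ge0 (j : 'I_n) : true -> 0 <= u 0 j * u 0 j by rewrite -expr2 sqr_ge0.
by apply/eqP; rewrite mxE -sqrf_eq0 expr2 (psumr_eq0P sq_ge0 u0).
Qed.

HB.instance Definition _ := isDotProduct.Build R V dotv dotv_gt0.

Definition is_onbasis F k (B : k.-tuple V) : Prop :=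
  basis_of F B /\ forall i j, dotv (tnth B i) (tnth B j) = (i == j)%:R.

Lemma ex_onbasis F : exists B : (\dim F).-tuple V, is_onbasis F B.
Proof.
move dF : (\dim F) => k; elim: k F dF => [|k IH] F dF.
  exists [tuple]; split=> [|[]//]; rewrite basisEdim span_nil dF leqnn andbT.
  by move/eqP: dF; rewrite dimv_eq0 => /eqP ->; exact: sub0v.
pose v0 := vpick F; pose v := (Num.sqrt (dotv v0 v0))^-1 *: v0.
have v0N0 : v0 != 0 by rewrite vpick0 -dimv_eq0 dF.
have v01 : 0 < dotv v0 v0 by exact: dotv_gt0.
have vv : dotv v v = 1.
  rewrite /v linearZl_LR linearZr_LR/= mulrA -invfM -expr2 sqr_sqrtr ?ltW//.
  by rewrite mulVf// gt_eqF.
have vvN0 : dotv v v != 0 by rewrite vv oner_neq0.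
have vF : v \in F by rewrite memvZ// memv_pick.
pose G := (F :&: orthov dotv <[v]>)%VS.
have vNF : v \notin orthov dotv F by apply/mem_orthovPn; exists v.
have dG : \dim G = k by rewrite -eq_dim_orthov1// dF.
have [B [BG Bon]] := IH G dG.
have vNG : v \notin G by rewrite memv_cap vF/= mem_orthov1.
have vB i : dotv v (tnth B i) = 0.
  have := basis_mem BG (mem_tnth i B).
  rewrite memv_cap mem_orthov1 => /andP[_ /eqP h].
  by rewrite -[RHS]h (dotvC v)/= expr0 mul1r.
exists [tuple of v :: B]; split.
  rewrite basisEfree free_cons (span_basis BG) vNG (basis_free BG)/=.
  rewrite size_tuple dF leqnn andbT span_cons (span_basis BG).
  by rewrite subv_add capvSl andbT -memvE.
move=> i j; case: (unliftP ord0 i) => [i'|] ->; case: (unliftP ord0 j) => [j'|] ->;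
  rewrite ?tnth0 ?tnthS//.
by rewrite dotvC/= expr0 mul1r vB.
Qed.

Definition onbasis F : (\dim F).-tuple V := xget (vbasis F) (@is_onbasis F _).

Lemma onbasisP F : is_onbasis F (onbasis F).
Proof. exact: (xgetPex (vbasis F) (ex_onbasis F)). Qed.

Definition orthoc F : {vspace V} := orthov dotv F.

Lemma capv_orthoc F : (F :&: orthoc F = 0)%VS.
Proof.
apply/eqP; rewrite -subv0; apply/subvP => u; rewrite memv_cap memv0.
move=> /andP[uF /mem_orthovP/(_ _ uF) uu]; apply: contraT => /dotv_gt0.
by rewrite uu ltxx.
Qed.

Lemma addv_orthoc F : (F + orthoc F = fullv)%VS.
Proof.
apply/eqP; rewrite eqEsubv subvf; apply/subvP => u _.
have [BF Bon] := onbasisP F.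
set B := onbasis F in BF Bon.
pose x := \sum_i dotv u (tnth B i) *: tnth B i.
have Bmem i : tnth B i \in F by rewrite (basis_mem BF)// mem_tnth.
rewrite -(subrK x u) addrC; apply: memv_add.
  by apply: rpred_sum => i _; rewrite memvZ.
apply/mem_orthovP => v vF.
have uxB i : dotv (u - x) (tnth B i) = 0.
  rewrite linearBl /x linear_sumlz (bigD1 i)//= linearZl_LR/= Bon eqxx mulr1.
  rewrite big1 ?addr0 ?subrr// => j ji.
  by rewrite linearZl_LR/= Bon (negbTE ji) mulr0.
rewrite (coord_basis BF vF) linear_sumr big1// => i _.
by rewrite linearZr_LR/= -tnth_nth uxB mulr0.
Qed.

(* The projection onto F along its orthogonal complement. *)
Definition orthoproj F : 'End(V) := daddv_pi F (orthoc F).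

(* Lebesgue measure of A `&` F in the subspace F, read in orthonormal
   coordinates. It is only used on compact subsets of F, where the measure is
   finite, so that [fine] loses nothing. *)
Definition vol F A : R :=
  fine (lebesgue_tuple R (\dim F)
    [set t | A (\sum_(i < \dim F) tnth t i *: tnth (onbasis F) i)]).

Definition parallelepiped (s : seq V) : set V :=
  [set \sum_(i < size s) t i *: s`_i |
    t in [set t : 'I_(size s) -> R | forall i, 0 <= t i <= 1]].

(* The (size s)-dimensional volume; for a dependent family the span has
   dimension < size s, so that this volume is 0. *)
Definition wedge_norm (s : seq V) : R :=
  if free s then vol (span s) (parallelepiped s) else 0.

Definition convex_body (K : set V) : Prop :=
  [/\ compact K, convex_set K & K° !=set0].

End euclidean_space.

Definition uniform_cover (R : realType) (n m : nat) (S : {set 'I_n})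
    (Sj : 'I_m -> {set 'I_n}) (p : 'I_m -> R) : Prop :=
  [/\ (0 < m)%N, (forall j, Sj j \subset S), (forall j, 0 < p j) &
      forall i, i \in S -> \sum_(j < m) p j * (i \in Sj j)%:R = 1].

(* Main.v *)
Require Import Defs.
From HB Require Import structures.
From mathcomp Require Import all_boot all_order all_algebra fingroup perm.
From mathcomp Require Import all_classical all_reals all_analysis.
From mathcomp Require Import measurable_realfun ring lra.

(** Why the theorem holds. In coordinates with respect to the basis w,
    projecting along span {w_k : k in B} forgets the coordinates in B. By the
    linear change of variables and the multiplicativity of Gram determinants,
    the volume of the orthogonal projection of K to the complement of that
    span is |w| / |w_B| times v(~B), where v(A) is the volume of the
    projection to the coordinates in A of the coordinate body
    {z | sum_k z_k w_k in K} ([vol_orthoc_subfam]). The first inequality thus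
    reduces to one about the numbers v(A) ([projection_inequality]):
      v(~S)^(p-1) v([n])
        <= prod_j C(n-d+d_j, d_j)^(p_j) / C(n, d) * prod_j v(~S u S_j)^(p_j).

    Let L be the projection to the coordinates outside S. Above y in L, let
    f(y) be the volume of the fibre of the coordinate body, and f_j(y) that of
    the fibre of its projection to the coordinates in ~S u S_j. Finner's
    inequality for the uniform cover gives f <= prod_j f_j^(p_j). With
    h_j = f_j^(1/d_j) and theta_j = p_j d_j / d, which sum to 1, the right side
    is prod_j (h_j^d)^(theta_j), and Hoelder's inequality bounds v([n]) by
    prod_j (int_L h_j^d)^(theta_j). Convexity of K makes h_j concave enough
    for Berwald's inequality ([berwald]), a reverse Hoelder inequality that
    bounds int_L h_j^d through int_L h_j^(d_j) = v(~S u S_j). Its extremal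
    functions are affine functions on cones, whose moments are beta integrals;
    hence the binomial coefficients. Berwald's inequality itself holds because
    the distribution function of h_j crosses that of a cone at most once, by
    the Brunn-Minkowski inequality ([brunn_minkowski]).

    For the second inequality, the sets S \ S_j form a uniform cover of S with
    weights p_j / (p - 1); insert it in the first inequality and raise to the
    power p - 1. The last two inequalities are the first two for a basis u such
    that (u_k), k in S, is the basis of H dual to (w_k): then H_j + H^perp is
    the complement of span {u_k : k in S \ S_j}, and |u_(S \ S_j)| is
    |w_(S_j)| / |w_S| ([orthoc_span_dual], [wedge_norm_dual]).

    Volumes in coordinate directions are iterated one-dimensional integrals
    ([flatint]), so that Finner's inequality, the Brunn-Minkowski inequality
    and the change of variables are proved one coordinate at a time. *)

Set Implicit Arguments.
Unset Strict Implicit.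
Unset Printing Implicit Defensive.

Import Order.TTheory GRing.Theory Num.Theory numFieldNormedType.Exports.

Local Open Scope classical_set_scope.
Local Open Scope ring_scope.

(** * Measurable row vectors *)

Section measurable_row.
Variables (R : realType) (n : nat).
Local Notation mR := (measurableTypeR R).
Local Notation X := 'rV[R]_n.

Definition row_of_tuple (t : n.-tuple mR) : X := \row_i tnth t i.
Definition tuple_of_row (x : X) : n.-tuple mR := [tuple x 0 i | i < n].

Lemma row_of_tupleK : cancel row_of_tuple tuple_of_row.
Proof. by move=> t; apply: eq_from_tnth => i; rewrite tnth_mktuple mxE. Qed.

Lemma tuple_of_rowK : cancel tuple_of_row row_of_tuple.
Proof. by move=> x; apply/rowP => i; rewrite mxE tnth_mktuple. Qed.

(** The sigma-algebra of tuples, transported along the bijection; it contains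
    the open sets, see [open_measurable_row]. *)
Definition measurable_row : set (set X) :=
  [set A | measurable (row_of_tuple @^-1` A)].

Let measurable_row0 : measurable_row set0.
Proof. by rewrite /measurable_row/= preimage_set0. Qed.

Let measurable_rowC A : measurable_row A -> measurable_row (~` A).
Proof. by rewrite /measurable_row/= preimage_setC; exact: measurableC. Qed.

Let measurable_row_bigcup (F : (set X)^nat) :
  (forall i, measurable_row (F i)) -> measurable_row (\bigcup_i F i).
Proof.
by rewrite /measurable_row/= => mF; rewrite preimage_bigcup; exact: bigcup_measurable.
Qed.

HB.instance Definition _ := @isMeasurable.Build
  default_measure_display X measurable_row
  measurable_row0 measurable_rowC measurable_row_bigcup.

End measurable_row.

Section measurable_row_fun.
Context (R : realType) (n : nat) d (T : measurableType d).
Local Notation mR := (measurableTypeR R).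
Local Notation X := 'rV[R]_n.

Lemma measurable_row_of_tuple :
  measurable_fun [set: n.-tuple mR] (@row_of_tuple R n).
Proof. by move=> _ A mA; rewrite setTI. Qed.

Lemma measurable_tuple_of_row :
  measurable_fun [set: X] (@tuple_of_row R n).
Proof.
move=> _ A mA; rewrite setTI /measurable/= /measurable_row/=.
rewrite (_ : _ @^-1` _ = A)//; apply/seteqP; split=> t /=; by rewrite row_of_tupleK.
Qed.

Lemma measurable_coord (i : 'I_n) : measurable_fun [set: X] (fun x : X => x 0 i : mR).
Proof.
rewrite (_ : (fun _ => _) = (@tnth n mR ^~ i) \o (@tuple_of_row R n)).
  apply: (measurableT_comp _ measurable_tuple_of_row).
  exact: measurable_tnth.
by apply/funext => x /=; rewrite tnth_mktuple.
Qed.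

Lemma measurable_fun_row (f : T -> X) :
  (forall i, measurable_fun setT (fun t => f t 0 i : mR)) ->
  measurable_fun setT f.
Proof.
move=> mf; rewrite (_ : f = @row_of_tuple R n \o (fun t => tuple_of_row (f t))).
  apply: (measurableT_comp measurable_row_of_tuple).
  apply/measurable_fun_tnthP => i.
  rewrite (_ : _ \o _ = (fun t => f t 0 i : mR))//.
  by apply/funext => t /=; rewrite tnth_mktuple.
by apply/funext => t /=; rewrite tuple_of_rowK.
Qed.

End measurable_row_fun.

(** * Integration over coordinate flats *)

Section upd.
Context (R : realType) (n : nat).
Local Notation mR := (measurableTypeR R).
Local Notation X := 'rV[R]_n.
Implicit Types (i j : 'I_n) (x y : X) (s t : R).

Definition upd i x s : X := \row_j (if j == i then s else x 0 j).

Lemma updE i x s j : upd i x s 0 j = if j == i then s else x 0 j.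
Proof. by rewrite mxE. Qed.

Lemma updC i j x s t : i != j -> upd i (upd j x t) s = upd j (upd i x s) t.
Proof.
move=> ij; apply/rowP => k; rewrite !updE.
by have [->|//] := eqVneq k i; rewrite (negbTE ij).
Qed.

Lemma upd_id i x : upd i x (x 0 i) = x.
Proof. by apply/rowP => k; rewrite updE; case: eqP => [->|]. Qed.

Lemma updD i x y s t : upd i x s + upd i y t = upd i (x + y) (s + t).
Proof. by apply/rowP => k; rewrite !mxE; case: eqP. Qed.

Lemma updZ i x s c : c *: upd i x s = upd i (c *: x) (c * s).
Proof. by apply/rowP => k; rewrite !mxE; case: eqP. Qed.

Lemma measurable_upd i : measurable_fun setT (fun z : X * mR => upd i z.1 z.2).
Proof.
apply: measurable_fun_row => j.
have [ji|ji] := eqVneq j i.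
  rewrite (_ : (fun _ => _) = snd); first exact: measurable_snd.
  by apply/funext => z; rewrite updE ji eqxx.
rewrite (_ : (fun _ => _) = (fun x : X => x 0 j : mR) \o fst).
  by apply: (measurableT_comp (measurable_coord _)); exact: measurable_fst.
by apply/funext => z; rewrite updE (negbTE ji).
Qed.

Lemma measurable_upd1 i x : measurable_fun setT (fun s : mR => upd i x s).
Proof.
rewrite (_ : (fun _ => _) = (fun z : X * mR => upd i z.1 z.2) \o (fun s => (x, s)))//.
by apply: (measurableT_comp (@measurable_upd i)); exact: measurable_pair1.
Qed.

End upd.

Section flatint.
Context (R : realType) (n : nat).
Local Notation mR := (measurableTypeR R).
Local Notation X := 'rV[R]_n.
Local Notation mu := (@lebesgue_measure R).
Implicit Types (i j : 'I_n) (l : seq 'I_n) (x y : X) (g h : X -> \bar R).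

Local Open Scope ereal_scope.

(** The integral of g over the flat through x in the coordinate directions
    listed in l. The other coordinates of x are parameters: keeping all of them
    lets l shrink in an induction while the ambient space stays the same. *)
Definition flatint l g : X -> \bar R :=
  foldr (fun i h x => \int[mu]_(s in setT) h (upd i x s)) g l.

Lemma flatint_cons i l g x : flatint (i :: l) g x = \int[mu]_s flatint l g (upd i x s).
Proof. by []. Qed.

Lemma flatint_cat l1 l2 g : flatint (l1 ++ l2) g = flatint l1 (flatint l2 g).
Proof. by rewrite /flatint foldr_cat. Qed.

Lemma flatint_ge0 l g x : (forall x, 0 <= g x) -> 0 <= flatint l g x.
Proof.
by move=> g0; elim: l x => //= i l IH x; apply: integral_ge0 => s _; exact: IH.
Qed.

Lemma measurable_flatint l g : measurable_fun [set: X] g -> (forall x, 0 <= g x) ->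
  measurable_fun setT (flatint l g).
Proof.
move=> mg g0; elim: l => //= i l IH.
apply: (@measurable_fun_fubini_tonelli_F _ _ _ _ _ mu
  (fun z : X * mR => flatint l g (upd i z.1 z.2))) => [|z].
  exact: (measurableT_comp IH (@measurable_upd R n i)).
exact: flatint_ge0.
Qed.

Lemma measurable_flatint_upd i l g x : measurable_fun [set: X] g -> (forall x, 0 <= g x) ->
  measurable_fun setT (fun s : mR => flatint l g (upd i x s)).
Proof.
move=> mg g0; apply: (measurableT_comp (measurable_flatint l mg g0)).
exact: measurable_upd1.
Qed.

(** The y in the flat through x in the directions l. *)
Definition agree_off l x y := forall k, k \notin l -> x 0%R k = y 0%R k.

Lemma agree_off_upd i l x y s : agree_off l (upd i x s) y -> agree_off (i :: l) x y.
Proof.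
move=> h k; rewrite inE negb_or => /andP[ki kl].
by rewrite -(h k kl) updE (negbTE ki).
Qed.

Lemma le_flatint l g h x : measurable_fun [set: X] g -> (forall x, 0 <= g x) ->
  measurable_fun [set: X] h -> (forall x, 0 <= h x) ->
  (forall y, agree_off l x y -> g y <= h y) -> flatint l g x <= flatint l h x.
Proof.
move=> mg g0 mh h0; elim: l x => [|i l IH] x gh /=; first by apply: gh.
apply: ge0_le_integral => //.
- by move=> s _; exact: flatint_ge0.
- exact: measurable_flatint_upd.
- exact: measurable_flatint_upd.
- by move=> s _; apply: IH => y /agree_off_upd; exact: gh.
Qed.

Lemma eq_flatint l g h x : (forall y, agree_off l x y -> g y = h y) ->
  flatint l g x = flatint l h x.
Proof.
elim: l x => [|i l IH] x gh /=; first by apply: gh.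
by apply: eq_integral => s _; apply: IH => y /agree_off_upd; exact: gh.
Qed.

Lemma eq_flatint2 l g x y :
  (forall u v, agree_off l x u -> agree_off l y v ->
     (forall k, k \in l -> u 0%R k = v 0%R k) -> g u = g v) ->
  flatint l g x = flatint l g y.
Proof.
elim: l x y => [|i l IH] x y gh /=; first by apply: gh.
apply: eq_integral => s _; apply: IH => u v xu yv uv.
apply: gh; [exact: agree_off_upd xu|exact: agree_off_upd yv|].
move=> k; rewrite inE; have [kl _|kl] := boolP (k \in l); first exact: uv.
rewrite orbF => /eqP ki; subst k; by rewrite -xu// -yv// !updE eqxx.
Qed.

Lemma flatint_agree l g x y : agree_off l x y -> flatint l g x = flatint l g y.
Proof.
move=> xy; apply: eq_flatint2 => u v xu yv uv; congr g; apply/rowP => k.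
have [kl|kl] := boolP (k \in l); first exact: uv.
by rewrite -xu// -yv// xy.
Qed.

Lemma flatintZl l g (c : R) x : (0 <= c)%R -> measurable_fun [set: X] g ->
  (forall x, 0 <= g x) -> flatint l (fun y => c%:E * g y) x = c%:E * flatint l g x.
Proof.
move=> c0 mg g0; elim: l x => //= i l IH x.
under eq_integral do rewrite IH.
rewrite ge0_integralZl//; first exact: measurable_flatint_upd.
by move=> s _; exact: flatint_ge0.
Qed.

Lemma flatint_swap i j l g : measurable_fun [set: X] g -> (forall x, 0 <= g x) ->
  flatint (i :: j :: l) g = flatint (j :: i :: l) g.
Proof.
move=> mg g0; apply/funext => x; rewrite /=.
have [-> //|ij] := eqVneq i j.
pose F (z : mR * mR) := flatint l g (upd j (upd i x z.1) z.2).
rewrite (@fubini_tonelli _ _ _ _ _ mu mu F).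
- by apply: eq_integral => t _; apply: eq_integral => s _; rewrite /F updC// eq_sym.
- apply: (measurableT_comp (measurable_flatint l mg g0)).
  apply: (measurableT_comp (f:= fun z : X * mR => upd j z.1 z.2)
    (g := fun z : mR * mR => (upd i x z.1, z.2))); first exact: measurable_upd.
  apply: measurable_fun_pair; last exact: measurable_snd.
  by apply: (measurableT_comp (measurable_upd1 i x)); exact: measurable_fst.
- by move=> z; exact: flatint_ge0.
Qed.

Lemma perm_flatint l1 l2 g : perm_eq l1 l2 -> measurable_fun [set: X] g ->
  (forall x, 0 <= g x) -> flatint l1 g = flatint l2 g.
Proof.
move=> + mg g0; elim: l1 l2 => [|i l1 IH] l2 p12.
  by have /perm_nilP -> : perm_eq l2 [::] by rewrite perm_sym.
have /perm_mem/(_ i) := p12; rewrite mem_head => /esym il2.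
case/splitPr: il2 p12 => a b p12.
transitivity (flatint (i :: (a ++ b)) g).
  rewrite -[LHS]/(fun x => \int[mu]_s flatint l1 g (upd i x s)) (IH (a ++ b))//.
  rewrite -(perm_cons i); apply: perm_trans p12 _.
  by rewrite perm_catC/= perm_cons perm_catC.
elim: a {p12} => // j a IHa.
rewrite /= -[RHS]/(fun x => \int[mu]_s flatint (a ++ i :: b) g (upd j x s)).
by rewrite -IHa; exact: flatint_swap.
Qed.

End flatint.

(** * Affine substitutions and exchange of integrals *)

Section affine1.
Context (R : realType).
Local Notation mR := (measurableTypeR R).
Local Notation mu := (@lebesgue_measure R).

Let aff (a c : R) : mR -> mR := fun s => a * s + c.

Let measurable_aff a c : measurable_fun setT (aff a c).
Proof.
apply: (@measurable_funD _ _ R setT (fun s : mR => a * s) (fun=> c)) => //.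
by apply: (@measurable_funM _ _ R setT (fun=> a) (fun s : mR => s)).
Qed.

Let lebesgue_measure_aff_pos a c A : 0 < a -> measurable A ->
  mu A = (a%:E * mu (aff a c @^-1` A))%E.
Proof.
move=> a0.
pose nu := mscale (NngNum (ltW a0)) (measure_function_pushforward__canonical__measure_function_Measure mu (measurable_aff a c)).
apply: (lebesgue_measure_unique (mu := nu)) => _ [[x y]] _ <-.
rewrite -[RHS]/(a%:E * mu (aff a c @^-1` `]x, y]%classic))%E.
rewrite (_ : _ @^-1` _ = `](x - c) / a, (y - c) / a]%classic); last first.
  apply/seteqP; split=> s /=; rewrite !in_itv/= /aff.
  - by move=> /andP[xs sy]; rewrite ltr_pdivrMr// ler_pdivlMr//; lra.
  - by rewrite ltr_pdivrMr// ler_pdivlMr// => /andP[xs sy]; lra.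
rewrite !lebesgue_measure_itv/= !lte_fin ltr_pM2r ?invr_gt0// ltrD2r.
case: ifPn => _; last by rewrite mule0.
rewrite -!EFinD -EFinM; congr EFin.
by field; rewrite gt_eqF.
Qed.

Lemma integral_affine (a c : R) (f : mR -> \bar R) : a != 0 ->
  measurable_fun setT f -> (forall s, (0 <= f s)%E) ->
  (\int[mu]_s f (a * s + c)%R = (`|a|^-1)%R%:E * \int[mu]_s f s)%E.
Proof.
move=> + mf f0; wlog a0 : a c / 0 < a.
  move=> H a_neq0; have [a_gt0|a_lt0|a0] := ltgtP 0 a; first exact: H.
    have -> : (\int[mu]_s f (a * s + c)%R = \int[mu]_s f ((- a) * s + c)%R)%E.
      pose h (s : mR) := f (a * s + c).
      transitivity (\int[pushforward mu (-%R : mR -> mR)]_s h s)%E.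
        by apply/esym/eq_measure_integral => A mA _; exact: lebesgue_measureN.
      rewrite ge0_integral_pushforward//.
      - by apply: eq_integral => s _ /=; rewrite /h mulrN mulNr.
      - exact: (measurableT_comp mf (measurable_aff a c)).
      - by move=> s _; exact: f0.
    by rewrite -normrN; apply: H; rewrite ?oppr_gt0 ?oppr_eq0.
  by rewrite -a0 eqxx in a_neq0.
move=> _; rewrite gtr0_norm//.
have aN0 : a \is a GRing.unit by rewrite unitfE gt_eqF.
transitivity (\int[pushforward mu (aff a c)]_s f s)%E.
  by rewrite ge0_integral_pushforward//; exact: measurable_aff.
rewrite (eq_measure_integral (mscale (NngNum (ltW (eq_ind_r is_true a0 (invr_gt0 a)))) mu)); last first.
  move=> A mA _; rewrite -[RHS]/(a^-1%:E * mu A)%E (lebesgue_measure_aff_pos c a0 mA).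
  by rewrite muleA -EFinM mulVf ?mul1e// gt_eqF.
by rewrite ge0_integral_mscale.
Qed.

End affine1.

Section flatint_affine.
Context (R : realType) (n : nat).
Local Notation mR := (measurableTypeR R).
Local Notation X := 'rV[R]_n.
Local Notation mu := (@lebesgue_measure R).
Implicit Types (i j : 'I_n) (l : seq 'I_n) (x y : X) (g h : X -> \bar R).

Lemma measurable_fun_affine (c : R) (z : X) :
  measurable_fun [set: X] (fun x => c *: x + z).
Proof.
apply: measurable_fun_row => i.
under eq_fun do rewrite !mxE.
apply: (@measurable_funD _ _ R setT (fun x : X => c * x 0 i) (fun=> z 0 i)) => //.
apply: (@measurable_funM _ _ R setT (fun=> c) (fun x : X => x 0 i)) => //.
exact: measurable_coord.
Qed.

Lemma flatint_affine l g (c : R) z x : 0 < c -> measurable_fun [set: X] g ->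
  (forall x, (0 <= g x)%E) ->
  (flatint l g (c *: x + z)%R =
   (c ^+ size l)%R%:E * flatint l (fun y => g (c *: y + z)%R) x)%E.
Proof.
move=> c0 mg g0; elim: l x => [|i l IH] x; first by rewrite /= expr0 mul1e.
rewrite [size _]/= exprS EFinM -muleA !flatint_cons.
rewrite -ge0_integralZl//; last 3 first.
- apply: measurable_flatint_upd => //.
  exact: (measurableT_comp mg (measurable_fun_affine _ _)).
- by move=> s _; exact: flatint_ge0.
- by rewrite lee_fin exprn_ge0// ltW.
under [in RHS]eq_integral => s _.
  rewrite -IH (_ : c *: upd i x s + z = upd i (c *: x + z) (c * s + z 0 i)); last first.
    by rewrite updZ -[X in _ + X](upd_id i) updD.
  over.
rewrite (@integral_affine R c (z 0 i) (fun s => flatint l g (upd i (c *: x + z)%R s)))//.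
- by rewrite gtr0_norm// muleA -EFinM mulfV ?mul1e// gt_eqF.
- by rewrite gt_eqF.
- exact: measurable_flatint_upd.
- by move=> s; exact: flatint_ge0.
Qed.

Lemma measurable_flatint_param d (T : measurableType d) l (h : T * X -> \bar R) :
  measurable_fun [set: T * X] h -> (forall z, (0 <= h z)%E) ->
  measurable_fun [set: T * X] (fun z => flatint l (fun y => h (z.1, y)) z.2).
Proof.
move=> mh h0; elim: l => [|i l IH].
  by rewrite (_ : (fun _ => _) = h)//; apply/funext => -[].
apply: (@measurable_fun_fubini_tonelli_F _ _ _ _ _ mu
  (fun z : (T * X) * mR => flatint l (fun y => h (z.1.1, y)) (upd i z.1.2 z.2))) => [|z].
  apply: (measurableT_comp (f := fun z : T * X => flatint l (fun y => h (z.1, y)) z.2)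
    (g := fun z : (T * X) * mR => (z.1.1, upd i z.1.2 z.2)) IH).
  apply: measurable_fun_pair.
    by apply: (measurableT_comp measurable_fst); exact: measurable_fst.
  apply: (measurableT_comp (@measurable_upd R n i)
    (g := fun z : (T * X) * mR => (z.1.2, z.2))).
  apply: measurable_fun_pair; last exact: measurable_snd.
  by apply: (measurableT_comp measurable_snd); exact: measurable_fst.
by apply: flatint_ge0.
Qed.

Lemma flatint_integral l (h : mR * X -> \bar R) x :
  measurable_fun [set: mR * X] h -> (forall z, (0 <= h z)%E) ->
  (flatint l (fun y => \int[mu]_t h (t, y)) x =
   \int[mu]_t flatint l (fun y => h (t, y)) x)%E.
Proof.
move=> mh h0; elim: l x => // i l IH x.
rewrite flatint_cons; under eq_integral do rewrite IH.
rewrite (@fubini_tonelli _ _ _ _ _ mu mu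
  (fun z => flatint l (fun y => h (z.2, y)) (upd i x z.1)))//; last first.
  by move=> z; exact: flatint_ge0.
apply: (measurableT_comp (f := fun z : mR * X => flatint l (fun y => h (z.1, y)) z.2)
    (g := fun z : mR * mR => (z.2, upd i x z.1)) (measurable_flatint_param l mh h0)).
apply: measurable_fun_pair; first exact: measurable_snd.
by apply: (measurableT_comp (measurable_upd1 i x)); exact: measurable_fst.
Qed.

End flatint_affine.

(** * Weighted products: the inequalities of Hoelder and Finner *)

Section real_powers.
Context (R : realType).
Implicit Types a b : R.

Lemma prod_powR_sum (J : finType) (P : pred J) a (w : J -> R) : 0 < a ->
  \prod_(j | P j) a `^ w j = a `^ (\sum_(j | P j) w j).
Proof.
move=> a0; apply/esym/(big_morph (powR a)); last by rewrite powRr0.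
by move=> u z; rewrite powRD// (gt_eqF a0) implybT.
Qed.

Lemma powR_subr1 a q : 0 < a -> a `^ q = a `^ (q - 1) * a.
Proof.
by move=> a0; rewrite -{3}(powRr1 (ltW a0)) -powRD ?subrK// (gt_eqF a0) implybT.
Qed.

Lemma powR_inv a q : 0 <= a -> a^-1 `^ q = (a `^ q)^-1.
Proof. by move=> a0; rewrite -powR_inv1// powRAC powR_inv1 ?powR_ge0. Qed.

Lemma powR_div a b q : 0 <= a -> 0 <= b -> (a / b) `^ q = a `^ q / b `^ q.
Proof. by move=> a0 b0; rewrite powRM ?invr_ge0// powR_inv. Qed.

Lemma powR_rootK a k : (0 < k)%N -> 0 <= a -> (a `^ k%:R^-1) ^+ k = a.
Proof.
move=> k0 a0; rewrite -powR_mulrn ?powR_ge0// -powRrM mulVf ?powRr1//.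
by rewrite pnatr_eq0 -lt0n.
Qed.

End real_powers.

Section weighted_amgm.
Context (R : realType) (J : finType) (P : pred J) (p : J -> R).
Hypothesis p_gt0 : forall j, P j -> 0 < p j.
Hypothesis p_sum1 : \sum_(j | P j) p j = 1.

(** Jensen's inequality for ln: with A the right-hand side, the bounds
    ln t <= t - 1 at t = x j / A, summed with weights p j, have right-hand
    sides that cancel. *)
Lemma powR_amgm (x : J -> R) : (forall j, P j -> 0 <= x j) ->
  \prod_(j | P j) x j `^ p j <= \sum_(j | P j) p j * x j.
Proof.
move=> x0; have S0 : 0 <= \sum_(j | P j) p j * x j.
  by apply: sumr_ge0 => j Pj; rewrite mulr_ge0 ?x0// ltW// p_gt0.
have [/existsP[j /andP[Pj /eqP xj0]]|] := boolP [exists j, P j && (x j == 0)].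
  by rewrite (bigD1 j)//= xj0 powR0 ?mul0r// gt_eqF// p_gt0.
rewrite negb_exists => /forallP x_neq0.
have {x_neq0}x_gt0 j : P j -> 0 < x j.
  by move=> Pj; have := x_neq0 j; rewrite Pj/= lt_neqAle eq_sym x0// => ->.
have [j0 Pj0] : exists j, P j.
  apply/existsP; apply: contraT; rewrite negb_exists => /forallP P0.
  by have := p_sum1; rewrite big_pred0 ?(rwP eqP) ?(eq_sym 0) ?oner_eq0// => j; exact/negbTE/P0.
set A := \sum_(j | P j) _ in S0 *.
have A0 : 0 < A.
  rewrite /A (bigD1 j0)//= ltr_pwDl ?mulr_gt0 ?p_gt0 ?x_gt0//.
  by apply: sumr_ge0 => j /andP[Pj _]; rewrite mulr_ge0 ?x0// ltW// p_gt0.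
rewrite (eq_bigr (fun j => expR (p j * ln (x j)))); last first.
  by move=> j Pj; rewrite /powR gt_eqF// x_gt0.
rewrite -expR_sum -[leRHS](lnK A0) ler_expR.
have : \sum_(j | P j) p j * ln (x j / A) <= \sum_(j | P j) p j * (x j / A - 1).
  apply: ler_sum => j Pj; rewrite ler_pM2l ?p_gt0//.
  rewrite -{1}(subrK 1 (x j / A)) addrC; apply: le_ln1Dx.
  by rewrite ltrBDr addNr divr_gt0// x_gt0.
have -> : \sum_(j | P j) p j * (x j / A - 1) = 0.
  under eq_bigr do rewrite mulrBr mulr1 mulrA.
  by rewrite sumrB p_sum1 -mulr_suml -/A mulfV ?subrr// gt_eqF.
rewrite (eq_bigr (fun j => p j * ln (x j) - p j * ln A)); last first.
  by move=> j Pj; rewrite ln_div ?posrE ?x_gt0// mulrBr.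
by rewrite sumrB -mulr_suml p_sum1 mul1r subr_le0.
Qed.

Local Open Scope ereal_scope.

Lemma prode_eq0 (x : J -> \bar R) j : P j -> x j = 0 -> \prod_(j | P j) x j = 0.
Proof. by move=> Pj xj0; rewrite (bigD1 j)//= xj0 mul0e. Qed.

Lemma prode_eqy (x : J -> \bar R) j : (forall j, P j -> 0 < x j) ->
  P j -> x j = +oo -> \prod_(j | P j) x j = +oo.
Proof.
move=> x0 Pj xjy; rewrite (bigD1 j)//= xjy gt0_mulye//.
by elim/big_ind : _ => // [a b|k /andP[Pk _]]; [exact: mule_gt0|exact: x0].
Qed.

(** For c j the integral of f j, this is the pointwise bound whose integral
    is Hoelder's inequality. *)
Lemma poweR_amgm (c : J -> R) (x : J -> \bar R) : (forall j, P j -> 0 < c j)%R ->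
  (forall j, P j -> 0 <= x j) ->
  \prod_(j | P j) x j `^ p j <=
  (\prod_(j | P j) c j `^ p j)%:E * \sum_(j | P j) (p j / c j)%:E * x j.
Proof.
move=> c0 x0.
have C0 : (0 < \prod_(j | P j) c j `^ p j)%R.
  by apply: prodr_gt0 => j Pj; rewrite powR_gt0// c0.
have w0 j : P j -> (0 < p j / c j)%R by move=> Pj; rewrite divr_gt0 ?p_gt0 ?c0.
have [/existsP[j /andP[Pj /eqP xjy]]|] := boolP [exists j, P j && (x j == +oo)].
  rewrite [X in _ * X](bigD1 j)//= xjy gt0_muley ?lte_fin ?w0// addye; last first.
    rewrite gt_eqF// (lt_le_trans (ltNy0))// sume_ge0// => k /andP[Pk _].
    by rewrite mule_ge0 ?x0// lee_fin ltW// w0.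
  by rewrite gt0_muley ?lte_fin// leey.
rewrite negb_exists => /forallP xy.
have xf j : P j -> x j = (fine (x j))%:E.
  move=> Pj; rewrite fineK// ge0_fin_numE ?x0// ltey.
  by have := xy j; rewrite Pj.
rewrite (eq_bigr (fun j => ((fine (x j)) `^ p j)%:E)); last first.
  by move=> j Pj; rewrite [in LHS]xf// poweR_EFin.
rewrite [X in _ * X](eq_bigr (fun j => (p j / c j * fine (x j))%:E)); last first.
  by move=> j Pj; rewrite [in LHS]xf// EFinM.
rewrite prodEFin sumEFin -EFinM lee_fin.
rewrite -ler_pdivrMl// mulrC -prodf_div.
rewrite (eq_bigr (fun j => (fine (x j) / c j) `^ p j)%R); last first.
  by move=> j Pj; rewrite powR_div ?fine_ge0 ?x0 ?ltW ?c0.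
apply: le_trans (powR_amgm _) _.
  by move=> j Pj; rewrite divr_ge0 ?fine_ge0 ?x0// ltW// c0.
by apply: ler_sum => j Pj; rewrite -mulrA (mulrC (_^-1)%R).
Qed.

Lemma emeasurable_prod d (T : measurableType d) (f : J -> T -> \bar R) :
  (forall j, P j -> measurable_fun setT (f j)) ->
  measurable_fun setT (fun t => \prod_(j | P j) f j t).
Proof.
move=> mf; rewrite (_ : (fun _ => _) = fun t => \prod_(j <- [seq j <- index_enum J | P j]) f j t); last first.
  by apply/funext => t; rewrite big_filter.
have : all P [seq j <- index_enum J | P j] by rewrite filter_all.
elim: [seq j <- index_enum J | P j] => [_|j s IH /= /andP[Pj Ps]].
  by under eq_fun do rewrite big_nil; exact: measurable_cst.
by under eq_fun do rewrite big_cons; apply: emeasurable_funM; [exact: mf|exact: IH].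
Qed.

Lemma ge0_integral_bigsum d (T : measurableType d) (mu : {measure set T -> \bar R}) (f : J -> T -> \bar R) :
  (forall j, P j -> measurable_fun setT (f j)) ->
  (forall j t, P j -> 0 <= f j t) ->
  \int[mu]_t (\sum_(j | P j) f j t) = \sum_(j | P j) \int[mu]_t f j t.
Proof.
move=> mf f0; rewrite -[RHS]big_filter.
under eq_integral do rewrite -big_filter.
have : all P [seq j <- index_enum J | P j] by rewrite filter_all.
elim: [seq j <- index_enum J | P j] => [_|j s IH /= /andP[Pj Ps]].
  by rewrite big_nil integral0_eq// => t _; rewrite big_nil.
under eq_integral do rewrite big_cons.
rewrite big_cons ge0_integralD//.
- by rewrite IH.
- by move=> t _; exact: f0.
- exact: mf.
- move=> t _; elim: s Ps {IH} => [|k s IH /= /andP[Pk Ps]]; first by rewrite big_nil.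
  by rewrite big_cons adde_ge0 ?f0// IH.
- elim: s Ps {IH} => [_|k s IH /= /andP[Pk Ps]].
    by under eq_fun do rewrite big_nil; exact: measurable_cst.
  by under eq_fun do rewrite big_cons; apply: emeasurable_funD; [exact: mf|exact: IH].
Qed.

(** Integrate [poweR_amgm] with c j the integral of f j: the weighted sum then
    has integral 1. An integral equal to 0 or to +oo is no admissible c j;
    in the first case the left side vanishes, in the second the right side is
    infinite. *)
Lemma hoelder_prod d (T : measurableType d) (mu : {measure set T -> \bar R}) (f : J -> T -> \bar R) :
  (forall j, P j -> measurable_fun setT (f j)) ->
  (forall j t, P j -> 0 <= f j t) ->
  \int[mu]_t (\prod_(j | P j) f j t `^ p j) <=
  \prod_(j | P j) (\int[mu]_t f j t) `^ p j.
Proof.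
move=> mf f0.
have mprod : measurable_fun setT (fun t => \prod_(j | P j) f j t `^ p j).
  by apply: emeasurable_prod => j Pj; apply: (measurableT_comp (measurable_poweR _)); exact: mf.
have prod0 t : 0 <= \prod_(j | P j) f j t `^ p j.
  by apply: prode_ge0 => j _; exact: poweR_ge0.
have F0 j : P j -> 0 <= \int[mu]_t f j t.
  by move=> Pj; apply: integral_ge0 => t _; exact: f0.
have [/existsP[j /andP[Pj /eqP Fj0]]|] :=
    boolP [exists j, P j && (\int[mu]_t f j t == 0)].
  rewrite (_ : \int[mu]_t _ = 0).
    by apply: prode_ge0 => k _; exact: poweR_ge0.
  rewrite (@ge0_ae_eq_integral _ _ _ mu setT _ (cst 0)) ?integral0//.
  have [N [mN N0 sN]] : ae_eq mu setT (f j) (cst 0).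
    apply/ae_eq_integral_abs => //; first exact: mf.
    by rewrite -[RHS]Fj0; apply: eq_integral => t _; rewrite gee0_abs// f0.
  exists N; split => //; apply: subset_trans sN => t /=; apply: contra_not.
  move=> + _ => /(_ Logic.I) ft0.
  by apply: (@prode_eq0 _ j) => //; rewrite ft0 poweR0r// gt_eqF// p_gt0.
rewrite negb_exists => /forallP F_neq0.
have {}F0 j : P j -> 0 < \int[mu]_t f j t.
  by move=> Pj; have := F_neq0 j; rewrite Pj/= lt_neqAle eq_sym F0// => ->.
have [/existsP[j /andP[Pj /eqP Fjy]]|] :=
    boolP [exists j, P j && (\int[mu]_t f j t == +oo)].
  rewrite (_ : \prod_(_ | _) _ = +oo) ?leey//.
  apply: (@prode_eqy _ j) => // [k Pk|]; first by rewrite poweR_gt0// F0.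
  by rewrite Fjy poweRyr// gt_eqF// p_gt0.
rewrite negb_exists => /forallP Fy.
pose c j := fine (\int[mu]_t f j t).
have cE j : P j -> \int[mu]_t f j t = (c j)%:E.
  move=> Pj; rewrite /c fineK// ge0_fin_numE ?ltW ?F0// ltey.
  by have := Fy j; rewrite Pj.
have c0 j : P j -> (0 < c j)%R by move=> Pj; rewrite -lte_fin -cE// F0.
have w0 j : P j -> (0 <= p j / c j)%R.
  by move=> Pj; rewrite divr_ge0 ?ltW ?p_gt0 ?c0.
have mw j : P j -> measurable_fun setT (fun t => (p j / c j)%:E * f j t).
  by move=> Pj; apply: measurable_funeM; exact: mf.
have C0 : (0 <= \prod_(j | P j) c j `^ p j)%R.
  by apply: prodr_ge0 => j Pj; rewrite powR_ge0.
have s0 t : 0 <= \sum_(j | P j) (p j / c j)%:E * f j t.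
  by apply: sume_ge0 => j Pj; rewrite mule_ge0 ?f0// lee_fin w0.
have ms : measurable_fun setT (fun t => \sum_(j | P j) (p j / c j)%:E * f j t).
  have -> : (fun t => \sum_(j | P j) (p j / c j)%:E * f j t) =
      fun t => \sum_(j <- index_enum J) (if P j then (p j / c j)%:E * f j t else 0).
    by apply/funext => t; rewrite -big_mkcond.
  apply: emeasurable_sum => j; have [Pj|_] := boolP (P j); first exact: mw.
  exact: measurable_cst.
apply: (@le_trans _ _ (\int[mu]_t
  ((\prod_(j | P j) c j `^ p j)%:E * \sum_(j | P j) (p j / c j)%:E * f j t))).
  apply: ge0_le_integral => //.
  - exact: measurable_funeM.
  - by move=> t _; apply: poweR_amgm => // j Pj; exact: f0.
rewrite ge0_integralZl//.
rewrite ge0_integral_bigsum//; last by move=> j t Pj; rewrite mule_ge0 ?f0// lee_fin w0.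
rewrite (eq_bigr (fun j => (p j)%:E)); last first.
  move=> j Pj; rewrite ge0_integralZl ?lee_fin ?w0//.
  - by rewrite cE// -EFinM divfK// gt_eqF// c0.
  - exact: mf.
  - by move=> t _; exact: f0.
rewrite sumEFin p_sum1 mule1 [leRHS](eq_bigr (fun j => (c j `^ p j)%:E)); last first.
  by move=> j Pj; rewrite cE.
by rewrite prodEFin.
Qed.

End weighted_amgm.

Section finner.
Context (R : realType) (n : nat) (J : finType).
Local Notation mR := (measurableTypeR R).
Local Notation X := 'rV[R]_n.
Local Notation mu := (@lebesgue_measure R).
Local Open Scope ereal_scope.

Lemma flatint_indep l (g : X -> \bar R) i x s :
  (forall y t, g (upd i y t) = g y) -> flatint l g (upd i x s) = flatint l g x.
Proof.
move=> gi; elim: l x => [|k l IH] x /=; first exact: gi.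
have [->|ki] := eqVneq k i.
  by apply: eq_integral => t _; congr flatint; apply/rowP => j; rewrite !updE; case: eqP.
by apply: eq_integral => t _; rewrite updC// IH.
Qed.

(** Finner's inequality, one coordinate i at a time: the factors with
    i \notin A j are constant in that coordinate, and the weights of the other
    factors sum to 1, so that Hoelder's inequality applies to them. *)
Lemma finner_inequality (P : pred J) (p : J -> R) (A : J -> {set 'I_n}) (g : J -> X -> \bar R) l x :
  (forall j, P j -> 0 < p j)%R ->
  (forall i, i \in l -> \sum_(j | P j) p j * (i \in A j)%:R = 1)%R ->
  uniq l ->
  (forall j, P j -> measurable_fun [set: X] (g j)) ->
  (forall j y, P j -> 0 <= g j y) ->
  (forall j i y s, P j -> i \in l -> i \notin A j -> g j (upd i y s) = g j y) ->
  flatint l (fun y => \prod_(j | P j) g j y `^ p j) x <=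
  \prod_(j | P j) (flatint [seq i <- l | i \in A j] (g j) x) `^ p j.
Proof.
move=> p0 + + mg g0; elim: l x => [//|i l IH] x pA /= /andP[il ul] gi.
have mprod : measurable_fun [set: X] (fun y => \prod_(j | P j) g j y `^ p j).
  by apply: emeasurable_prod => j Pj; apply: (measurableT_comp (measurable_poweR _)); exact: mg.
have prod0 y : 0 <= \prod_(j | P j) g j y `^ p j.
  by apply: prode_ge0 => j _; exact: poweR_ge0.
pose G j (s : mR) := flatint [seq k <- l | k \in A j] (g j) (upd i x s).
have G0 j s : P j -> 0 <= G j s.
  by move=> Pj; apply: flatint_ge0 => y; exact: g0.
have mG j : P j -> measurable_fun [set: mR] (G j).
  by move=> Pj; apply: measurable_flatint_upd => [|y]; [exact: mg|exact: g0].
have mGp j : P j -> measurable_fun [set: mR] (fun s => G j s `^ p j).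
  by move=> Pj; apply: (measurableT_comp (measurable_poweR _)); exact: mG.
apply: (@le_trans _ _ (\int[mu]_s \prod_(j | P j) G j s `^ p j)).
  apply: ge0_le_integral => //.
  - by move=> s _; exact: flatint_ge0.
  - exact: measurable_flatint_upd.
  - exact: emeasurable_prod.
  - move=> s _; apply: IH => // [k kl|j k y t Pj kl]; first by rewrite pA// inE kl orbT.
    by apply: gi => //; rewrite inE kl orbT.
pose C := \prod_(j | P j && (i \notin A j)) flatint [seq k <- l | k \in A j] (g j) x `^ p j.
rewrite (eq_integral (fun s : mR => C * \prod_(j | P j && (i \in A j)) G j s `^ p j)); last first.
  move=> s _; rewrite (bigID (fun j => i \in A j)) /= muleC; congr (_ * _).
  apply: eq_bigr => j /andP[Pj iA]; congr poweR; apply: flatint_indep => y t.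
  by apply: gi => //; rewrite mem_head.
rewrite ge0_integralZl//; last 3 first.
- by apply: emeasurable_prod => j /andP[Pj _]; exact: mGp.
- by move=> s _; apply: prode_ge0 => j _; exact: poweR_ge0.
- by apply: prode_ge0 => j _; exact: poweR_ge0.
rewrite [leRHS](bigID (fun j => i \in A j)) /= [leRHS]muleC.
rewrite [X in _ <= X * _](_ : _ = C); last first.
  by apply: eq_bigr => j /andP[Pj iA]; rewrite (negbTE iA).
apply: lee_wpmul2l; first by apply: prode_ge0 => j _; exact: poweR_ge0.
apply: le_trans (hoelder_prod _ _ _ _ _) _.
- by move=> j /andP[Pj _]; exact: p0.
- rewrite -(pA i (mem_head _ _)) big_mkcondr/=; apply: eq_bigr => j _.
  by case: ifP => _; rewrite ?mulr1 ?mulr0.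
- by move=> j /andP[Pj _]; exact: mG.
- by move=> j s /andP[Pj _]; exact: G0.
rewrite le_eqVlt; apply/orP; left; apply/eqP.
by apply: eq_bigr => j /andP[Pj ->].
Qed.

End finner.

(** * The Brunn-Minkowski inequality *)

Section line.
Context (R : realType).
Local Notation mR := (measurableTypeR R).
Local Notation mu := (@lebesgue_measure R).
Local Open Scope ereal_scope.

Lemma measurable_fun_EFin_indic d (T : measurableType d) (A : set T) :
  measurable A -> measurable_fun setT (fun t => (\1_A t)%:E : \bar R).
Proof.
by move=> /(@measurable_indic _ _ R setT); exact: (iffRL (measurable_EFinP _ _)).
Qed.

Lemma eq_EFin_indic T T' (A : set T) (B : set T') x y : (A x <-> B y) ->
  (\1_A x)%:E = (\1_B y)%:E :> \bar R.
Proof.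
move=> AB; rewrite !indicE; congr (_%:R%:E); congr nat_of_bool.
by apply/idP/idP => /set_mem/AB/mem_set.
Qed.

Lemma measure_integral_indic d (T : measurableType d) (nu : {measure set T -> \bar R}) A :
  measurable A -> nu A = \int[nu]_t (\1_A t)%:E.
Proof. by move=> mA; rewrite integral_indic// setIT. Qed.

Lemma lebesgue_measure_shift (c : R) (E : set mR) : measurable E ->
  measurable [set s : mR | E (s + c)%R] /\ mu [set s : mR | E (s + c)%R] = mu E.
Proof.
move=> mE.
have maff : measurable_fun [set: mR] (fun s : mR => s + c)%R.
  by apply: (@measurable_funD _ _ R setT (fun s : mR => s) (fun=> c)).
have mE' : measurable [set s : mR | E (s + c)%R].
  by rewrite -[X in measurable X]setTI; exact: maff.
split => //.
rewrite (measure_integral_indic mu mE') (measure_integral_indic mu mE).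
rewrite (eq_integral (fun s : mR => (\1_E (1 * s + c)%R)%:E)); last first.
  by move=> s _; rewrite mul1r.
rewrite (@integral_affine R 1%R c (fun s => (\1_E s)%:E)) ?oner_eq0//.
  by rewrite normr1 invr1 mul1e.
exact: measurable_fun_EFin_indic.
Qed.

(** E2 contains the translate of E0 by a point a of E1 close to inf E1 and the
    translate of E1 by a point b of E0 close to sup E0. These two overlap in a
    short interval only, so that their measures almost add up. *)
Lemma lebesgue_brunn_minkowski1 (E0 E1 E2 : set mR) (c : R) :
  measurable E0 -> measurable E1 -> measurable E2 ->
  E0 !=set0 -> E1 !=set0 ->
  (forall s, E0 s -> `|s| <= c)%R -> (forall s, E1 s -> `|s| <= c)%R ->
  (forall s t, E0 s -> E1 t -> E2 (s + t)%R) ->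
  mu E0 + mu E1 <= mu E2.
Proof.
move=> mE0 mE1 mE2 E0_0 E1_0 c0 c1 E012.
apply/lee_addgt0Pr => e e0.
have sup0 : has_sup (E0 : set R).
  by split=> //; exists c => s /c0; rewrite ler_norml => /andP[].
have inf1 : has_inf (E1 : set R).
  by split=> //; exists (- c)%R => s /c1; rewrite ler_norml => /andP[].
have e20 : (0 < e / 2)%R by rewrite divr_gt0.
have [b E0b bs] := sup_adherent e20 sup0.
have [a E1a ai] := inf_adherent e20 inf1.
have [mU UE] := lebesgue_measure_shift (- a) mE0.
have [mW WE] := lebesgue_measure_shift (- b) mE1.
move: UE mU WE mW; set U := [set s | _]; set W := [set s | _] => UE mU WE mW.
have UW : U `&` W `<=` `[(b + inf E1)%R, (sup E0 + a)%R]%classic.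
  move=> s [/= Us Ws]; rewrite in_itv/=; apply/andP; split.
    by rewrite -lerBrDl; apply: ge_inf => //; exact: inf1.2.
  by rewrite -lerBlDr; apply: ub_le_sup => //; exact: sup0.2.
have mUW : mu (U `&` W) <= e%:E.
  apply: (@le_trans _ _ (mu `[(b + inf E1)%R, (sup E0 + a)%R]%classic)).
    by apply: le_measure => //; rewrite inE//; exact: measurableI.
  rewrite lebesgue_measure_itv/=; case: ifP => _; last by rewrite lee_fin ltW.
  by rewrite -EFinB lee_fin; lra.
rewrite -UE -WE (measureDI mu mU mW) addeAC.
apply: leeD => //; rewrite -measureU//; last 2 first.
- exact: measurableD.
- by rewrite setIC setDIK.
apply: le_measure; rewrite ?inE//.
  by apply: measurableU => //; exact: measurableD.
move=> s [[/= Us _]|/= Ws].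
  by rewrite -(subrK a s); exact: E012.
by rewrite -(subrKC b s); exact: E012.
Qed.

(** Rescaling the levels to ]0, 1[ makes functions with different suprema
    comparable level by level. *)
Lemma layer_cake (f : mR -> \bar R) (M : R) : (0 < M)%R ->
  measurable_fun [set: mR] f -> (forall s, 0 <= f s) ->
  \int[mu]_s (mine M%:E (f s)) =
  M%:E * \int[mu]_(y in `]0%R, 1%R[) mu [set s | (M * y)%:E <= f s].
Proof.
move=> M0 mf f0.
pose D := [set z : mR * mR | (0%R < z.2 < 1%R)%R /\ (M * z.2)%:E <= f z.1].
have mD : measurable D.
  rewrite [D](_ : _ = ([set: mR] `*` `]0%R, 1%R[%classic) `&`
     [set z : mR * mR | (M * z.2)%:E <= f z.1]).
    apply: measurableI; first exact: measurableX.
    rewrite -[X in measurable X]setTI.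
    apply: measurable_lee => //.
      apply/measurable_EFinP.
      apply: (@measurable_funM _ _ R setT (fun=> M) (fun z : mR * mR => z.2)) => //.
      exact: measurable_snd.
    by apply: (measurableT_comp mf); exact: measurable_fst.
  by apply/seteqP; split=> z /=; [move=> [? ?]; split|move=> [[_ ?] ?]].
have -> : \int[mu]_s (mine M%:E (f s)) =
    \int[mu]_s (M%:E * \int[mu]_y (\1_D (s, y))%:E).
  apply: eq_integral => s _.
  pose Ds := [set y : mR | (0%R < y < 1%R)%R /\ (M * y)%:E <= f s].
  rewrite (_ : (fun y : mR => (\1_D (s, y))%:E) =
     fun y => (\1_Ds y)%:E)//.
  have key v : (0 <= v)%R -> (v <= 1)%R -> (v%:E = mu `]0%R, v] /\ v%:E = mu `]0%R, v[).
    move=> v0 v1; rewrite !lebesgue_measure_itv/= lte_fin.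
    case: ifPn => [|]; first by rewrite oppr0 addr0.
    by rewrite -leNgt => v0'; split; congr EFin; apply/le_anti; rewrite v0 v0'.
  have [fM|fM] := ltP (f s) M%:E; last first.
    rewrite (_ : Ds = `]0%R, 1%R[%classic).
      rewrite integral_indic//= setIT -(key 1%R _ _).2//.
      by rewrite mule1.
    apply/seteqP; split=> y //= => [[]//|y01]; split=> //.
    apply: le_trans fM; rewrite lee_fin ger_pMr//.
    by move: y01; rewrite in_itv/= => /andP[_ /ltW].
  case fE : (f s) (f0 s) fM => [v| |] //; rewrite lee_fin lte_fin => v0 vM.
  rewrite (_ : Ds = `]0%R, (v / M)%R]%classic).
    rewrite integral_indic//= setIT -(key (v / M)%R _ _).1.
    - by rewrite -EFinM mulrC divfK ?gt_eqF.
    - by rewrite divr_ge0// ltW.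
    - by rewrite ler_pdivrMr// mul1r ltW.
  have vE y : ((M * y)%:E <= f s) = (y <= v / M)%R.
    by rewrite fE lee_fin mulrC ler_pdivlMr.
  apply/seteqP; split=> y; rewrite /Ds/= vE in_itv/=.
    by move=> [/andP[-> _] ->].
  move=> /andP[-> yv]; split=> //=; apply: le_lt_trans yv _.
  by rewrite ltr_pdivrMr// mul1r.
have mi : measurable_fun [set: mR * mR] (fun z : mR * mR => (\1_D z)%:E : \bar R).
  exact: measurable_fun_EFin_indic.
rewrite ge0_integralZl//; last 3 first.
- by apply: (measurable_fun_fubini_tonelli_F (fun z => (\1_D z)%:E)).
- by move=> s _; exact: integral_ge0.
- by rewrite lee_fin ltW.
congr (_ * _).
rewrite (@fubini_tonelli _ _ _ _ _ mu mu (fun z => (\1_D z)%:E))//.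
rewrite [RHS]integral_mkcond; apply: eq_integral => y _; rewrite patchE.
rewrite measure_integral_indic; last first.
  by rewrite -[X in measurable X]setTI; exact: measurable_lee.
case: ifPn => [|] yI.
  apply: eq_integral => s _; rewrite !indicE; congr (_%:R%:E).
  congr nat_of_bool; rewrite /D; apply/idP/idP; rewrite !inE/=; first by move=> [].
  by move=> ?; split => //; move: yI; rewrite inE.
rewrite integral0_eq// => s _; rewrite indicE memNset//.
by move=> [/= yI' _]; move/negP: yI; apply; rewrite inE.
Qed.

End line.

Section radon.
Context (R : realType).

(** x ^+ r.+1 lies above its tangent at c. *)
Lemma exprS_tangent (x c : R) r : 0 <= x -> 0 <= c ->
  r.+1%:R * c ^+ r * x <= x ^+ r.+1 + r%:R * c ^+ r.+1.
Proof.
move=> x0 c0; elim: r => [|r IH]; first by rewrite !expr1 expr0 mul0r addr0 !mul1r.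
have xc : 0 <= (x ^+ r.+1 - c ^+ r.+1) * (x - c).
  have [xc|cx] := leP x c.
    by rewrite mulr_le0 ?subr_le0// lerXn2r.
  by rewrite mulr_ge0 ?subr_ge0 ?lerXn2r ?ltW// nnegrE ltW.
have {}IH := ler_wpM2l c0 IH.
rewrite -subr_ge0 in IH; rewrite -subr_ge0.
have -> : x ^+ r.+2 + r.+1%:R * c ^+ r.+2 - r.+2%:R * c ^+ r.+1 * x =
  (c * (x ^+ r.+1 + r%:R * c ^+ r.+1) - c * (r.+1%:R * c ^+ r * x)) +
   (x ^+ r.+1 - c ^+ r.+1) * (x - c).
  by rewrite !exprS -!natr1; ring.
exact: addr_ge0.
Qed.

(** The function x ^+ r.+1 / m ^+ r is convex and homogeneous of degree 1 in
    (x, m): add its tangent inequalities at the common slope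
    c = (a + b) / (s + t). *)
Lemma radon_inequality (a b s t : R) r : 0 <= a -> 0 <= b -> 0 < s -> 0 < t ->
  (a + b) ^+ r.+1 <= (s + t) ^+ r * (a ^+ r.+1 / s ^+ r + b ^+ r.+1 / t ^+ r).
Proof.
move=> a0 b0 s0 t0; have st0 : 0 < s + t by rewrite addr_gt0.
pose c := (a + b) / (s + t).
have c0 : 0 <= c by apply: divr_ge0; [exact: addr_ge0|exact: ltW].
have key (x m : R) : 0 <= x -> 0 < m ->
    r.+1%:R * c ^+ r * x - r%:R * c ^+ r.+1 * m <= x ^+ r.+1 / m ^+ r.
  move=> x0 m0; have mN0 : m != 0 by rewrite gt_eqF.
  have := @exprS_tangent (x / m) c r (divr_ge0 x0 (ltW m0)) c0.
  rewrite -lerBlDr => /(ler_wpM2r (ltW m0)); congr (_ <= _).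
    by rewrite mulrBl -[X in X - _ = _]mulrA divfK.
  by rewrite expr_div_n exprS [in X in _ / X]exprS invfM; field; rewrite mN0 expf_neq0.
have {key} := lerD (key a s a0 s0) (key b t b0 t0).
set lhs := (X in X <= _); have -> : lhs = (s + t) * c ^+ r.+1.
  have ab : a + b = c * (s + t) by rewrite /c divfK// gt_eqF.
  rewrite (_ : lhs = r.+1%:R * c ^+ r * (a + b) - r%:R * c ^+ r.+1 * (s + t)).
    by rewrite ab -natr1 exprS; ring.
  by rewrite /lhs; ring.
move=> /(ler_wpM2l (exprn_ge0 r (ltW st0))); apply: le_trans.
by rewrite /c expr_div_n mulrA -exprSr mulrC divfK// expf_neq0// gt_eqF.
Qed.

End radon.

Section flatvol.
Context (R : realType) (n : nat).
Local Notation mR := (measurableTypeR R).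
Local Notation X := 'rV[R]_n.
Local Notation mu := (@lebesgue_measure R).
Implicit Types (i j : 'I_n) (l : seq 'I_n) (x y : X) (g h : X -> \bar R) (A : set X).
Local Open Scope ereal_scope.

Definition flatvol l A x := flatint l (fun y => (\1_A y)%:E) x.

Lemma flatvol_ge0 l A x : 0 <= flatvol l A x.
Proof. by apply: flatint_ge0 => y; rewrite lee_fin. Qed.

Lemma measurable_flatvol l A : measurable A -> measurable_fun [set: X] (flatvol l A).
Proof.
move=> mA; apply: measurable_flatint; first exact: measurable_fun_EFin_indic.
by move=> y.
Qed.

Lemma measurable_flatvol_upd i l A x : measurable A ->
  measurable_fun [set: mR] (fun s : mR => flatvol l A (upd i x s)).
Proof.
move=> mA; apply: (measurableT_comp (measurable_flatvol l mA)); exact: measurable_upd1.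
Qed.

Lemma le_flatvol l A B x : measurable A -> measurable B ->
  (forall y, agree_off l x y -> A y -> B y) -> flatvol l A x <= flatvol l B x.
Proof.
move=> mA mB AB; apply: le_flatint => //.
- exact: measurable_fun_EFin_indic.
- exact: measurable_fun_EFin_indic.
- move=> y xy; rewrite lee_fin !indicE ler_nat.
  have [Ay|] := boolP (y \in A) => //; rewrite (mem_set (AB _ xy _))//.
  exact: set_mem.
Qed.

Lemma eq_flatvol l A B x : (forall y, agree_off l x y -> A y <-> B y) ->
  flatvol l A x = flatvol l B x.
Proof.
by move=> AB; apply: eq_flatint => y /AB; exact: eq_EFin_indic.
Qed.

Lemma flatint0 l x : flatint l (fun=> 0) x = 0 :> \bar R.
Proof. by elim: l x => // i l IH x /=; rewrite integral0_eq. Qed.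

Lemma flatint_neq0 l g x : flatint l g x != 0 -> exists2 y, agree_off l x y & g y != 0.
Proof.
apply: contraNP => H; apply/eqP; rewrite -(flatint0 l x).
apply: eq_flatint => y xy; apply/eqP; apply: contra_notT H => gy.
by exists y.
Qed.

Lemma flatvol_gt0 l A x : 0 < flatvol l A x -> exists2 y, agree_off l x y & A y.
Proof.
move=> /gt_eqF/negbT/flatint_neq0[y xy]; rewrite indicE.
by case: (boolP (y \in A)) => [/set_mem Ay _|_ /eqP//]; exists y.
Qed.

Lemma flatint_le_box l g (c : R) x : uniq l -> (0 <= c)%R -> measurable_fun [set: X] g ->
  (forall y, 0 <= g y) -> (forall y, g y <= 1) ->
  (forall y j, j \in l -> (c < `|y ord0 j|)%R -> g y = 0) ->
  flatint l g x <= ((c *+ 2) ^+ size l)%R%:E.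
Proof.
move=> + c0 mg g0 g1; elim: l x => [|i l IH] x /= ; first by rewrite expr0.
move=> /andP[il ul] gc.
pose I : set mR := `[(- c)%R, c]%classic.
have mI : measurable_fun [set: mR] (fun s : mR => (\1_I s)%:E : \bar R).
  by apply: measurable_fun_EFin_indic; exact: measurable_itv.
apply: (@le_trans _ _ (\int[mu]_s (((c *+ 2) ^+ size l)%R%:E * (\1_I s)%:E))).
  apply: ge0_le_integral => //.
  - by move=> s _; exact: flatint_ge0.
  - exact: measurable_flatint_upd.
  - exact: measurable_funeM.
  - move=> s _; rewrite indicE; have [_|sI] := boolP (s \in I).
      by rewrite mule1; apply: IH => // y j jl; apply: gc; rewrite inE jl orbT.
    rewrite mule0 le_eqVlt; apply/orP; left; apply/eqP.
    rewrite -(flatint0 l (upd i x s)); apply: eq_flatint => y xy.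
    apply: (gc _ i); rewrite ?mem_head// -xy// updE eqxx ltNge; apply: contra sI.
    by rewrite ler_norml => sc; apply/mem_set; rewrite /I/= in_itv/=.
rewrite ge0_integralZl//.
- rewrite -measure_integral_indic; last exact: measurable_itv.
  rewrite -[X in _ * X]/(mu `[(- c)%R, c]%classic) lebesgue_measure_itv/= lte_fin.
  rewrite exprS (mulrC (c *+ 2))%R EFinM.
  case: ifPn => _; first by rewrite opprK -EFinD mulr2n.
  by rewrite mule0 mule_ge0// lee_fin ?exprn_ge0 ?mulrn_wge0.
- by rewrite lee_fin exprn_ge0// mulrn_wge0.
Qed.

Lemma flatvol_le_box l A (c : R) x : uniq l -> (0 <= c)%R -> measurable A ->
  (forall y, A y -> forall j, j \in l -> `|y ord0 j| <= c)%R ->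
  flatvol l A x <= ((c *+ 2) ^+ size l)%R%:E.
Proof.
move=> ul c0 mA Ac; apply: flatint_le_box => //.
- exact: measurable_fun_EFin_indic.
- by move=> y /=; rewrite lee_fin indicE lern1 leq_b1.
- move=> y j jl cy; rewrite indicE memNset// => /Ac/(_ j jl).
  by rewrite leNgt cy.
Qed.

End flatvol.

Section brunn_minkowski.
Context (R : realType) (n : nat).
Local Notation mR := (measurableTypeR R).
Local Notation X := 'rV[R]_n.
Local Notation mu := (@lebesgue_measure R).
Implicit Types (i j : 'I_n) (l : seq 'I_n) (x y : X) (A : set X).
Local Open Scope ereal_scope.

Lemma measurable_level (f : mR -> \bar R) (M : R) : measurable_fun [set: mR] f ->
  measurable_fun [set: mR] (fun y : mR => mu [set s | (M * y)%:E <= f s]).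
Proof.
move=> mf; pose D := [set z : mR * mR | (M * z.2)%:E <= f z.1].
have mD : measurable D.
  rewrite -[X in measurable X]setTI.
  apply: measurable_lee => //.
    apply/measurable_EFinP.
    apply: (@measurable_funM _ _ R setT (fun=> M) (fun z : mR * mR => z.2)) => //.
    exact: measurable_snd.
  by apply: (measurableT_comp mf); exact: measurable_fst.
have := measurable_fun_ysection mu mD; congr (measurable_fun _ _).
apply/funext => y /=; congr (mu _); apply/seteqP; split=> s /=;
  by rewrite /ysection/= inE.
Qed.

(** The supremum of the fibre volumes, written as a power with exponent
    [size l], the form in which the Brunn-Minkowski inequality for the fibres
    takes their volumes. For l = [::] the fibre volumes are 0 or 1. *)
Lemma flatvol_sup i l A x (c : R) : uniq l -> (0 <= c)%R -> measurable A ->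
  (forall y, A y -> forall j, j \in i :: l -> `|y ord0 j| <= c)%R ->
  0 < flatvol (i :: l) A x ->
  exists m : R, [/\ (0 < m)%R,
    forall s, flatvol l A (upd i x s) <= (m ^+ size l)%:E &
    forall y : R, (0 < y < 1)%R ->
      exists s, ((m ^+ size l) * y)%:E <= flatvol l A (upd i x s)].
Proof.
move=> ul c0 mA Ac Vgt0.
pose f (s : mR) := flatvol l A (upd i x s).
pose S := ereal_sup (range f).
have fS s : f s <= S by apply: ereal_sup_ubound; exists s.
have S_gt0 : 0 < S.
  rewrite ltNge; apply: contraTN Vgt0 => S0; rewrite -leNgt /flatvol flatint_cons.
  rewrite integral0_eq// => s _; apply/le_anti; rewrite (le_trans (fS s) S0).
  exact: flatvol_ge0.
have S_fin : S <= ((c *+ 2) ^+ size l)%R%:E.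
  apply: ub_ereal_sup => _ [s _ <-]; apply: flatvol_le_box => // y Ay j jl.
  by apply: Ac => //; rewrite inE jl orbT.
have SE : S = (fine S)%:E.
  by rewrite fineK// ge0_fin_numE ?ltW// (le_lt_trans S_fin)// ltry.
have N0 : (0 < fine S)%R by rewrite -lte_fin -SE.
have [m m0 mS] : exists2 m : R, (0 < m)%R & (m ^+ size l)%R = fine S.
  case: l @f @S fS S_gt0 {S_fin ul Vgt0 Ac} SE N0 => [|k l] f S fS S_gt0 SE N0.
    exists 1%R => //; rewrite expr0; apply: EFin_inj; rewrite -SE.
    apply/le_anti/andP; split; last first.
      apply: ub_ereal_sup => _ [s _ <-].
      by rewrite /f/flatvol/= lee_fin indicE lern1 leq_b1.
    have [_ [s _ <-] fs0] := ereal_sup_gt S_gt0.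
    apply: le_trans (fS s); move: fs0; rewrite /f/flatvol/= lte_fin indicE.
    by rewrite lee_fin; case: (_ \in _); rewrite ?ltxx ?lexx.
  exists (fine S `^ (size (k :: l))%:R^-1)%R; first by rewrite powR_gt0.
  by rewrite powR_rootK// ltW.
exists m; rewrite mS -SE; split => // y /andP[y0 y1].
have : (fine S * y)%:E < S by rewrite SE lte_fin gtr_pMr.
by move=> /ereal_sup_gt[_ [s _ <-] ys]; exists s; exact: ltW.
Qed.

(** Induction on the number of coordinates. Let m0 ^+ r and m1 ^+ r be the
    suprema of the fibre volumes of A0 and A1. By the induction hypothesis with
    u := y, the fibre volumes of A2 have a superlevel set at (m0 + m1) ^+ r * y
    that contains the sum of those of A0 at m0 ^+ r * y and of A1 at
    m1 ^+ r * y. The one-dimensional inequality at each level y, the layer-cake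
    formula and [radon_inequality] give the claim. *)
Lemma brunn_minkowski_gen l A0 A1 A2 (c a b u : R) x0 x1 : uniq l ->
  measurable A0 -> measurable A1 -> measurable A2 -> (0 <= c)%R ->
  (forall y, A0 y -> forall j, j \in l -> `|y ord0 j| <= c)%R ->
  (forall y, A1 y -> forall j, j \in l -> `|y ord0 j| <= c)%R ->
  (forall y z, A0 y -> A1 z -> A2 (y + z)%R) ->
  (0 < a)%R -> (0 < b)%R -> (0 < u)%R ->
  (a ^+ size l * u)%:E <= flatvol l A0 x0 ->
  (b ^+ size l * u)%:E <= flatvol l A1 x1 ->
  ((a + b) ^+ size l * u)%:E <= flatvol l A2 (x0 + x1)%R.
Proof.
move=> + mA0 mA1 mA2 c0 + + A012.
elim: l a b u x0 x1 => [|i l IH] a b u x0 x1 /=.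
  move=> _ _ _ _ _ u0; rewrite !expr0 !mul1r /flatvol/= !indicE !lee_fin.
  have [/set_mem A0x|_] := boolP (x0 \in A0); last by move=> *; move: u0; rewrite ltNge => /negP.
  have [/set_mem A1x|_] := boolP (x1 \in A1); last by move=> *; move: u0; rewrite ltNge => /negP.
  by rewrite (mem_set (A012 _ _ A0x A1x)).
move=> /andP[il ul] A0c A1c a0 b0 u0 V0 V1.
have V0gt0 : 0 < flatvol (i :: l) A0 x0.
  by apply: lt_le_trans V0; rewrite lte_fin mulr_gt0// exprn_gt0.
have V1gt0 : 0 < flatvol (i :: l) A1 x1.
  by apply: lt_le_trans V1; rewrite lte_fin mulr_gt0// exprn_gt0.
have [m0 [m0gt0 m0sup m0ex]] := flatvol_sup ul c0 mA0 A0c V0gt0.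
have [m1 [m1gt0 m1sup m1ex]] := flatvol_sup ul c0 mA1 A1c V1gt0.
set r := size l in m0sup m0ex m1sup m1ex V0 V1 *.
pose f0 (s : mR) := flatvol l A0 (upd i x0 s).
pose f1 (s : mR) := flatvol l A1 (upd i x1 s).
pose f2 (s : mR) := flatvol l A2 (upd i (x0 + x1)%R s).
have mf0 : measurable_fun [set: mR] f0 by exact: measurable_flatvol_upd.
have mf1 : measurable_fun [set: mR] f1 by exact: measurable_flatvol_upd.
have mf2 : measurable_fun [set: mR] f2 by exact: measurable_flatvol_upd.
pose m2 := (m0 + m1)%R.
pose J (f : mR -> \bar R) (m : R) :=
  \int[mu]_(y in `]0%R, 1%R[) mu [set s | (m ^+ r * y)%:E <= f s].
have m2gt0 : (0 < m2)%R by rewrite addr_gt0.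
have E0 : flatvol (i :: l) A0 x0 = (m0 ^+ r)%:E * J f0 m0.
  rewrite /J -layer_cake//; [|by rewrite exprn_gt0|by move=> s; exact: flatvol_ge0].
  by apply: eq_integral => s _; apply/esym/min_idPr; exact: m0sup.
have E1 : flatvol (i :: l) A1 x1 = (m1 ^+ r)%:E * J f1 m1.
  rewrite /J -layer_cake//; [|by rewrite exprn_gt0|by move=> s; exact: flatvol_ge0].
  by apply: eq_integral => s _; apply/esym/min_idPr; exact: m1sup.
have E2 : (m2 ^+ r)%:E * J f2 m2 <= flatvol (i :: l) A2 (x0 + x1)%R.
  rewrite /J -layer_cake//; [|by rewrite exprn_gt0|by move=> s; exact: flatvol_ge0].
  apply: ge0_le_integral => //.
  - by move=> s _; rewrite le_min flatvol_ge0 lee_fin exprn_ge0// ltW.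
  - by apply: measurable_mine => //; exact: measurable_cst.
  - by move=> s _; rewrite ge_min lexx orbT.
have J012 : J f0 m0 + J f1 m1 <= J f2 m2.
  rewrite /J -ge0_integralD//; last 2 first.
  - by apply: measurable_funTS; exact: measurable_level.
  - by apply: measurable_funTS; exact: measurable_level.
  apply: ge0_le_integral => //.
  - by move=> y _; exact: adde_ge0.
  - by apply: measurable_funTS; apply: emeasurable_funD; exact: measurable_level.
  - by apply: measurable_funTS; exact: measurable_level.
  move=> y /=; rewrite in_itv/= => y01; have /andP[y0 y1] := y01.
  have mlev (f : mR -> \bar R) (M : R) : measurable_fun [set: mR] f ->
      measurable [set s : mR | M%:E <= f s].
    move=> mf; rewrite -[X in measurable X]setTI; apply: measurable_lee => //.
  have bnd A x s : (forall y, A y -> forall j, j \in i :: l -> `|y ord0 j| <= c)%R ->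
      0 < flatvol l A (upd i x s) -> (`|s| <= c)%R.
    move=> Ac /flatvol_gt0[z xz /Ac/(_ i (mem_head _ _))]; rewrite -xz//.
    by rewrite updE eqxx.
  apply: (@lebesgue_brunn_minkowski1 _ _ _ _ c); try exact: mlev.
  - exact: m0ex.
  - exact: m1ex.
  - move=> s /= h; apply: (bnd _ _ _ A0c); apply: lt_le_trans h.
    by rewrite lte_fin mulr_gt0// exprn_gt0.
  - move=> s /= h; apply: (bnd _ _ _ A1c); apply: lt_le_trans h.
    by rewrite lte_fin mulr_gt0// exprn_gt0.
  - move=> s t /= h0 h1; rewrite /f2 -updD.
    apply: IH => // z Az k kl; [apply: A0c|apply: A1c] => //; by rewrite inE kl orbT.
apply: le_trans E2.
have m0r : (0 < m0 ^+ r)%R by rewrite exprn_gt0.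
have m1r : (0 < m1 ^+ r)%R by rewrite exprn_gt0.
have h0 : (a ^+ r.+1 * u / m0 ^+ r)%:E <= J f0 m0.
  by rewrite mulrC EFinM muleC lee_pdivrMr// muleC -E0.
have h1 : (b ^+ r.+1 * u / m1 ^+ r)%:E <= J f1 m1.
  by rewrite mulrC EFinM muleC lee_pdivrMr// muleC -E1.
apply: (@le_trans _ _ ((m2 ^+ r)%:E * ((a ^+ r.+1 * u / m0 ^+ r)%:E + (b ^+ r.+1 * u / m1 ^+ r)%:E))).
  rewrite -EFinD -EFinM lee_fin.
  have := radon_inequality r (ltW a0) (ltW b0) m0gt0 m1gt0.
  move=> /(ler_wpM2r (ltW u0)) /le_trans; apply.
  by rewrite le_eqVlt; apply/orP; left; apply/eqP; rewrite /m2; field; rewrite ?gt_eqF.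
apply: lee_wpmul2l; first by rewrite lee_fin exprn_ge0// ltW.
by apply: le_trans J012; exact: leeD.
Qed.

Lemma brunn_minkowski l A0 A1 A2 (c a b : R) x0 x1 : uniq l ->
  measurable A0 -> measurable A1 -> measurable A2 -> (0 <= c)%R ->
  (forall y, A0 y -> forall j, j \in l -> `|y ord0 j| <= c)%R ->
  (forall y, A1 y -> forall j, j \in l -> `|y ord0 j| <= c)%R ->
  (forall y z, A0 y -> A1 z -> A2 (y + z)%R) ->
  (0 < a)%R -> (0 < b)%R ->
  (a ^+ size l)%:E <= flatvol l A0 x0 ->
  (b ^+ size l)%:E <= flatvol l A1 x1 ->
  ((a + b) ^+ size l)%:E <= flatvol l A2 (x0 + x1)%R.
Proof.
move=> ul mA0 mA1 mA2 c0 A0c A1c A012 a0 b0 V0 V1; rewrite -[(_ ^+ _)%R]mulr1.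
by apply: (brunn_minkowski_gen ul mA0 mA1 mA2 c0) => //; rewrite mulr1.
Qed.

End brunn_minkowski.

(** * Berwald's inequality *)

Section berwald_weights.
Context (R : realType).
Local Notation mR := (measurableTypeR R).
Local Notation mu := (@lebesgue_measure R).
Local Open Scope ereal_scope.

(** The density of the measure d(t ^+ s) on the positive half-line. *)
Definition pow_weight s (t : R) : R := if (0 < t)%R then (s%:R * t ^+ s.-1)%R else 0%R.

(** For 0 <= t, the relative volume of {h >= t} when h is the affine function
    on a k-dimensional cone with value N at the apex and 0 on the base. *)
Definition cone_weight (N : R) k (t : R) : R :=
  if (t <= N)%R then ((1 - t / N) ^+ k)%R else 0%R.

Lemma pow_weight_ge0 s t : (0 <= pow_weight s t)%R.
Proof. by rewrite /pow_weight; case: ifPn => // t0; rewrite mulr_ge0// exprn_ge0// ltW. Qed.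

Lemma cone_weight_ge0 N k t : (0 < N)%R -> (0 <= cone_weight N k t)%R.
Proof.
move=> N0; rewrite /cone_weight; case: ifPn => // tN.
by rewrite exprn_ge0// subr_ge0 ler_pdivrMr// mul1r.
Qed.

Lemma measurable_pow_weight s : measurable_fun [set: mR] (fun t : mR => (pow_weight s t)%:E : \bar R).
Proof.
apply/measurable_EFinP; apply: measurable_fun_ifT => //=.
  exact: measurable_fun_ltr.
by apply: (@measurable_funM _ _ R setT (fun=> s%:R%R) (fun t : mR => t ^+ s.-1)%R).
Qed.

Lemma measurable_cone_weight N k : measurable_fun [set: mR] (fun t : mR => (cone_weight N k t)%:E : \bar R).
Proof.
apply/measurable_EFinP; apply: measurable_fun_ifT => //=.
  exact: measurable_fun_ler.
apply: measurable_funX.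
apply: (@measurable_funB _ _ R setT (fun=> 1%R) (fun t : mR => t / N)%R) => //.
exact: (@measurable_funM _ _ R setT (fun t : mR => t) (fun=> N^-1)%R).
Qed.

(** Substituting N t for t gives a beta integral. *)
Lemma integral_cone_weight (N : R) s k : (0 < N)%R ->
  \int[mu]_t (pow_weight s.+1 t * cone_weight N k t)%:E =
  (N ^+ s.+1 / 'C(k + s.+1, s.+1)%:R)%R%:E.
Proof.
move=> N0.
pose G (t : mR) : \bar R := (pow_weight s.+1 t * cone_weight N k t)%:E.
have mG : measurable_fun [set: mR] G.
  under [G]eq_fun do rewrite /G EFinM.
  by apply: emeasurable_funM; [exact: measurable_pow_weight|exact: measurable_cone_weight].
have G0 t : 0 <= G t.
  by rewrite lee_fin mulr_ge0 ?pow_weight_ge0// cone_weight_ge0.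
have NN0 : N != 0%R by rewrite gt_eqF.
have := @integral_affine R N 0%R G NN0 mG G0.
rewrite gtr0_norm// => /(congr1 (fun e => N%:E * e)).
rewrite muleA -EFinM mulfV// mul1e => <-.
pose XM : R -> R := XMonemX s k.
transitivity (N%:E * ((s.+1%:R * N ^+ s)%:E * \int[mu]_(t in `]0%R, 1%R]) (XM t)%:E)).
  congr (_ * _).
  have mXM : measurable_fun (`]0%R, 1%R]%classic : set mR) (fun t : mR => (XM t)%:E : \bar R).
    by apply/measurable_EFinP; exact: measurable_XMonemX.
  have XM0 t : t \in `]0%R, 1%R] -> 0 <= (XM t)%:E.
    by rewrite in_itv/= => /andP[t0 t1]; rewrite lee_fin XMonemX_ge0// in_itv/= ltW.
  rewrite -ge0_integralZl//; last by rewrite lee_fin mulr_ge0// exprn_ge0// ltW.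
  rewrite [RHS]integral_mkcond; apply: eq_integral => t _.
  rewrite addr0 patchE /G /pow_weight pmulr_rgt0// /cone_weight.
  rewrite (mulrC N t) ger_pMl// mulfK//.
  have [t01|t01] := boolP (t \in `]0%R, 1%R]%classic).
    have /andP[-> ->] : (0 < t <= 1)%R by move: t01; rewrite inE/= in_itv.
    by rewrite -EFinM /XM /XMonemX /unstable.onem/= exprMn; congr EFin; ring.
  case: ifPn => t0; last by rewrite mul0r.
  case: ifPn => t1; last by rewrite mulr0.
  by move/negP: t01; case; rewrite inE/= in_itv/= t0 t1.
have -> : \int[mu]_(t in `]0%R, 1%R]) (XM t)%:E = (beta_fun s.+1 k.+1)%:E.
  rewrite integral_itv_obnd_cbnd; last first.
    by apply/measurable_EFinP; exact: measurable_XMonemX.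
  rewrite EFin_beta_fun/= integral_mkcond; apply: eq_integral => t _.
  by rewrite !patchE; case: ifP.
rewrite beta_fun_fact -!EFinM; congr EFin.
have CE : ('C(k + s.+1, s.+1)%:R * (s.+1%:R * s`!%:R * k`!%:R))%R = (s + k).+1`!%:R :> R.
  have := @bin_fact (k + s.+1) s.+1 (leq_addl _ _).
  by rewrite addnK addnS addnC factS => <-; rewrite !natrM.
have C0 : ('C(k + s.+1, s.+1)%:R != 0 :> R)%R by rewrite pnatr_eq0 -lt0n bin_gt0 leq_addl.
have F0 : ((s + k).+1`!%:R != 0 :> R)%R by rewrite pnatr_eq0 -lt0n fact_gt0.
apply: (mulIf F0); rewrite mulrA mulrA divfK// -CE natrM exprS.
by field.
Qed.

Lemma integral_pow_weight s (H : R) : (0 <= H)%R ->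
  \int[mu]_t ((pow_weight s.+1 t)%:E * (\1_[set t : mR | (t <= H)%R] t)%:E) = (H ^+ s.+1)%:E.
Proof.
rewrite le_eqVlt => /predU1P[<-|H0].
  rewrite expr0n/= integral0_eq// => t _; rewrite /pow_weight.
  case: ifPn => t0; last by rewrite mul0e.
  by rewrite indicE memNset ?mule0//= leNgt t0.
rewrite (_ : (H ^+ s.+1)%:E = (H ^+ s.+1 / 'C(0 + s.+1, s.+1)%:R)%R%:E); last first.
  by rewrite add0n binn divr1.
rewrite -integral_cone_weight//; apply: eq_integral => t _.
rewrite -EFinM; congr (_ * _)%:E; rewrite /cone_weight expr0 indicE.
case: ifPn => tH; first by rewrite mem_set.
by rewrite memNset//=; exact/negP.
Qed.

End berwald_weights.

Section berwald.
Context (R : realType) (n : nat).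
Local Notation mR := (measurableTypeR R).
Local Notation X := 'rV[R]_n.
Local Notation mu := (@lebesgue_measure R).
Implicit Types (i j : 'I_n) (l : seq 'I_n) (x y : X) (A : set X).
Local Open Scope ereal_scope.

Lemma measurable_dilate A (c : R) : measurable A ->
  measurable [set y : X | A (c^-1 *: y)%R].
Proof.
move=> mA; rewrite [X in measurable X](_ : _ = setT `&` (fun y : X => c^-1 *: y + 0)%R @^-1` A).
  exact: measurable_fun_affine.
by apply/seteqP; split=> y /=; rewrite addr0; [|case].
Qed.

Lemma flatvol_dilate l A (c : R) x : (0 < c)%R -> measurable A ->
  flatvol l [set y | A (c^-1 *: y)%R] (c *: x)%R = (c ^+ size l)%:E * flatvol l A x.
Proof.
move=> c0 mA; have mA' := measurable_dilate c mA.
rewrite /flatvol -[X in flatint _ _ X]addr0 flatint_affine//; last first.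
  exact: measurable_fun_EFin_indic.
congr (_ * _); apply: eq_flatint => y _; rewrite addr0.
by apply: eq_EFin_indic; rewrite /= scalerA mulVf ?gt_eqF// scale1r.
Qed.

(** For the empty list a positive volume is 1, and so is its root. *)
Lemma flatvol_root l A (v : R) x : flatvol l A x = v%:E -> (0 < v)%R ->
  exists2 a : R, (0 < a)%R & (a ^+ size l)%R = v.
Proof.
case: l => [|i l] + v0.
  rewrite /flatvol/= indicE => -[vE]; exists 1%R => //.
  by move: v0; rewrite -vE expr0; case: (_ \in _) => //; rewrite ltxx.
move=> _; exists (v `^ (size (i :: l))%:R^-1)%R; first by rewrite powR_gt0.
by rewrite powR_rootK// ltW.
Qed.

Section one_body.
Variables (l : seq 'I_n) (L : set X) (h : X -> R) (c B v : R) (x : X).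
Hypotheses (ul : uniq l) (mL : measurable L) (c0 : (0 <= c)%R).
Hypothesis Lc : forall y, L y -> forall j, j \in l -> (`|y ord0 j| <= c)%R.
Hypotheses (mh : measurable_fun [set: X] (fun y => (h y)%:E)).
Hypotheses (h0 : forall y, (0 <= h y)%R) (hB : forall y, (h y <= B)%R).
Hypothesis hL : forall y, (0 < h y)%R -> L y.
(* Concavity along segments with the contribution of y left out. Roots of
   fibre volumes have this property by convexity alone. *)
Hypothesis hconc : forall y z t, L y -> L z -> (0 < t < 1)%R ->
  (t * h z <= h ((1 - t) *: y + t *: z))%R.
Hypotheses (v0 : (0 < v)%R) (vE : flatvol l L x = v%:E).

Let k := size l.
Let phi (t : R) := flatvol l [set y | (t <= h y)%R] x.

Let mlev t : measurable [set y : X | (t <= h y)%R].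
Proof.
rewrite [X in measurable X](_ : _ = setT `&` [set y | t%:E <= (h y)%:E]).
  by apply: measurable_lee.
by apply/seteqP; split=> y /=; rewrite lee_fin; [|case].
Qed.

Let phi_fin t : (0 < t)%R -> exists2 w : R, phi t = w%:E & (0 <= w)%R.
Proof.
move=> t0; have pv : phi t <= v%:E.
  by rewrite -vE; apply: le_flatvol => // y _ /(lt_le_trans t0); exact: hL.
have p0 : 0 <= phi t by exact: flatvol_ge0.
exists (fine (phi t)); last exact: fine_ge0.
by rewrite fineK// ge0_fin_numE// (le_lt_trans pv)// ltry.
Qed.

(** If h has more than the volume of the cone above the level u, it has at
    least that of the cone above every lower level t: with s = t / u, the set
    {h >= t} contains (1 - s) L + s {h >= u}, and the Brunn-Minkowski
    inequality bounds its volume from below. *)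
Let crossing (N t u : R) : (0 < N)%R -> (0 < t < u)%R ->
  (v * cone_weight N k u)%:E < phi u -> (v * cone_weight N k t)%:E <= phi t.
Proof.
move=> N0 /andP[t0 tu] Hu; have u0 := lt_trans t0 tu.
rewrite /cone_weight; case: ifPn => [tN|_]; last by rewrite mulr0 flatvol_ge0.
have [w wE w0] := phi_fin u0.
have {}w0 : (0 < w)%R.
  rewrite -lte_fin -wE; apply: le_lt_trans Hu.
  by rewrite lee_fin mulr_ge0 ?cone_weight_ge0// ltW.
have [a a0 aE] := flatvol_root vE v0.
(* For u < N, b is the root of the cone's volume above u; for N <= u that
   volume vanishes and b is the root of phi u. *)
have [b [b0 bE bN]] : exists b : R, [/\ (0 < b)%R, (b ^+ k)%:E <= phi u & (a * (1 - u / N) <= b)%R].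
  have [uN|Nu] := ltP u N.
    exists (a * (1 - u / N))%R; split => //.
      by rewrite mulr_gt0// subr_gt0 ltr_pdivrMr// mul1r.
    rewrite exprMn aE; apply: ltW; move: Hu.
    by rewrite /cone_weight ltW.
  have [b b0 bE] := flatvol_root wE w0; exists b; split => //.
    by rewrite bE wE.
  apply: le_trans (ltW b0); rewrite pmulr_rle0// subr_le0.
  by rewrite ler_pdivlMr// mul1r.
pose s := (t / u)%R.
have s0 : (0 < s)%R by rewrite divr_gt0.
have s1 : (0 < 1 - s)%R by rewrite subr_gt0 ltr_pdivrMr// mul1r.
have s01 : (0 < s < 1)%R by rewrite s0 -subr_gt0.
have tsu : t = (s * u)%R by rewrite /s divfK// gt_eqF.
pose A0 := [set y : X | L ((1 - s)^-1 *: y)%R].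
pose A1 := [set y : X | [set y | (u <= h y)%R] (s^-1 *: y)%R].
have mA0 : measurable A0 by exact: measurable_dilate.
have mA1 : measurable A1 by exact: measurable_dilate.
have bndd (e : R) y j : (0 < e)%R -> (e <= 1)%R -> j \in l -> L (e^-1 *: y)%R -> (`|y ord0 j| <= c)%R.
  move=> e0 e1 jl /Lc/(_ j jl); rewrite mxE normrM gtr0_norm ?invr_gt0//.
  rewrite mulrC ler_pdivrMr// => /le_trans; apply.
  by rewrite ler_piMr.
have s1' : (1 - s <= 1)%R by lra.
have s1'' : (s <= 1)%R by lra.
have := @brunn_minkowski R n l A0 A1 [set y | (t <= h y)%R] c
  ((1 - s) * a) (s * b) ((1 - s) *: x) (s *: x) ul mA0 mA1 (mlev t) c0.
rewrite -scalerDl subrK scale1r => bm.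
apply: (@le_trans _ _ ((((1 - s) * a + s * b) ^+ size l)%R)%:E); last first.
  apply: bm.
  - by move=> y Ly j jl; exact: (bndd _ _ _ s1).
  - by move=> y /= uy j jl; apply: (bndd _ _ _ s0) => //; apply: hL; exact: lt_le_trans uy.
  - move=> y z /= Ly uz; rewrite tsu.
    have Lz : L (s^-1 *: z)%R by apply: hL; exact: lt_le_trans uz.
    have := hconc Ly Lz s01; rewrite !scalerA !divff ?gt_eqF// !scale1r.
    by apply: le_trans; rewrite ler_pM2l.
  - by rewrite mulr_gt0.
  - by rewrite mulr_gt0.
  - by rewrite flatvol_dilate// vE -EFinM lee_fin exprMn aE.
  - rewrite flatvol_dilate// -/(phi u) exprMn EFinM; apply: lee_wpmul2l => //.
    by rewrite lee_fin exprn_ge0// ltW.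
rewrite lee_fin -aE -exprMn; apply: lerXn2r; rewrite ?nnegrE.
- by rewrite mulr_ge0 ?(ltW a0)// subr_ge0 ler_pdivrMr// mul1r.
- by rewrite addr_ge0// mulr_ge0// ltW.
- have -> : (1 - t / N = (1 - s) + s * (1 - u / N))%R by rewrite tsu; ring.
  by rewrite mulrDr (mulrC a (1 - s)%R) lerD2l mulrCA ler_pM2l.
Qed.

Let mgraph : measurable [set z : mR * X | z.1%:E <= (h z.2)%:E].
Proof.
rewrite -[X in measurable X]setTI; apply: measurable_lee => //.
  by apply/measurable_EFinP; exact: measurable_fst.
by apply: (measurableT_comp mh); exact: measurable_snd.
Qed.

Let flatint_pow q : flatint l (fun y => (h y ^+ q.+1)%:E) x =
  \int[mu]_t ((pow_weight q.+1 t)%:E * phi t).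
Proof.
pose D := [set z : mR * X | z.1%:E <= (h z.2)%:E].
pose F (z : mR * X) : \bar R := (pow_weight q.+1 z.1)%:E * (\1_D z)%:E.
have mF : measurable_fun [set: mR * X] F.
  apply: emeasurable_funM; last exact: measurable_fun_EFin_indic.
  by apply: (measurableT_comp (@measurable_pow_weight R q.+1)); exact: measurable_fst.
have F0 z : 0 <= F z.
  by rewrite mule_ge0// lee_fin ?pow_weight_ge0// indicE.
transitivity (flatint l (fun y => \int[mu]_t F (t, y)) x).
  apply: eq_flatint => y _; rewrite -integral_pow_weight//; apply: eq_integral => t _.
rewrite flatint_integral//; apply: eq_integral => t _.
rewrite /phi /flatvol -flatintZl ?pow_weight_ge0//; last exact: measurable_fun_EFin_indic.
Qed.

Let measurable_phi : measurable_fun [set: mR] (fun t : mR => phi t).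
Proof.
have mi := measurable_fun_EFin_indic (R := R) mgraph.
have mp := @measurable_flatint_param R n _ _ l _ mi (fun z => ltac:(by rewrite lee_fin indicE)).
have mt : measurable_fun [set: mR] (fun t : mR => (t, x)).
  by apply: measurable_fun_pair => //; exact: measurable_cst.
exact: (measurableT_comp mp mt).
Qed.

(** Here N is the height of the cone for which the moment of order q + 1 is
    the same, J. By [crossing], the distribution functions phi of h and psi of
    the cone satisfy psi <= phi below some level t0 and phi <= psi above it, so
    (t ^+ (r - q) - t0 ^+ (r - q)) * (psi t - phi t) is nonnegative. In its
    integral against t ^+ q the moments of order q + 1 cancel, which leaves the
    comparison of the moments of order r + 1. *)
Lemma berwald (N J : R) q r : (q <= r)%N -> (0 < N)%R ->
  flatint l (fun y => (h y ^+ q.+1)%:E) x = J%:E ->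
  (N ^+ q.+1 = 'C(k + q.+1, q.+1)%:R * J / v)%R ->
  flatint l (fun y => (h y ^+ r.+1)%:E) x <= (v * N ^+ r.+1 / 'C(k + r.+1, r.+1)%:R)%:E.
Proof.
move=> qr N0 JE NE.
pose psi t := (v * cone_weight N k t)%R.
pose U := [set t : R | (0 < t)%R /\ (psi t)%:E < phi t].
have UB t : U t -> (t <= B)%R.
  move=> [t0 tU]; have /flatvol_gt0[y _ /= ty] : 0 < phi t.
    apply: le_lt_trans tU; rewrite lee_fin mulr_ge0 ?cone_weight_ge0// ltW//.
  exact: le_trans (hB y).
have phi0 t : 0 <= phi t by exact: flatvol_ge0.
have psi0 t : (0 <= psi t)%R by rewrite mulr_ge0 ?cone_weight_ge0// ltW.
pose t0 := sup U.
have t0_ge0 : (0 <= t0)%R.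
  have [[u Uu]|/set0P/negP/negPn/eqP U0] := pselect (U !=set0); last first.
    by rewrite /t0 U0 sup0.
  apply: le_trans (ltW Uu.1) _; apply: ub_le_sup => //.
  by exists B => t /UB.
have below t : (0 < t)%R -> (t < t0)%R -> (psi t)%:E <= phi t.
  move=> tgt0 tt0.
  have [Une|/set0P/negP/negPn/eqP U0] := pselect (U !=set0); last first.
    by move: tt0; rewrite /t0 U0 sup0 ltNge ltW.
  have tt0' : (0 < t0 - t)%R by rewrite subr_gt0.
  have [u Uu] := sup_adherent tt0' (conj Une (ex_intro _ B UB)).
  rewrite -/t0 subKr => tu.
  by apply: (@crossing N t u) => //; [rewrite tgt0|exact: Uu.2].
have above t : (0 < t)%R -> (t0 < t)%R -> phi t <= (psi t)%:E.
  move=> tgt0 t0t; rewrite leNgt; apply/negP => Ut.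
  move: t0t; rewrite ltNge => /negP; apply; apply: ub_le_sup.
    by exists B => u /UB.
  by split.
(* With this factor the densities of the moments r + 1 and q + 1 agree at
   t0. *)
pose C := (r.+1%:R / q.+1%:R * t0 ^+ (r - q))%R.
have C0 : (0 <= C)%R by rewrite mulr_ge0// ?divr_ge0// exprn_ge0.
pose W s t := pow_weight (R := R) s t.
have pointwise t : (W r.+1 t)%:E * phi t + C%:E * ((W q.+1 t)%:E * (psi t)%:E) <=
    (W r.+1 t)%:E * (psi t)%:E + C%:E * ((W q.+1 t)%:E * phi t).
  have [tgt0|tle0] := ltP 0%R t; last first.
    by rewrite /W /pow_weight ltNge tle0/= !mul0e.
  have [w wE w0] := phi_fin tgt0.
  have := below t tgt0; have := above t tgt0; rewrite wE.
  rewrite -!EFinM -!EFinD !lee_fin /W /pow_weight tgt0/= => ab be.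
  rewrite -subr_ge0.
  have -> : (r.+1%:R * t ^+ r * psi t + C * (q.+1%:R * t ^+ q * w) -
      (r.+1%:R * t ^+ r * w + C * (q.+1%:R * t ^+ q * psi t)) =
      r.+1%:R * t ^+ q * ((t ^+ (r - q) - t0 ^+ (r - q)) * (psi t - w)))%R.
    have -> : (t ^+ r = t ^+ (r - q) * t ^+ q)%R by rewrite -exprD subnK.
    have : (q.+1%:R != 0 :> R)%R by rewrite pnatr_eq0.
    by rewrite /C; move: (q.+1%:R)%R (r.+1%:R)%R => q1 r1 q10; field.
  apply: mulr_ge0; first by rewrite mulr_ge0// exprn_ge0// ltW.
  have [tt0|tt0|<-] := ltgtP t t0; last by rewrite subrr mul0r.
    rewrite mulr_le0// subr_le0 ?be//.
    by apply: lerXn2r; rewrite ?nnegrE// ltW.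
  rewrite mulr_ge0// subr_ge0 ?ab//.
  by apply: lerXn2r; rewrite ?nnegrE// ltW.
have mW s : measurable_fun [set: mR] (fun t : mR => (W s t)%:E : \bar R).
  exact: measurable_pow_weight.
have mpsi : measurable_fun [set: mR] (fun t : mR => (psi t)%:E : \bar R).
  under eq_fun do rewrite /psi EFinM.
  by apply: measurable_funeM; exact: measurable_cone_weight.
have mWphi s : measurable_fun [set: mR] (fun t : mR => (W s t)%:E * phi t : \bar R).
  exact: emeasurable_funM.
have mWpsi s : measurable_fun [set: mR] (fun t : mR => (W s t)%:E * (psi t)%:E : \bar R).
  exact: emeasurable_funM.
have Wphi0 s t : 0 <= (W s t)%:E * phi t.
  by rewrite mule_ge0// lee_fin pow_weight_ge0.
have Wpsi0 s t : 0 <= (W s t)%:E * (psi t)%:E.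
  by rewrite -EFinM lee_fin mulr_ge0// pow_weight_ge0.
have intpsi s : \int[mu]_t ((W s.+1 t)%:E * (psi t)%:E) =
    (v * N ^+ s.+1 / 'C(k + s.+1, s.+1)%:R)%:E.
  transitivity (\int[mu]_t (v%:E * (W s.+1 t * cone_weight N k t)%:E)).
    by apply: eq_integral => t _; rewrite -!EFinM; congr EFin; rewrite /psi mulrCA.
  rewrite ge0_integralZl//.
  - by rewrite integral_cone_weight// -EFinM mulrA.
  - under eq_fun do rewrite EFinM.
    by apply: emeasurable_funM => //; exact: measurable_cone_weight.
  - by move=> t _; rewrite lee_fin mulr_ge0 ?pow_weight_ge0 ?cone_weight_ge0.
  - by rewrite lee_fin ltW.
have : \int[mu]_t ((W r.+1 t)%:E * phi t + C%:E * ((W q.+1 t)%:E * (psi t)%:E)) <=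
   \int[mu]_t ((W r.+1 t)%:E * (psi t)%:E + C%:E * ((W q.+1 t)%:E * phi t)).
  apply: ge0_le_integral => //.
  - by move=> t _; rewrite adde_ge0// mule_ge0.
  - by apply: emeasurable_funD => //; exact: measurable_funeM.
  - by apply: emeasurable_funD => //; exact: measurable_funeM.
rewrite !ge0_integralD//; try by [move=> t _; rewrite mule_ge0|exact: measurable_funeM].
rewrite !ge0_integralZl// -!flatint_pow !intpsi JE NE.
have CN0 : ('C(k + q.+1, q.+1)%:R != 0 :> R)%R by rewrite pnatr_eq0 -lt0n bin_gt0 leq_addl.
have -> : (v * ('C(k + q.+1, q.+1)%:R * J / v) / 'C(k + q.+1, q.+1)%:R = J)%R.
  by field; rewrite CN0 gt_eqF.
by rewrite -EFinM leeD2rE.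
Qed.

End one_body.
End berwald.

(** * The cover inequality for coordinate projections *)

Section cylinder.
Context (R : realType) (n : nat).
Local Notation X := 'rV[R]_n.
Implicit Types (A B : {set 'I_n}) (K : set X) (x y z : X).

(** The projection of K to the coordinates in A, encoded as the cylinder above
    it, so that all projections are subsets of the same space. *)
Definition cyl A K : set X := [set x | exists2 y, K y & forall i, i \in A -> x 0 i = y 0 i].

Lemma cyl_agree A K x y : (forall i, i \in A -> x 0 i = y 0 i) -> cyl A K x -> cyl A K y.
Proof. by move=> xy [z Kz xz]; exists z => // i iA; rewrite -xy// xz. Qed.

Lemma sub_cyl A K : K `<=` cyl A K.
Proof. by move=> x Kx; exists x. Qed.

Lemma cylS A B K : A \subset B -> cyl B K `<=` cyl A K.
Proof. by move=> /fintype.subsetP AB x [z Kz xz]; exists z => // i /AB; exact: xz. Qed.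

Lemma cylT K : cyl [set: 'I_n]%SET K = K.
Proof.
apply/seteqP; split=> [x [z Kz xz]|]; last exact: sub_cyl.
by rewrite (_ : x = z)//; apply/rowP => i; rewrite xz// inE.
Qed.

Definition seg_convex K := forall x y t, K x -> K y -> 0 < t < 1 -> K ((1 - t) *: x + t *: y).

Lemma cyl_convex A K : seg_convex K -> seg_convex (cyl A K).
Proof.
move=> cK x y t [x' Kx' xx'] [y' Ky' yy'] t01.
exists ((1 - t) *: x' + t *: y'); first exact: cK.
by move=> i iA; rewrite !mxE xx'// yy'.
Qed.

Lemma cyl_bounded A K (c : R) : (forall y, K y -> forall j, `|y ord0 j| <= c) ->
  forall y, cyl A K y -> forall j, j \in A -> `|y ord0 j| <= c.
Proof. by move=> Kc y [z Kz yz] j jA; rewrite yz// Kc. Qed.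

End cylinder.

Section cover.
Context (R : realType) (n m : nat).
Local Notation X := 'rV[R]_n.
Variables (K : set X) (c : R) (v : {set 'I_n} -> R).
Hypotheses (Kconv : seg_convex K) (c0 : 0 <= c).
Hypothesis Kc : forall y, K y -> forall j, `|y ord0 j| <= c.
Hypothesis mK : forall A : {set 'I_n}, measurable (cyl A K).
Hypothesis vE : forall A : {set 'I_n}, flatvol (enum A) (cyl A K) 0%R = (v A)%:E.
Hypothesis v_gt0 : forall A : {set 'I_n}, 0 < v A.
Variables (S : {set 'I_n}) (Sj : 'I_m -> {set 'I_n}) (p : 'I_m -> R).
Hypothesis (cov : uniform_cover S Sj p).

Let E := ~: S.
Let d := #|S|.
Let dj j := #|Sj j|.
Let lE := enum E.
Let lS := enum S.
Let lj j := [seq i <- lS | i \in Sj j].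
Let Kj j := cyl (E :|: Sj j) K.
Let L := cyl E K.
Let f j : X -> \bar R := flatvol (lj j) (Kj j).

Let SjS j : Sj j \subset S. Proof. by case: cov. Qed.
Let p_gt0 j : 0 < p j. Proof. by case: cov. Qed.
Let covS i : i \in S -> \sum_(j < m) p j * (i \in Sj j)%:R = 1.
Proof. by case: cov => _ _ _; exact. Qed.

Let ulE : uniq lE. Proof. exact: enum_uniq. Qed.
Let ulS : uniq lS. Proof. exact: enum_uniq. Qed.
Let ulj j : uniq (lj j). Proof. by rewrite filter_uniq. Qed.

Let mem_lj j i : (i \in lj j) = (i \in Sj j).
Proof.
rewrite mem_filter mem_enum andb_idr//; exact: (fintype.subsetP (SjS j)).
Qed.

Let size_lj j : size (lj j) = dj j.
Proof.
rewrite /dj cardE; apply: perm_size; apply: uniq_perm => //; first exact: enum_uniq.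
by move=> i; rewrite mem_lj mem_enum.
Qed.

Let size_lE : size lE = (n - d)%N.
Proof.
by rewrite -cardE /E cardsCs finset.setCK card_ord.
Qed.

Let f0 j y : (0 <= f j y)%E. Proof. exact: flatvol_ge0. Qed.

Let mf j : measurable_fun [set: X] (f j). Proof. by apply: measurable_flatvol; exact: mK. Qed.

Let f_le j y : (f j y <= ((c *+ 2) ^+ dj j)%:E)%E.
Proof.
rewrite -size_lj; apply: flatvol_le_box => // [|z Kz i]; first exact: mK.
rewrite mem_lj => ij; apply: (cyl_bounded Kc Kz).
by rewrite inE ij orbT.
Qed.

Let f_gt0 j y : (0 < f j y)%E -> L y.
Proof.
move=> /flatvol_gt0[z yz /(cylS (finset.subsetUl _ _)) Lz].
apply: cyl_agree Lz => i iE; rewrite yz// mem_lj.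
by apply: contraL iE => /(fintype.subsetP (SjS j)); rewrite !inE negbK.
Qed.

(** The fibre above (1 - t) y + t z contains the fibre above z shrunk by t and
    translated by (1 - t) a, where a is a point of the fibre above y. *)
Let f_conc j y z t : L y -> L z -> 0 < t < 1 ->
  ((t ^+ dj j)%:E * f j z <= f j ((1 - t) *: y + t *: z)%R)%E.
Proof.
move=> [y' Ky' yy'] _ t01; have /andP[t0 t1] := t01.
pose a : X := \row_i (if i \in Sj j then y' 0 i else y 0 i).
have Ka : Kj j a.
  exists y' => // i; rewrite !inE mxE => /orP[iS|->//].
  by case: ifPn => // _; rewrite yy'// inE.
have -> : f j ((1 - t) *: y + t *: z)%R = f j (t *: z + (1 - t) *: a)%R.
  apply: flatint_agree => i; rewrite mem_lj => ij.
  by rewrite !mxE (negbTE ij) addrC.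
rewrite /f /flatvol flatint_affine//; last by apply: measurable_fun_EFin_indic; exact: mK.
rewrite size_lj; apply: lee_wpmul2l.
  by rewrite lee_fin exprn_ge0// ltW.
apply: le_flatint => //.
- by apply: measurable_fun_EFin_indic; exact: mK.
- have := measurable_fun_EFin_indic (R := R) (mK (E :|: Sj j)).
  by move=> /measurableT_comp; apply; exact: measurable_fun_affine.
- move=> u _; rewrite lee_fin !indicE ler_nat.
  have [/set_mem Ku|//] := boolP (u \in Kj j).
  rewrite mem_set// addrC; exact: (cyl_convex Kconv).
Qed.

(** K lies in every cylinder Kj j, and the indicator of Kj j depends on the
    coordinates in E and in Sj j only: Finner's inequality on the fibre above
    y. *)
Let fibre y : (flatvol lS K y <= \prod_(j < m) f j y `^ p j)%E.
Proof.
apply: (@le_trans _ _ (flatint lS (fun z => \prod_(j < m) (\1_(Kj j) z)%:E `^ p j)%E y)).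
  have mp : measurable_fun [set: X] (fun z => (\prod_(j < m) (\1_(Kj j) z)%:E `^ p j)%E).
    apply: (@emeasurable_prod R 'I_m xpredT) => j _.
    apply: (measurableT_comp (measurable_poweR _)).
    by apply: measurable_fun_EFin_indic; exact: mK.
  apply: le_flatint => //.
  - by apply: measurable_fun_EFin_indic; rewrite -(cylT K).
  - by move=> z; apply: prode_ge0 => j _; exact: poweR_ge0.
  - move=> z _; rewrite indicE; have [/set_mem Kz|_] := boolP (z \in K); last first.
      by apply: prode_ge0 => j _; exact: poweR_ge0.
    rewrite big1// => j _; rewrite indicE mem_set ?poweR1r//; exact: sub_cyl.
apply: (@finner_inequality R n 'I_m xpredT p Sj (fun j z => (\1_(Kj j) z)%:E)) => //.
- by move=> i; rewrite mem_enum => /covS.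
- by move=> j _; apply: measurable_fun_EFin_indic; exact: mK.
- move=> j i z s _; rewrite mem_enum => iS iSj; apply: eq_EFin_indic.
  have H k : k \in E :|: Sj j -> upd i z s 0 k = z 0 k.
    move=> kE; rewrite updE; case: eqP => // ki; move: kE.
    by rewrite ki !inE iS (negbTE iSj).
  by split; apply: cyl_agree => k kE; rewrite H.
Qed.

Let vT_fibre : ((v [set: 'I_n]%SET)%:E = flatint lE (flatvol lS K) 0%R)%E.
Proof.
rewrite -vE cylT /flatvol -flatint_cat; congr (_ 0).
apply: perm_flatint; last 2 first.
- by apply: measurable_fun_EFin_indic; rewrite -(cylT K).
- by move=> z; rewrite lee_fin indicE.
apply: uniq_perm; first exact: enum_uniq.
- rewrite cat_uniq ulE ulS andbT/= -all_predC; apply/allP => i.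
  by rewrite mem_enum/= mem_enum inE => ->.
- by move=> i; rewrite mem_cat !mem_enum !inE orNb.
Qed.

Let vj_fibre j : (flatint lE (f j) 0%R = (v (E :|: Sj j))%:E)%E.
Proof.
rewrite -vE /f /flatvol -flatint_cat; congr (_ 0).
apply: perm_flatint; last 2 first.
- by apply: measurable_fun_EFin_indic; exact: mK.
- by move=> z; rewrite lee_fin indicE.
apply: uniq_perm; last 1 first.
- by move=> i; rewrite mem_cat mem_lj !mem_enum !inE.
- rewrite cat_uniq ulE ulj andbT/= -all_predC; apply/allP => i.
  by rewrite mem_lj/= mem_enum inE negbK => /(fintype.subsetP (SjS j)).
- exact: enum_uniq.
Qed.

Let h j y : R := fine (f j y) `^ (dj j)%:R^-1.

Let h_pow j y : (0 < dj j)%N -> ((h j y ^+ dj j)%:E = f j y)%E.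
Proof.
move=> dj0; rewrite /h powR_rootK ?fine_ge0// fineK// ge0_fin_numE//.
exact: le_lt_trans (f_le _ _) (ltry _).
Qed.

Let berwald_j j N : (0 < dj j)%N -> 0 < N ->
  N ^+ dj j = 'C(n - d + dj j, dj j)%:R * v (E :|: Sj j) / v E ->
  (flatint lE (fun y => (h j y ^+ d)%:E) 0%R <= (v E * N ^+ d / 'C(n, d)%:R)%:E)%E.
Proof.
move=> dj0 N0 NE.
have djd : (dj j <= d)%N by rewrite subset_leq_card.
have d0 : (0 < d)%N by exact: leq_trans dj0 djd.
have dn : (d <= n)%N by rewrite -[X in (_ <= X)%N](card_ord n) max_card.
have h0 y : 0 <= h j y by exact: powR_ge0.
have dj0R : 0 < (dj j)%:R^-1 :> R by rewrite invr_gt0 ltr0n.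
have := @berwald R n lE L (h j) c (((c *+ 2) ^+ dj j) `^ (dj j)%:R^-1) (v E) 0
  ulE (mK E) c0 _ _ h0 _ _ _ (v_gt0 E) (vE E) N (v (E :|: Sj j)) (dj j).-1 d.-1.
rewrite !prednK// size_lE subnK//; apply => //.
- by move=> y Ly i; rewrite mem_enum => iE; exact: (cyl_bounded Kc Ly).
- apply/measurable_EFinP.
  apply: (measurableT_comp (measurable_powR _)).
  by apply: (measurableT_comp (fine_measurable measurableT)); exact: mf.
- move=> y; apply: ge0_ler_powR; rewrite ?nnegrE ?(ltW dj0R)//.
  + exact: fine_ge0.
  + by rewrite exprn_ge0// mulrn_wge0.
  + by rewrite -lee_fin fineK ?f_le// ge0_fin_numE// (le_lt_trans (f_le _ _)) ?ltry.
- move=> y hy; apply: (@f_gt0 j); rewrite -h_pow// lte_fin exprn_gt0//.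
- move=> y z t Ly Lz t01; have /andP[t0 t1] := t01.
  rewrite -(ler_pXn2r dj0) ?nnegrE ?mulr_ge0// ?(ltW t0)//.
  by rewrite exprMn -lee_fin EFinM !h_pow//; exact: f_conc.
- by rewrite -ltnS !prednK.
- by under eq_flatint do rewrite h_pow//; exact: vj_fibre.
Qed.

Let lee_prod (Q : pred 'I_m) (F G : 'I_m -> \bar R) :
  (forall j, Q j -> (0 <= F j <= G j)%E) ->
  (\prod_(j < m | Q j) F j <= \prod_(j < m | Q j) G j)%E.
Proof.
move=> FG; suff /andP[] : (0 <= \prod_(j < m | Q j) F j <= \prod_(j < m | Q j) G j)%E by [].
elim/big_ind2 : _ => [|u u' w w' /andP[? ?] /andP[? ?]|//]; first by rewrite lexx lee01.
by rewrite mule_ge0//= lee_pmul.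
Qed.

(** Count the pairs (i, j) with i \in Sj j, with weights p j. *)
Let sum_card : \sum_(j < m) p j * (dj j)%:R = d%:R.
Proof.
transitivity (\sum_(j < m) \sum_(i in S) p j * (i \in Sj j)%:R).
  apply: eq_bigr => j _; rewrite -mulr_sumr; congr (_ * _).
  rewrite -natr_sum; congr (_%:R); rewrite /dj -sum1_card big_mkcond/=.
  rewrite [RHS]big_mkcond/=; apply: eq_bigr => i _.
  case: ifPn => [ij|ij]; last by case: ifP; rewrite ?(negbTE ij).
  by rewrite (fintype.subsetP (SjS j) _ ij).
rewrite exchange_big/= (eq_bigr (fun=> 1)); last by move=> i; exact: covS.
by rewrite sumr_const.
Qed.

(* If Sj j is empty, then theta j = 0 and f j <= 1, so that the factor j can be
   dropped before Hoelder's inequality is applied. *)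
Let P j := (0 < dj j)%N.
Let theta j := p j * (dj j)%:R / d%:R.

(** The fibre volumes are at most the products of the h j ^+ d to the powers
    theta j; Hoelder's inequality with the weights theta j over the coordinates
    in E leaves the integrals of h j ^+ d, which Berwald's inequality bounds. *)
Lemma projection_inequality : (0 < d)%N ->
  v E `^ (\sum_(j < m) p j - 1) * v [set: 'I_n]%SET <=
  ((\prod_(j < m) 'C(n - d + dj j, dj j)%:R `^ p j) / 'C(n, d)%:R) *
  \prod_(j < m) v (E :|: Sj j) `^ p j.
Proof.
move=> d_gt0.
have dR : 0 < d%:R :> R by rewrite ltr0n.
have dn : (d <= n)%N by rewrite -[X in (_ <= X)%N](card_ord n) max_card.
have C0 : 0 < 'C(n, d)%:R :> R by rewrite ltr0n bin_gt0.
have Cj0 j : 0 < 'C(n - d + dj j, dj j)%:R :> R by rewrite ltr0n bin_gt0 leq_addl.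
have theta_gt0 j : P j -> 0 < theta j.
  by move=> Pj; rewrite divr_gt0// mulr_gt0// ltr0n.
have theta_sum : \sum_(j < m | P j) theta j = 1.
  rewrite big_mkcond/= -(mulfV (lt0r_neq0 dR)) -[X in X / _]sum_card mulr_suml.
  apply: eq_bigr => j _; case: ifPn => //.
  by rewrite /P lt0n negbK => /eqP ->; rewrite mulr0 mul0r.
have h0 j y : 0 <= h j y by exact: powR_ge0.
have mhd j : measurable_fun [set: X] (fun y => (h j y ^+ d)%:E).
  apply/measurable_EFinP; apply: measurable_funX.
  apply: (measurableT_comp (measurable_powR _)).
  by apply: (measurableT_comp (fine_measurable measurableT)); exact: mf.
pose a j := 'C(n - d + dj j, dj j)%:R * v (E :|: Sj j) / v E.
have a0 j : 0 < a j by rewrite divr_gt0// mulr_gt0.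
pose N j := a j `^ (dj j)%:R^-1.
have N0 j : 0 < N j by rewrite powR_gt0.
have NE j : P j -> N j ^+ dj j = a j.
  by move=> Pj; rewrite powR_rootK// ltW.
have step1 : ((v [set: 'I_n]%SET)%:E <=
    \prod_(j < m | P j) (flatint lE (fun y => (h j y ^+ d)%:E) 0%R) `^ theta j)%E.
  rewrite vT_fibre.
  apply: (@le_trans _ _ (flatint lE (fun y => \prod_(j < m | P j) (h j y ^+ d)%:E `^ theta j)%E 0)).
    apply: le_flatint.
    - by apply: measurable_flatvol; rewrite -(cylT K).
    - by move=> y; exact: flatvol_ge0.
    - apply: (@emeasurable_prod R 'I_m P) => j _.
      by apply: (measurableT_comp (measurable_poweR _)); exact: mhd.
    - by move=> y; apply: prode_ge0 => j _; exact: poweR_ge0.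
    move=> y _; apply: le_trans (fibre y) _.
    rewrite (bigID P)/= -[leRHS]mule1; apply: lee_pmul.
    - by apply: prode_ge0 => j _; exact: poweR_ge0.
    - by apply: prode_ge0 => j _; exact: poweR_ge0.
    - rewrite le_eqVlt; apply/orP; left; apply/eqP; apply: eq_bigr => j Pj.
      rewrite -h_pow// !poweR_EFin; congr EFin; move: (h j y) (h0 j y) => H H0.
      rewrite -(powR_mulrn (dj j) H0) -(powR_mulrn d H0) -!powRrM; congr (_ `^ _).
      by rewrite /theta mulrCA mulfV ?mulr1 1?mulrC// gt_eqF.
    - suff /andP[] : (0 <= \prod_(j < m | ~~ P j) f j y `^ p j <= 1)%E by [].
      elim/big_ind : _ => [|u w /andP[u0 u1] /andP[w0 w1]|j Pj].
      + by rewrite lexx lee01.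
      + by rewrite mule_ge0//= -[leRHS]mule1; exact: lee_pmul.
      + rewrite poweR_ge0/= -(poweR1r (p j)); apply: gt0_ler_poweR.
        * exact: ltW.
        * by rewrite in_itv/= f0 leey.
        * by rewrite in_itv/= lee01 leey.
        * move: Pj; rewrite /P -eqn0Ngt => /eqP dj0.
          by have := f_le j y; rewrite dj0 expr0.
  apply: le_trans (@finner_inequality R n 'I_m P theta (fun=> [set: 'I_n]%SET)
      (fun j y => (h j y ^+ d)%:E) lE 0 theta_gt0 _ ulE _ _ _) _.
  - by move=> i _; rewrite -[RHS]theta_sum; apply: eq_bigr => j _; rewrite inE mulr1.
  - by move=> j _; exact: mhd.
  - by move=> j y _; rewrite lee_fin exprn_ge0.
  - by move=> j i y s _ _; rewrite inE.
  rewrite le_eqVlt; apply/orP; left; apply/eqP; apply: eq_bigr => j _.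
  by rewrite (eq_filter (a2 := predT)) ?filter_predT// => i; rewrite inE.
have step2 : v [set: 'I_n]%SET <= \prod_(j < m | P j) (v E * N j ^+ d / 'C(n, d)%:R) `^ theta j.
  rewrite -lee_fin; apply: (le_trans step1); rewrite -prodEFin.
  apply: lee_prod => j Pj; rewrite poweR_ge0/= -poweR_EFin; apply: gt0_ler_poweR.
  - by rewrite ltW// theta_gt0.
  - rewrite in_itv/= leey andbT; apply: flatint_ge0 => y.
    by rewrite lee_fin exprn_ge0.
  - by rewrite in_itv/= leey andbT lee_fin divr_ge0// mulr_ge0 ?exprn_ge0 ?(ltW (v_gt0 _)) ?(ltW (N0 _)).
  - by apply: berwald_j => //; exact: NE.
have step3 : \prod_(j < m | P j) (v E * N j ^+ d / 'C(n, d)%:R) `^ theta j =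
    v E / 'C(n, d)%:R * \prod_(j < m) a j `^ p j.
  transitivity (\prod_(j < m | P j) ((v E / 'C(n, d)%:R) `^ theta j * a j `^ p j)).
    have q0 : 0 <= v E / 'C(n, d)%:R by rewrite divr_ge0// ltW.
    apply: eq_bigr => j Pj; rewrite -NE// mulrAC.
    move: (N j) (ltW (N0 j)) => M M0.
    rewrite [LHS]powRM ?exprn_ge0//; congr (_ * _).
    rewrite -(powR_mulrn (dj j) M0) -(powR_mulrn d M0) -!powRrM; congr (_ `^ _).
    by rewrite /theta mulrCA mulfV ?mulr1 1?mulrC// gt_eqF.
  rewrite big_split/= prod_powR_sum ?divr_gt0// theta_sum powRr1 ?divr_ge0 ?ltW//.
  congr (_ * _); rewrite [RHS](bigID P)/= [X in _ = _ * X]big1 ?mulr1// => j.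
  rewrite /P -eqn0Ngt => /eqP dj0; rewrite /a dj0 bin0 mul1r.
  move/eqP: dj0; rewrite cards_eq0 => /eqP ->.
  by rewrite finset.setU0 divff ?gt_eqF// powR1.
rewrite step3 in step2.
have step4 : \prod_(j < m) a j `^ p j =
   \prod_(j < m) 'C(n - d + dj j, dj j)%:R `^ p j *
   \prod_(j < m) v (E :|: Sj j) `^ p j / v E `^ (\sum_(j < m) p j).
  rewrite -prod_powR_sum// -big_split/= -prodf_div; apply: eq_bigr => j _.
  by rewrite powR_div ?mulr_ge0 ?ltW// powRM ?ltW.
rewrite step4 in step2.
apply: le_trans (ler_wpM2l (powR_ge0 _ _) step2) _.
rewrite powRB ?(gt_eqF (v_gt0 _)) ?implybT// powRr1 ?(ltW (v_gt0 _))//.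
rewrite le_eqVlt; apply/orP; left; apply/eqP.
have vE0 : v E != 0 by rewrite gt_eqF.
have vEp0 : v E `^ (\sum_(j < m) p j) != 0 by rewrite gt_eqF// powR_gt0.
by field; rewrite vE0 vEp0 gt_eqF.
Qed.

End cover.

(** * Compact sets of row vectors *)

Section row_topology.
Context (R : realType).

Lemma continuous_row (T : topologicalType) n (f : T -> 'rV[R]_n) :
  (forall j, continuous (fun t => f t 0 j)) -> continuous f.
Proof.
move=> fc x A /= /nbhs_ballP[e /= e0 eA].
have : \forall t \near x, forall j : 'I_n, ball (f x 0 j) e (f t 0 j).
  apply: filter_forall => j; apply: (fc j x); exact: nbhsx_ballx.
apply: filterS => t ft; apply: eA; split => // i j; rewrite (ord1 i); exact: ft.
Qed.

Lemma continuous_mulmxr k n (M : 'M[R]_(k, n)) :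
  continuous (fun x : 'rV[R]_k => x *m M).
Proof.
apply: continuous_row => j.
have -> : (fun x : 'rV[R]_k => (x *m M) 0 j) =
    (fun x => \sum_(i <- index_enum 'I_k) x 0 i * M i j).
  by apply/funext => x; rewrite mxE.
elim: (index_enum _) => [|i s IH] x.
  rewrite (_ : (fun _ => _) = cst 0); first exact: cst_continuous.
  by apply/funext => y; rewrite big_nil.
rewrite (_ : (fun _ => _) = (fun x : 'rV[R]_k => x 0 i * M i j) \+
    (fun x : 'rV[R]_k => \sum_(i <- s) x 0 i * M i j)); last first.
  by apply/funext => y; rewrite big_cons.
apply: (@continuousD R R^o); last exact: IH.
apply: (@continuousM R); first exact: coord_continuous.
exact: cst_continuous.
Qed.

(** An open set is the union of the countably many rational boxes in it. *)
Lemma open_measurable_row n (U : set 'rV[R]_n) : open U -> measurable U.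
Proof.
move=> oU.
pose box (q : {ffun 'I_n -> rat}) (e : R) :=
  [set x : 'rV[R]_n | forall i, `|x 0 i - ratr (q i)| < e].
have mbox q e : measurable (box q e).
  rewrite (_ : box q e = \bigcap_(i in [set: 'I_n])
      (fun x : 'rV[R]_n => x 0 i : measurableTypeR R) @^-1` [set s : R | `|s - ratr (q i)| < e]).
    apply: fin_bigcap_measurable => // i _.
    rewrite -[X in measurable X]setTI; apply: measurable_coord => //.
    rewrite (_ : [set _ | _] = `](ratr (q i) - e), (ratr (q i) + e)[%classic).
      exact: measurable_itv.
    by apply/seteqP; split=> s /=; rewrite in_itv/= ltr_distl.
  by apply/seteqP; split => [x h i _|x h i]; exact: h.
pose F k := if @unpickle ({ffun 'I_n -> rat} * nat)%type k is Some (q, j)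
  then (if pselect (box q j.+1%:R^-1 `<=` U) then box q j.+1%:R^-1 else set0) else set0.
rewrite (_ : U = \bigcup_k F k).
  apply: bigcup_measurable => k _; rewrite /F; case: unpickle => [[q j]|//].
  by case: pselect => _ /=; [exact: mbox|exact: measurable0].
apply/seteqP; split=> [x Ux|x [k _]]; last first.
  by rewrite /F; case: unpickle => [[q j]|//]; case: pselect => /= [s|_] //; exact: s.
have /nbhs_ballP[e /= e0 eU] : nbhs x U by move: oU; rewrite openE; exact.
have [j je] : exists j : nat, j.+1%:R^-1 < e / 2.
  exists (Num.bound (e / 2)^-1).
  rewrite invf_plt ?posrE ?divr_gt0//.
  apply: lt_le_trans (archi_boundP _) _; first by rewrite invr_ge0 ltW// divr_gt0.
  by rewrite ler_nat.
have j0 : 0 < j.+1%:R^-1 :> R by rewrite invr_gt0.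
have hq (i : 'I_n) : exists q : rat, `|x 0 i - ratr q| < j.+1%:R^-1.
  have : x 0 i - j.+1%:R^-1 < x 0 i + j.+1%:R^-1 by rewrite ltrD2l (lt_trans _ j0)// oppr_lt0.
  by move=> /rat_in_itvoo[q]; rewrite in_itv/= => qx; exists q; rewrite distrC ltr_distl.
pose q := [ffun i => sval (cid (hq i))].
have xq : box q j.+1%:R^-1 x by move=> i; rewrite ffunE; case: cid.
exists (pickle (q, j)) => //; rewrite /F pickleK.
case: pselect => // -[]; move=> y yq; apply: eU; split => // i k.
rewrite (ord1 i) /ball/= (le_lt_trans (ler_distD (ratr (q k)) _ _))//.
rewrite (splitr e) ltrD//; first exact: lt_trans je.
by rewrite distrC; exact: lt_trans je.
Qed.

Lemma closed_measurable_row n (A : set 'rV[R]_n) : closed A -> measurable A.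
Proof.
move=> cA; rewrite -[A]setCK; apply: measurableC; apply: open_measurable_row.
exact: closed_openC.
Qed.

Lemma compact_measurable_row n (A : set 'rV[R]_n) : compact A -> measurable A.
Proof.
move=> cA; apply: closed_measurable_row; exact: compact_closed.
Qed.

Lemma compact_mulmxr k n (M : 'M[R]_(k, n)) (A : set 'rV[R]_k) : compact A ->
  compact [set x *m M | x in A].
Proof.
move=> cA; apply: continuous_compact => //; apply: continuous_subspaceT.
exact: continuous_mulmxr.
Qed.

Lemma measurable_preimage_mulmxr k n (M : 'M[R]_(k, n)) (A : set 'rV[R]_n) :
  compact A -> measurable [set x : 'rV[R]_k | A (x *m M)].
Proof.
move=> cA; apply: closed_measurable_row.
have /continuous_closedP := @continuous_mulmxr k n M; apply.
exact: compact_closed.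
Qed.

(** With D the diagonal matrix that keeps the coordinates in A, the cylinder is
    the preimage of the compact set K D under D, hence closed. *)
Lemma compact_measurable_cyl n (A : {set 'I_n}) (K : set 'rV[R]_n) :
  compact K -> measurable (cyl A K).
Proof.
move=> cK; pose D : 'M[R]_n := \matrix_(i, j) ((i == j) && (j \in A))%:R.
have DE (x : 'rV[R]_n) j : (x *m D) 0 j = if j \in A then x 0 j else 0.
  rewrite mxE (bigD1 j)//= big1 => [|i ij]; last by rewrite mxE (negbTE ij) mulr0.
  by rewrite mxE eqxx addr0; case: ifP => _; rewrite (mulr1, mulr0).
have := measurable_preimage_mulmxr D (compact_mulmxr (M := D) cK); congr measurable.
apply/seteqP; split=> x /= [y Ky xy].
  exists y => // i iA; have /rowP/(_ i) := xy.
  by rewrite !DE iA.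
by exists y => //; apply/rowP => j; rewrite !DE; case: ifP => // /xy.
Qed.

Lemma compact_coord_bounded n (K : set 'rV[R]_n) : compact K ->
  exists2 c : R, 0 <= c & forall y, K y -> forall j, `|y ord0 j| <= c.
Proof.
move=> /compact_bounded[M [Mreal /(_ (Num.max M 0 + 1))]].
have M1 : M < Num.max M 0 + 1.
  by apply: (@le_lt_trans _ _ (Num.max M 0)); rewrite ?ltrDl// le_max lexx.
move=> /(_ M1) H; exists (Num.max M 0 + 1).
  by rewrite addr_ge0// le_max lexx orbT.
move=> y /H yM j; apply: le_trans yM.
have /mapP[k Hk ->] : `|y ord0 j| \in [seq `|y x.1 x.2| | x : 'I_1 * 'I_n].
  by apply/mapP; exists (ord0, j) => //=; rewrite mem_enum.
by rewrite [leRHS]/Num.norm/= mx_normrE; apply/bigmax_geP; right => /=; exists k.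
Qed.

Lemma flatvol_ge_box n (l : seq 'I_n) (A : set 'rV[R]_n) (z x : 'rV[R]_n) (e : R) :
  uniq l -> 0 < e -> measurable A ->
  (forall y, agree_off l x y -> (forall i, i \in l -> `|y 0 i - z 0 i| < e) -> A y) ->
  (((e *+ 2) ^+ size l)%:E <= flatvol l A x)%E.
Proof.
move=> + e0 mA; elim: l x => [|i l IH] x /=.
  by move=> _ /(_ x) Ax; rewrite expr0 /flatvol/= indicE mem_set//; exact: Ax.
move=> /andP[il ul] H.
pose I : set (measurableTypeR R) := `](z 0 i - e), (z 0 i + e)[%classic.
have mI : measurable_fun [set: measurableTypeR R] (fun s : measurableTypeR R => (\1_I s)%:E : \bar R).
  by apply: measurable_fun_EFin_indic; exact: measurable_itv.
apply: (@le_trans _ _ (\int[@lebesgue_measure R]_s (((e *+ 2) ^+ size l)%R%:E * (\1_I s)%:E))%E); last first.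
  apply: ge0_le_integral => //.
  - by move=> s _; rewrite -EFinM lee_fin mulr_ge0 ?exprn_ge0 ?mulrn_wge0 ?(ltW e0)// indicE.
  - exact: measurable_funeM.
  - exact: measurable_flatvol_upd.
  - move=> s _; rewrite indicE; have [/set_mem sI|_] := boolP (s \in I); last first.
      by rewrite mule0; exact: flatvol_ge0.
    rewrite mule1; apply: IH => // y xy yl; apply: H; first exact: agree_off_upd xy.
    move=> k; rewrite inE; have [kl _|kl] := boolP (k \in l); first exact: yl.
    rewrite orbF => /eqP ->; rewrite -xy// updE eqxx.
    by move: sI; rewrite /I/= in_itv/= ltr_distl.
rewrite ge0_integralZl//; last by rewrite lee_fin exprn_ge0// mulrn_wge0// ltW.
rewrite -measure_integral_indic; last exact: measurable_itv.
rewrite -[X in (_ <= _ * X)%E]/(lebesgue_measure `](z 0 i - e), (z 0 i + e)[%classic).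
rewrite lebesgue_measure_itv/= lte_fin.
rewrite exprS (mulrC (e *+ 2)) ifT ?ltrD2l ?gtrN//.
by rewrite -EFinD EFinM opprD opprK addrACA subrr add0r mulr2n.
Qed.

End row_topology.

(** * Linear change of variables *)

Section flatvol_lebesgue_tuple.
Context (R : realType) (n : nat).
Local Notation mR := (measurableTypeR R).
Local Notation X := 'rV[R]_n.

Definition coords k (l : k.-tuple 'I_n) (x : X) : k.-tuple mR :=
  [tuple x 0 (tnth l i) | i < k].

(** Both sides unfold to the same iterated integral. *)
Lemma flatvol_coords k (l : k.-tuple 'I_n) (E : set (k.-tuple mR)) x :
  uniq l -> measurable E ->
  flatvol l [set y | E (coords l y)] x = lebesgue_tuple R k E.
Proof.
elim: k l E x => [|k IH] l E x.
  move=> _ mE; rewrite (tuple0 l) /flatvol/= diracE indicE; congr (_%:R%:E).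
  congr nat_of_bool; apply/idP/idP => /set_mem; rewrite /= ?(tuple0 (coords _ _)) => h;
    by apply/mem_set; rewrite /= ?(tuple0 (coords _ _)).
case/tupleP: l => i l /= /andP[il ul] mE.
rewrite /lebesgue_cons /pushforward -[RHS]/(\int[@lebesgue_measure R]_s
  lebesgue_tuple R k (xsection (@tuple_cons R k @^-1` E) s))%E.
rewrite -[LHS]/(\int[@lebesgue_measure R]_s
  flatvol l [set y | E (coords [tuple of i :: l] y)] (upd i x s))%E.
apply: eq_integral => s _.
have mEs : measurable (xsection (@tuple_cons R k @^-1` E) s).
  apply: measurable_xsection; rewrite -[X in measurable X]setTI.
  exact: (@measurable_tuple_cons R k).
rewrite -(IH l _ (upd i x s) ul mEs); apply: eq_flatvol => y xy.
rewrite /= /xsection/= inE/=.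
suff -> : coords [tuple of i :: l] y = tuple_cons (s, coords l y) by [].
apply: eq_from_tnth => j; rewrite tnth_mktuple.
case: (unliftP ord0 j) => [j' ->|->].
  by rewrite !tnthS tnth_mktuple.
by rewrite !tnth0 -xy// updE eqxx.
Qed.

End flatvol_lebesgue_tuple.

Section leb.
Context (R : realType) (k : nat).
Local Notation mR := (measurableTypeR R).

Definition leb (A : set 'rV[R]_k) : \bar R := flatvol (enum 'I_k) A 0.

Lemma leb_lebesgue_tuple (A : set 'rV[R]_k) : measurable A ->
  leb A = lebesgue_tuple R k (@row_of_tuple R k @^-1` A).
Proof.
move=> mA; pose l : k.-tuple 'I_k := ord_tuple k.
have mA' : measurable (@row_of_tuple R k @^-1` A) by [].
rewrite -(flatvol_coords (l := l) 0 (enum_uniq _) mA'); apply: eq_flatvol => y _ /=.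
suff -> : row_of_tuple (coords l y) = y by [].
by apply/rowP => i; rewrite mxE tnth_mktuple tnth_ord_tuple.
Qed.

End leb.

Section change_of_variables.
Context (R : realType) (k : nat).
Local Notation mR := (measurableTypeR R).
Local Notation X := 'rV[R]_k.
Local Notation mu := (@lebesgue_measure R).
Local Notation lT := (enum 'I_k).
Implicit Types (M N : 'M[R]_k) (g : X -> \bar R).

Lemma measurable_fun_sumr (T : Type) d (Y : measurableType d) (s : seq T) (f : T -> Y -> mR) :
  (forall i, measurable_fun setT (f i)) ->
  measurable_fun setT (fun y => (\sum_(i <- s) f i y) : mR).
Proof.
move=> mf; elim: s => [|i s IH].
  rewrite (_ : (fun _ => _) = cst 0); first exact: measurable_cst.
  by apply/funext => y; rewrite big_nil.
rewrite (_ : (fun _ => _) = (fun y => f i y + \sum_(j <- s) f j y)); last first.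
  by apply/funext => y; rewrite big_cons.
by apply: (@measurable_funD _ _ R setT (f i) (fun y => \sum_(j <- s) f j y)); [exact: mf|exact: IH].
Qed.

Lemma measurable_mulmx_coord m (M : 'M[R]_(k, m)) j :
  measurable_fun [set: X] (fun x : X => (x *m M) 0 j : mR).
Proof.
under eq_fun do rewrite mxE.
apply: measurable_fun_sumr => i.
apply: (@measurable_funM _ _ R setT (fun x : X => x 0 i) (fun=> M i j)) => //.
exact: measurable_coord.
Qed.

Lemma measurable_fun_mulmxr m (M : 'M[R]_(k, m)) :
  measurable_fun [set: X] (fun x : X => x *m M).
Proof. by apply: measurable_fun_row => j; exact: measurable_mulmx_coord. Qed.

(** The elementary step of the change of variables: a triangular matrix acts as
    a composition of such maps, one for each coordinate. *)
Definition col_map M i (x : X) : X := upd i x ((x *m M) 0 i).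

Lemma measurable_col_map M i : measurable_fun [set: X] (col_map M i).
Proof.
apply: (measurableT_comp (@measurable_upd R k i)
  (g := fun x : X => (x, (x *m M) 0 i : mR))).
apply: measurable_fun_pair; first exact: measurable_id.
exact: measurable_mulmx_coord.
Qed.

Lemma flatint_col_map M i g : M i i != 0 -> measurable_fun [set: X] g ->
  (forall x, (0 <= g x)%E) ->
  (flatint lT (g \o col_map M i) 0 = `|M i i|^-1%:E * flatint lT g 0)%E.
Proof.
move=> Mii mg g0.
have mgc : measurable_fun [set: X] (g \o col_map M i).
  exact: (measurableT_comp mg (measurable_col_map M i)).
have pT : perm_eq lT (rcons (rem i lT) i).
  have iT : i \in lT by rewrite mem_enum.
  by apply: perm_trans (perm_to_rem iT) _; rewrite perm_sym perm_rcons.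
rewrite (perm_flatint pT mgc)//; last by move=> x; exact: g0.
rewrite (perm_flatint pT mg g0) -cats1 !flatint_cat.
rewrite -flatintZl//; last 2 first.
- exact: measurable_flatint mg g0.
- by move=> x; exact: flatint_ge0.
congr (flatint _ _ _); apply/funext => x; rewrite /flatint/=.
pose c := \sum_(j | j != i) x 0 j * M j i.
rewrite -(@integral_affine R (M i i) c (fun s => g (upd i x s)))//; last first.
  exact: (measurableT_comp mg (measurable_upd1 i x)).
apply: eq_integral => s _; congr g; rewrite /col_map.
have -> : (upd i x s *m M) 0 i = M i i * s + c.
  rewrite mxE (bigD1 i)//= updE eqxx mulrC; congr (_ + _).
  by apply: eq_bigr => j ji; rewrite updE (negbTE ji).
by apply/rowP => j; rewrite !updE; case: eqP.
Qed.

(** The change of variables formula for M. *)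
Definition scales M := forall g, measurable_fun [set: X] g -> (forall x, (0 <= g x)%E) ->
  (flatint lT (fun x => g (x *m M)) 0 * `|\det M|%:E = flatint lT g 0)%E.

Lemma scalesM M N : scales M -> scales N -> scales (M *m N).
Proof.
move=> sM sN g mg g0; rewrite det_mulmx normrM EFinM muleA -(sN g mg g0).
rewrite -(sM (fun x => g (x *m N)))//.
- by congr (_ * _ * _)%E; apply: eq_flatint => x _; rewrite mulmxA.
- exact: (measurableT_comp mg (measurable_fun_mulmxr N)).
Qed.

Let scalesE M c : (0 < c) -> c = `|\det M| ->
  (forall g, measurable_fun [set: X] g -> (forall x, (0 <= g x)%E) ->
    (flatint lT (fun x => g (x *m M)) 0 = c^-1%:E * flatint lT g 0)%E) -> scales M.
Proof.
move=> c0 cE H g mg g0; rewrite -cE H// muleAC -EFinM mulVf ?mul1e// gt_eqF//.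
Qed.

(** Let Phi m replace the first m coordinates of x by those of x *m M. As M is
    upper triangular, the first m coordinates of x *m M do not depend on
    coordinate m, so that Phi m.+1 is Phi m after [col_map M m], which
    divides integrals by the absolute value of the diagonal entry. *)
Lemma scales_upper M : (forall i j : 'I_k, (j < i)%N -> M i j = 0) ->
  M \in unitmx -> scales M.
Proof.
move=> upM; have detM : \det M = \prod_i M i i.
  rewrite -det_tr det_trig; first by apply: eq_bigr => i _; rewrite mxE.
  by apply/is_trig_mxP => i j ij; rewrite mxE upM.
rewrite unitmxE unitfE => dM.
have Mii i : M i i != 0.
  by move: dM; rewrite detM prodf_seq_neq0 => /allP/(_ i); rewrite mem_index_enum; exact.
pose Phi m (x : X) : X := \row_j if (j < m)%N then (x *m M) 0 j else x 0 j.
have PhiS m (mk : (m < k)%N) x : Phi m.+1 x = Phi m (col_map M (Ordinal mk) x).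
  apply/rowP => j; rewrite [LHS]mxE [RHS]mxE ltnS; case: ltngtP => [jm|jm|jm].
  - rewrite [LHS]mxE [RHS]mxE; apply: eq_bigr => i _; rewrite /col_map updE; case: eqP => // ->.
    by rewrite upM ?mulr0.
  - by rewrite /col_map updE -(inj_eq val_inj)/= gtn_eqF.
  - have -> : j = Ordinal mk by exact: val_inj.
    by rewrite /col_map updE eqxx.
have H m : (m <= k)%N -> forall g, measurable_fun [set: X] g -> (forall x, (0 <= g x)%E) ->
    (flatint lT (fun x => g (Phi m x)) 0 =
      (\prod_(i < k | (i < m)%N) `|M i i|)^-1%:E * flatint lT g 0)%E.
  elim: m => [_ g mg g0|m IH mk g mg g0].
    rewrite big_pred0// invr1 mul1e; apply: eq_flatint => x _; congr g.
    by apply/rowP => j; rewrite mxE.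
  have mPhi : measurable_fun [set: X] (Phi m).
    apply: measurable_fun_row => j.
    rewrite (_ : (fun x => _) = fun x : X => if (j < m)%N then (x *m M) 0 j else x 0 j).
      by case: (j < m)%N; [exact: measurable_mulmx_coord|exact: measurable_coord].
    by apply/funext => x; rewrite [LHS]mxE.
  transitivity (flatint lT (fun x => g (Phi m (col_map M (Ordinal mk) x))) 0).
    by apply: eq_flatint => x _; rewrite PhiS.
  rewrite (@flatint_col_map M (Ordinal mk) (fun x => g (Phi m x)))//; last first.
    exact: (measurableT_comp mg mPhi).
  rewrite IH ?(ltnW mk)// muleA -EFinM -invfM.
  congr (_^-1%:E * _)%E; rewrite [RHS](bigD1 (Ordinal mk))//=; congr (_ * _).
  apply: eq_bigl => i; rewrite ltnS -(inj_eq val_inj)/=.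
  by rewrite [RHS]andbC -ltn_neqAle.
apply: (@scalesE _ (\prod_(i < k | (i < k)%N) `|M i i|)).
- by apply: prodr_gt0 => i _; rewrite normr_gt0.
- by rewrite detM normr_prod; apply: eq_bigl => i; rewrite ltn_ord.
- move=> g mg g0; rewrite -(H k (leqnn k) g mg g0); apply: eq_flatint => x _.
  by congr g; apply/rowP => j; rewrite [in RHS]mxE ltn_ord.
Qed.

Lemma scales_perm (s : {perm 'I_k}) : scales (perm_mx s).
Proof.
have sE (x : X) j : (x *m perm_mx s) 0 j = x 0 ((s^-1)%g j).
  by rewrite -{1}(invgK s) -col_permE mxE.
apply: (@scalesE _ 1) => //.
  by rewrite det_perm normrX normrN1 expr1n.
move=> g mg g0; rewrite invr1 mul1e.
have H l x : flatint l (fun y => g (y *m perm_mx s)) x = flatint (map s l) g (x *m perm_mx s).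
  elim: l x => //= i l IH x; apply: eq_integral => t _; rewrite IH; congr flatint.
  apply/rowP => j; rewrite sE !updE sE.
  by rewrite (can2_eq (permKV s) (permK s)).
rewrite H mul0mx; congr (_ 0); apply: perm_flatint => //.
apply: uniq_perm; first by rewrite map_inj_uniq ?enum_uniq//; exact: perm_inj.
  exact: enum_uniq.
move=> i; rewrite [RHS]mem_enum; apply/mapP; exists ((s^-1)%g i).
  by rewrite mem_enum.
by rewrite permKV.
Qed.

(** Reversing the order of the coordinates turns a lower triangular matrix into
    an upper triangular one. *)
Lemma scales_lower M : (forall i j : 'I_k, (i < j)%N -> M i j = 0) ->
  M \in unitmx -> scales M.
Proof.
move=> loM uM; pose s := perm (@rev_ord_inj k); pose P := perm_mx s : 'M[R]_k.
have sV : (s^-1)%g = s.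
  apply/permP => i; apply: (@perm_inj _ s).
  by rewrite permKV !permE rev_ordK.
have PP : P *m P = 1%:M by rewrite -perm_mxM -{1}sV mulVg perm_mx1.
have uP : P \in unitmx by exact: unitmx_perm.
have -> : M = P *m (P *m M *m P) *m P.
  by rewrite !mulmxA PP mul1mx -mulmxA PP mulmx1.
apply: scalesM; last exact: scales_perm.
apply: scalesM; first exact: scales_perm.
apply: scales_upper; last by rewrite !unitmx_mul uP uM.
move=> i j ji; rewrite /P -row_permE -{2}sV -col_permE !mxE !permE.
apply: loM => /=; apply: ltn_sub2l; rewrite ?ltnS//.
exact: leq_ltn_trans ji (ltn_ord i).
Qed.

End change_of_variables.

(** By the LUP decomposition it suffices to treat permutation matrices and
    triangular ones. *)
Lemma scales_unitmx (R : realType) k (M : 'M[R]_k) : M \in unitmx -> scales M.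
Proof.
case: k M => [|k] M uM.
  move=> g mg g0; rewrite det_mx00 normr1 mule1; apply: eq_flatint => x _.
  by congr g; apply/rowP => -[].
have := cormen_lup_perm M; have := cormen_lup_correct M.
have := cormen_lup_detL M; have := cormen_lup_lower M; have := cormen_lup_upper M.
case: (cormen_lup M) => [[P L] U]/= upU loL dL PM /is_perm_mxP[s PE].
have {}PM : P *m M = L *m U by exact: PM.
have uL : L \in unitmx by rewrite unitmxE dL unitr1.
have uU : U \in unitmx.
  rewrite unitmxE; have /(congr1 determinant) := PM.
  by rewrite !det_mulmx dL mul1r => <-; rewrite PE -det_mulmx -unitmxE unitmx_mul unitmx_perm.
have -> : M = perm_mx (s^-1)%g *m (L *m U).
  by rewrite -PM PE mulmxA -perm_mxM mulVg perm_mx1 mul1mx.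
apply: scalesM; first exact: scales_perm.
apply: scalesM; last exact: scales_upper.
apply: scales_lower => // i j ij; rewrite loL ?(ltnW ij)//.
by rewrite -(inj_eq val_inj)/= ltn_eqF.
Qed.

Lemma leb_mulmx (R : realType) k (M : 'M[R]_k) (A : set 'rV[R]_k) : M \in unitmx ->
  measurable A -> (leb [set x | A (x *m M)] * `|\det M|%:E = leb A)%E.
Proof.
move=> uM mA; have := @scales_unitmx R k M uM (fun x => (\1_A x)%:E).
by apply; [exact: measurable_fun_EFin_indic|move=> x; rewrite lee_fin indicE].
Qed.

(** * Gram determinants and orthogonal projections *)

Section dot_matrix.
Context (R : realType) (n : nat).
Local Notation V := 'rV[R]_n.
Implicit Types (s : seq V) (F : {vspace V}).

(** The number k of rows is not tied to the size of s, so that it can be a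
    dimension that is only provably equal to it. *)
Definition seqmx k s : 'M[R]_(k, n) := \matrix_(i < k) s`_i.

Lemma mulmx_seqmx k s (x : 'rV[R]_k) : x *m seqmx k s = \sum_(i < k) x 0 i *: s`_i.
Proof.
rewrite mulmx_sum_row; apply: eq_bigr => i _; by rewrite rowK.
Qed.

Lemma mulmx_tr_dotv k l (M : 'M[R]_(k, n)) (N : 'M[R]_(l, n)) i j :
  (M *m N^T) i j = dotv (row i M) (row j N).
Proof.
by rewrite dotvE mxE; apply: eq_bigr => c _; rewrite !mxE.
Qed.

Lemma dotv_eq0 (u : V) : dotv u u = 0 -> u = 0.
Proof.
rewrite dotvE => /eqP; rewrite psumr_eq0 => [/allP u0|i _]; last by rewrite -expr2 sqr_ge0.
apply/rowP => i; rewrite mxE; apply/eqP.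
by have := u0 i; rewrite mem_index_enum -expr2 sqrf_eq0; exact.
Qed.

Definition row_inj k (M : 'M[R]_(k, n)) := forall x : 'rV[R]_k, x *m M = 0 -> x = 0.

Lemma gram_unitmx k (M : 'M[R]_(k, n)) : row_inj M -> M *m M^T \in unitmx.
Proof.
move=> injM; rewrite -row_free_unit; apply: inj_row_free => x xMM.
apply/injM/dotv_eq0; rewrite /dotv trmx_mul.
by rewrite mulmxA -[x *m M *m _]mulmxA xMM mul0mx mxE.
Qed.

Lemma free_row_inj k s : k = size s -> free s -> row_inj (seqmx k s).
Proof.
move=> -> fs x; rewrite mulmx_seqmx => x0.
have /freeP := (fs : free (in_tuple s)); move=> /(_ (fun i => x 0 i)) h.
by apply/rowP => i; rewrite mxE h.
Qed.

Lemma onbasis_gram F (B := onbasis F) : seqmx (\dim F) B *m (seqmx (\dim F) B)^T = 1%:M.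
Proof.
have [_ Bon] := onbasisP F.
by apply/matrixP => i j; rewrite mulmx_tr_dotv !rowK !mxE -!tnth_nth Bon.
Qed.

Lemma onbasis_expand F v (MB := seqmx (\dim F) (onbasis F)) : v \in F ->
  v *m MB^T *m MB = v.
Proof.
move=> vF; have [Bb Bon] := onbasisP F.
have vE := coord_basis Bb vF.
pose c : 'rV[R]_(\dim F) := \row_i coord (onbasis F) i v.
have -> : v = c *m MB.
  by rewrite mulmx_seqmx [LHS]vE; apply: eq_bigr => i _; rewrite mxE.
by rewrite -(mulmxA c) onbasis_gram mulmx1.
Qed.

Lemma onbasis_change F (M : 'M[R]_(\dim F, n)) (MB := seqmx (\dim F) (onbasis F)) :
  (forall i, row i M \in F) -> row_inj M ->
  exists G, [/\ G \in unitmx, M = G *m MB & M *m M^T = G *m G^T].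
Proof.
move=> MF injM; pose G := M *m MB^T.
have MG : M = G *m MB.
  by apply/row_matrixP => i; rewrite !row_mul onbasis_expand.
have gramM : M *m M^T = G *m G^T.
  by rewrite {1 2}MG trmx_mul mulmxA -(mulmxA G) onbasis_gram mulmx1.
by exists G; split => //; have := gram_unitmx injM; rewrite gramM unitmx_mul => /andP[].
Qed.

Lemma fineMr (a : \bar R) (c : R) : 0 < c -> fine (a * c%:E) = fine a * c.
Proof.
move=> c0; case: a => [a|//|//]; first by rewrite -EFinM.
- by rewrite gt0_mulye ?lte_fin// mul0r.
- by rewrite gt0_mulNye ?lte_fin// mul0r.
Qed.

(** Volume in F computed in the coordinates of any basis, the rows of M. The
    passage to the orthonormal basis is a matrix G with M *m M^T = G *m G^T, so
    its determinant is the root of the Gram determinant. *)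
Lemma vol_rows F k (M : 'M[R]_(k, n)) (A : set V) : k = \dim F ->
  (forall i, row i M \in F) -> row_inj M -> compact A ->
  vol F A = Num.sqrt (\det (M *m M^T)) * fine (leb [set x : 'rV[R]_k | A (x *m M)]).
Proof.
move=> ek; subst k => MF injM cA.
pose MB := seqmx (\dim F) (onbasis F).
have [G [uG MG gramM]] := onbasis_change MF injM.
have dG : 0 < `|\det G| by rewrite normr_gt0 -unitfE -unitmxE.
rewrite gramM det_mulmx det_tr -expr2 sqrtr_sqr mulrC.
have mB : measurable [set x : 'rV[R]_(\dim F) | A (x *m MB)].
  exact: measurable_preimage_mulmxr.
rewrite -fineMr//.
rewrite (_ : [set x | A (x *m M)] = [set x | [set x | A (x *m MB)] (x *m G)]).
  rewrite leb_mulmx// leb_lebesgue_tuple// /vol; congr (fine (lebesgue_tuple R _ _)).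
  have E t : row_of_tuple t *m MB = \sum_i tnth t i *: tnth (onbasis F) i.
    by rewrite mulmx_seqmx; apply: eq_bigr => i _; rewrite /row_of_tuple mxE -tnth_nth.
  by apply/seteqP; split=> t /=; rewrite E.
by apply/seteqP; split=> x /=; rewrite -mulmxA -MG.
Qed.

Lemma leb_cube k : leb [set x : 'rV[R]_k | forall i, 0 <= x 0 i <= 1] = 1%E.
Proof.
rewrite leb_lebesgue_tuple; last first.
  apply: compact_measurable_row.
  apply: (@rV_compact R k (fun=> `[0, 1]%classic)) => _.
  exact: segment_compact.
have := @lebesgue_tuple_box R k (fun=> `[0, 1]%classic) (fun=> measurable_itv _).
rewrite big1 => [<-|i _]; last first.
  by rewrite lebesgue_measure_itv/= lte_fin ltr01 -EFinD subr0.
congr (lebesgue_tuple _ _ _); apply/seteqP; split=> t /= h i.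
  by have := h i; rewrite mxE in_itv.
by have := h i; rewrite mxE in_itv.
Qed.

Definition gramdet s := \det (seqmx (size s) s *m (seqmx (size s) s)^T).

Lemma gramdetE k s : k = size s -> gramdet s = \det (seqmx k s *m (seqmx k s)^T).
Proof. by move=> ->. Qed.

Lemma wedge_normE s : free s -> wedge_norm s = Num.sqrt (gramdet s).
Proof.
move=> fs; rewrite /wedge_norm fs.
have injs := free_row_inj (erefl _) fs.
have paraE : parallelepiped s =
    [set x *m seqmx (size s) s | x in [set x : 'rV[R]_(size s) | forall i, 0 <= x 0 i <= 1]].
  apply/seteqP; split=> v [t t01 <-].
    exists (\row_i t i) => [i|]; first by rewrite mxE; exact: t01.
    by rewrite mulmx_seqmx; apply: eq_bigr => i _; rewrite mxE.
  by exists (fun i => t 0 i) => //; rewrite mulmx_seqmx.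
rewrite (@vol_rows _ (size s) (seqmx (size s) s))//.
- rewrite (_ : [set x | _] = [set x : 'rV[R]_(size s) | forall i, 0 <= x 0 i <= 1]).
    by rewrite leb_cube mulr1.
  rewrite paraE; apply/seteqP; split=> x /=; last by exists x.
  move=> [y y01 /eqP]; rewrite -subr_eq0 -mulmxBl => /eqP/injs/eqP.
  by rewrite subr_eq0 => /eqP <-.
- by move: fs => /eqP.
- by move=> i; rewrite rowK memv_span// mem_nth.
- rewrite paraE; apply: compact_mulmxr.
  apply: (@rV_compact R (size s) (fun=> `[0, 1]%classic)) => _.
  exact: segment_compact.
Qed.

End dot_matrix.

Section orthogonal.
Context (R : realType) (n : nat).
Local Notation V := 'rV[R]_n.
Implicit Types (s a b : seq V) (F E : {vspace V}) (u v : V).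

Lemma dotv_sym u v : dotv u v = dotv v u.
Proof. by rewrite !dotvE; apply: eq_bigr => i _; rewrite mulrC. Qed.

Lemma dotvBl u v x : dotv (u - v) x = dotv u x - dotv v x.
Proof. by rewrite linearBl. Qed.

Lemma orthocP F u : reflect (forall v, v \in F -> dotv u v = 0) (u \in orthoc F).
Proof. apply: (iffP idP) => [/mem_orthovP h v|h]; first exact: h.
by apply/mem_orthovP => v; exact: h. Qed.

Lemma orthoc_spanP s u :
  reflect (forall v, v \in s -> dotv u v = 0) (u \in orthoc (span s)).
Proof.
apply: (iffP (orthocP _ _)) => h v vs; first by apply: h; exact: memv_span.
by rewrite (coord_span (X := in_tuple s) vs) linear_sumr big1// => i _; rewrite linearZr_LR/= h ?mulr0// mem_nth.
Qed.

Lemma dim_orthoc F : (\dim F + \dim (orthoc F) = n)%N.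
Proof.
by rewrite -dimv_disjoint_sum ?capv_orthoc// addv_orthoc dimvf /dim/= mul1n.
Qed.

Lemma orthocK F : orthoc (orthoc F) = F.
Proof.
apply/eqP; rewrite eq_sym eqEdim; apply/andP; split.
  apply/subvP => u uF; apply/orthocP => v /orthocP/(_ _ uF).
  by rewrite dotv_sym.
by rewrite -(leq_add2r (\dim (orthoc F))) addnC dim_orthoc dim_orthoc.
Qed.

Lemma orthoproj_mem F u : orthoproj F u \in F.
Proof. exact: memv_pi. Qed.

Lemma orthoproj_sub F u : u - orthoproj F u \in orthoc F.
Proof.
have /(daddv_pi_add (capv_orthoc F)) : u \in (F + orthoc F)%VS.
  by rewrite addv_orthoc memvf.
by rewrite /orthoproj => e; rewrite -[X in X - _]e addrAC subrr add0r memv_pi.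
Qed.

Lemma orthoproj_uniq F u v : v \in F -> u - v \in orthoc F -> orthoproj F u = v.
Proof.
move=> vF uv; have d1 : orthoproj F u - v \in F by rewrite rpredB// orthoproj_mem.
have d2 : orthoproj F u - v \in orthoc F.
  rewrite -(addrNK u (orthoproj F u)) -addrA rpredD//.
  by rewrite -opprB rpredN orthoproj_sub.
have : orthoproj F u - v \in (F :&: orthoc F)%VS by rewrite memv_cap d1 d2.
by rewrite capv_orthoc memv0 subr_eq0 => /eqP.
Qed.

Lemma orthoproj_id F u : u \in F -> orthoproj F u = u.
Proof. by move=> uF; apply: orthoproj_uniq => //; rewrite subrr mem0v. Qed.

Lemma orthoproj_orthoc F u : u \in F -> orthoproj (orthoc F) u = 0.
Proof.
by move=> uF; apply: orthoproj_uniq; rewrite ?mem0v// subr0 orthocK.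
Qed.

Lemma orthoc_projC F u : u - orthoproj (orthoc F) u \in F.
Proof. by rewrite -{2}(orthocK F) orthoproj_sub. Qed.

Lemma gramdet_gt0 s : free s -> 0 < gramdet s.
Proof.
move=> fs; have ds : size s = \dim (span s) by apply/esym/eqP.
have injs := free_row_inj (esym ds) fs.
have [|G [uG _ GE]] := onbasis_change (M := seqmx (\dim (span s)) s) _ injs.
  by move=> i; rewrite rowK memv_span// mem_nth// ds.
rewrite (@gramdetE _ _ (\dim (span s)))// GE det_mulmx det_tr -expr2.
by rewrite lt_neqAle sqr_ge0 andbT eq_sym sqrf_eq0 -unitfE -unitmxE.
Qed.

Lemma wedge_norm_gt0 s : free s -> 0 < wedge_norm s.
Proof. by move=> fs; rewrite wedge_normE// sqrtr_gt0 gramdet_gt0. Qed.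

Lemma gramdet_nil : gramdet ([::] : seq V) = 1.
Proof. by rewrite /gramdet det_mx00. Qed.

Lemma gramdet_perm a b : perm_eq a b -> gramdet a = gramdet b.
Proof.
move=> pab; have sz := perm_size pab.
have /tuple_permP[/= p aE] : perm_eq a (in_tuple b) by [].
rewrite (@gramdetE _ _ (size b) a)// /gramdet.
have -> : seqmx (size b) a = row_perm p (seqmx (size b) b).
  apply/row_matrixP => i; rewrite rowK [RHS](_ : _ = b`_(p i)); last first.
    by apply/rowP => j; rewrite !mxE.
  rewrite {1}aE.
  by rewrite (nth_map i) ?size_enum_ord// nth_ord_enum (tnth_nth 0).
rewrite row_permE trmx_mul mulmxA -(mulmxA (perm_mx p)) !det_mulmx det_tr det_perm.
by rewrite [LHS]mulrC signrMK.
Qed.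

(** Subtracting from the vectors of b their components in the span of a is a
    unitriangular operation, after which the Gram matrix is block diagonal. *)
Lemma gramdet_cat a b : gramdet (a ++ b) =
  gramdet a * gramdet [seq orthoproj (orthoc (span a)) v | v <- b].
Proof.
pose P := orthoproj (orthoc (span a)).
pose k := size a; pose l := size b.
pose Ma := seqmx k a; pose Mb := seqmx l b; pose Mb' := seqmx l [seq P v | v <- b].
pose C : 'M[R]_(l, k) := \matrix_(i, j) coord (in_tuple a) j (b`_i - P b`_i).
have bE : Mb = C *m Ma + Mb'.
  apply/row_matrixP => i; rewrite linearD/= row_mul mulmx_seqmx !rowK.
  rewrite (nth_map 0)// -[LHS](subrK (P b`_i)); congr (_ + _).
  rewrite [LHS](coord_span (X := in_tuple a)) ?orthoc_projC//.
  by apply: eq_bigr => j _; rewrite !mxE.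
rewrite (@gramdetE _ _ (k + l)) ?size_cat// (@gramdetE _ _ l [seq P v | v <- b]) ?size_map//.
have -> : seqmx (k + l) (a ++ b) = block_mx 1%:M 0 C 1%:M *m col_mx Ma Mb'.
  rewrite mul_block_col !mul1mx mul0mx addr0 -bE.
  apply/row_matrixP => i; rewrite rowK nth_cat.
  case: (split_ordP i) => j ->.
    by rewrite rowKu rowK.
  by rewrite rowKd rowK/= addKn.
set T := block_mx _ _ _ _; set N := col_mx _ _.
have -> : T *m N *m (T *m N)^T = T *m (N *m N^T) *m T^T by rewrite trmx_mul !mulmxA.
rewrite !det_mulmx det_tr /T det_lblock !det1 !mul1r mulr1 /N.
rewrite tr_col_mx mul_col_row.
have o1 : Ma *m Mb'^T = 0.
  apply/matrixP => i j; rewrite mulmx_tr_dotv !rowK mxE (nth_map 0)// dotv_sym.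
  by apply/(orthoc_spanP a); rewrite ?orthoproj_mem// mem_nth.
have o2 : Mb' *m Ma^T = 0.
  by apply: (can_inj trmxK); rewrite trmx_mul trmxK o1 trmx0.
by rewrite o1 o2 det_lblock.
Qed.

End orthogonal.

(** * Projections along the vectors of a basis *)

Section basis.
Context (R : realType) (n : nat) (w : n.-tuple 'rV[R]_n).
Local Notation V := 'rV[R]_n.
Hypothesis wb : basis_of fullv w.
Implicit Types (A B : {set 'I_n}) (K : set V).

Definition subfam A := [seq tnth w k | k <- enum A].

Let W := seqmx n w.

Lemma size_subfam A : size (subfam A) = #|A|.
Proof. by rewrite size_map -cardE. Qed.

Lemma subfamT : subfam [set: 'I_n]%SET = w.
Proof.
rewrite /subfam -[RHS](map_tnth_enum w); congr map.
by rewrite (eq_enum (B := predT))// => i; rewrite inE.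
Qed.

Lemma subfamU A B : A \subset ~: B ->
  perm_eq (subfam (A :|: B)) (subfam A ++ subfam B).
Proof.
move=> dAB; rewrite -map_cat; apply: perm_map; apply: uniq_perm.
- exact: enum_uniq.
- rewrite cat_uniq !enum_uniq andbT/=; apply/hasPn => i; rewrite !mem_enum => iB.
  by apply: contraL iB => /(fintype.subsetP dAB); rewrite inE.
- by move=> i; rewrite mem_cat !mem_enum inE.
Qed.

Lemma subset_setCC A : A \subset ~: ~: A.
Proof. by rewrite finset.setCK. Qed.

Lemma free_subfam A : free (subfam A).
Proof.
apply: (@catl_free _ _ (subfam (~: A))).
rewrite -(perm_free (subfamU (subset_setCC A))) finset.setUCr subfamT.
exact: basis_free wb.
Qed.

Lemma mem_subfam A k : k \in A -> tnth w k \in subfam A.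
Proof. by move=> kA; apply: map_f; rewrite mem_enum. Qed.

Lemma dim_span_subfam A : \dim (span (subfam A)) = #|A|.
Proof. by have /eqP -> := free_subfam A; rewrite size_subfam. Qed.

Lemma gramdet_subfam A B : A \subset ~: B ->
  gramdet (subfam (A :|: B)) = gramdet (subfam A) *
    gramdet [seq orthoproj (orthoc (span (subfam A))) v | v <- subfam B].
Proof. by move=> dAB; rewrite (gramdet_perm (subfamU dAB)) gramdet_cat. Qed.

Lemma basis_unitmx : W \in unitmx.
Proof.
have injW : row_inj W by apply: free_row_inj; [rewrite size_tuple|exact: basis_free wb].
have := gram_unitmx injW; rewrite unitmx_mul => /andP[]//.
Qed.

Lemma compact_orthoproj (F : {vspace V}) K : compact K -> compact (orthoproj F @` K).
Proof.
move=> cK; have := compact_mulmxr (M := lin1_mx (orthoproj F)) cK; congr compact.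
by apply/seteqP; split=> _ [x Kx <-]; exists x; rewrite ?mul_rV_lin1.
Qed.

Definition coord_body K : set V := [set z | K (z *m W)].

Lemma row_inj_gram k (M : 'M[R]_(k, n)) : \det (M *m M^T) != 0 -> row_inj M.
Proof.
rewrite -unitfE -unitmxE => uM x xM.
by rewrite -[x](mulmxK uM) mulmxA xM !mul0mx.
Qed.

(** The projection along span (subfam w B) kills w_k for k \in B and maps the
    other w_k to a basis of the complement. In the coordinates of that basis
    the image of K is a coordinate projection of [coord_body K], and the Gram
    determinant of that basis is the quotient of those of w and of
    subfam w B, by [gramdet_cat]. *)
Lemma vol_orthoc_subfam B K : compact K ->
  vol (orthoc (span (subfam B))) (orthoproj (orthoc (span (subfam B))) @` K) =
  wedge_norm w / wedge_norm (subfam B) *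
  fine (flatvol (enum (~: B)) (cyl (~: B) (coord_body K)) 0).
Proof.
move=> cK; set F := orthoc _.
pose P := orthoproj F.
pose s := [seq P v | v <- subfam (~: B)].
pose l : #|~: B|.-tuple 'I_n := enum_tuple (~: B).
pose M := seqmx #|~: B| s.
have ssz : size s = #|~: B| by rewrite size_map size_subfam.
have gs : gramdet w = gramdet (subfam B) * gramdet s.
  by rewrite -subfamT -(finset.setUCr B) gramdet_subfam// subset_setCC.
have gB0 : 0 < gramdet (subfam B) by rewrite gramdet_gt0// free_subfam.
have gw0 : 0 < gramdet w by rewrite gramdet_gt0// (basis_free wb).
have gs0 : 0 < gramdet s by rewrite -(pmulr_rgt0 _ gB0) -gs.
have gsM : gramdet s = \det (M *m M^T) by rewrite (@gramdetE _ _ #|~: B|).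
have injM : row_inj M by apply: row_inj_gram; rewrite -gsM gt_eqF.
have sE (i : 'I_#|~: B|) : s`_i = P (tnth w (tnth l i)).
  rewrite (nth_map 0) ?size_subfam//; congr (P _).
  by rewrite (nth_map (tnth l i)) -?cardE// [in RHS](tnth_nth (tnth l i)).
have lE (i : 'I_#|~: B|) : tnth l i = enum_val i by rewrite (tnth_nth (enum_default i)).
have PW z : P (z *m W) = (\row_i z 0 (tnth l i)) *m M.
  rewrite !mulmx_seqmx linear_sum/= (bigID (fun j => j \in B))/= big1 ?add0r.
    rewrite (eq_bigl (fun j => j \in ~: B)) => [|j]; last by rewrite inE.
    rewrite big_enum_val; apply: eq_bigr => i _.
    by rewrite linearZ/= mxE sE lE -tnth_nth.
  move=> j jB; rewrite linearZ/= -tnth_nth /P orthoproj_orthoc ?scaler0//.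
  by apply: memv_span; exact: mem_subfam.
rewrite (@vol_rows _ _ F #|~: B| M)//; last 3 first.
- apply: (@addnI #|B|); rewrite cardsC card_ord.
  by rewrite -(dim_span_subfam B) dim_orthoc.
- by move=> i; rewrite rowK sE; exact: orthoproj_mem.
- exact: compact_orthoproj.
congr (_ * _).
  rewrite -gsM !wedge_normE ?(basis_free wb) ?free_subfam//.
  by rewrite gs sqrtrM ?(ltW gB0)// mulrAC mulfV ?mul1r// gt_eqF// sqrtr_gt0.
have mE : measurable [set x : 'rV[R]_(#|~: B|) | (P @` K) (x *m M)].
  by apply: measurable_preimage_mulmxr; exact: compact_orthoproj.
rewrite leb_lebesgue_tuple// -(flatvol_coords (l := l) 0) ?enum_uniq//.
congr fine; apply: eq_flatvol => y _ /=.
have -> : row_of_tuple (coords l y) = \row_i y 0 (tnth l i).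
  by apply/rowP => i; rewrite !mxE tnth_mktuple.
split.
  move=> [u Ku uE]; exists (u *m invmx W).
    by rewrite /coord_body/= mulmxKV// basis_unitmx.
  have /eqP : P (u *m invmx W *m W) = P u by rewrite mulmxKV// basis_unitmx.
  rewrite PW uE -subr_eq0 -mulmxBl => /eqP/injM/eqP; rewrite subr_eq0 => /eqP/rowP e i iB.
  have il : i \in l by rewrite mem_enum.
  by have /tnthP[j ->] := il; have := e j; rewrite !mxE.
move=> [z Kz yz]; exists (z *m W) => //.
rewrite -/P PW; congr (_ *m _); apply/rowP => i; rewrite !mxE yz//.
by have := mem_tnth i l; rewrite mem_enum.
Qed.

End basis.

(** * The inequalities for a cover and for its complement *)

Section cover_forms.
Context (R : realType) (n : nat) (v : {set 'I_n} -> R).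
Hypothesis v_gt0 : forall A, 0 < v A.

(** The conclusion of [projection_inequality] for all covers at once: the
    second inequality applies it to another cover than the given one. *)
Definition cylinder_inequality := forall m (S : {set 'I_n}) (Sj : 'I_m -> {set 'I_n}) (p : 'I_m -> R),
  uniform_cover S Sj p -> (0 < #|S|)%N ->
  v (~: S) `^ (\sum_(j < m) p j - 1) * v [set: 'I_n]%SET <=
  ((\prod_(j < m) 'C(n - #|S| + #|Sj j|, #|Sj j|)%:R `^ p j) / 'C(n, #|S|)%:R) *
  \prod_(j < m) v (~: S :|: Sj j) `^ p j.
Hypothesis core : cylinder_inequality.

Variables (m : nat) (S : {set 'I_n}) (Sj : 'I_m -> {set 'I_n}) (p : 'I_m -> R).
Hypothesis cov : uniform_cover S Sj p.
Let pt := \sum_(j < m) p j.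

Let cov0 j : #|S| = 0%N -> Sj j = finset.set0.
Proof.
move=> /eqP; rewrite cards_eq0 => /eqP S0; have [_ /(_ j) + _ _] := cov.
by rewrite S0 finset.subset0 => /eqP.
Qed.

(** If S is empty, both sides are a power of v [set: 'I_n] with the same
    exponent. *)
Lemma cover_inequality :
  v (~: S) `^ (pt - 1) * v [set: 'I_n]%SET <=
  ((\prod_(j < m) 'C(n - #|S| + #|Sj j|, #|Sj j|)%:R `^ p j) / 'C(n, #|S|)%:R) *
  \prod_(j < m) v (~: S :|: Sj j) `^ p j.
Proof.
have [S0|S0] := posnP #|S|; last exact: core.
rewrite S0 bin0 divr1 big1 => [|j _]; last first.
  by rewrite cov0// cards0 bin0 powR1.
rewrite mul1r; move/eqP: (S0); rewrite cards_eq0 => /eqP ->.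
rewrite (eq_bigr (fun j => v [set: 'I_n]%SET `^ p j)) => [|j _]; last first.
  by rewrite (cov0 _ S0) finset.setU0 finset.setC0.
by rewrite prod_powR_sum// finset.setC0 -powR_subr1.
Qed.

Let pt_ge1 : (0 < #|S|)%N -> 1 <= pt.
Proof.
rewrite card_gt0 => /set0Pn[i iS]; have [_ _ p0 /(_ _ iS) <-] := cov.
by apply: ler_sum => j _; rewrite ler_piMr ?(ltW (p0 _))// lern1 leq_b1.
Qed.

(** The sets S :\: Sj j form a uniform cover of S with weights
    p j / (pt - 1); raise the inequality for it to the power pt - 1. If pt = 1,
    every Sj j equals S and the two sides are equal. *)
Lemma complement_cover_inequality :
  v (~: S) * v [set: 'I_n]%SET `^ (pt - 1) <=
  ((\prod_(j < m) 'C(n - #|Sj j|, n - #|S|)%:R `^ p j) / 'C(n, #|S|)%:R `^ (pt - 1)) *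
  \prod_(j < m) v (~: Sj j) `^ p j.
Proof.
have [m0 SjS p0 pS] := cov.
have [S0|S0] := posnP #|S|.
  rewrite S0 bin0 powR1 divr1 big1 => [|j _]; last first.
    by rewrite cov0// cards0 binn powR1.
  rewrite mul1r; move/eqP: (S0); rewrite cards_eq0 => /eqP ->.
  rewrite (eq_bigr (fun j => v [set: 'I_n]%SET `^ p j)) => [|j _]; last first.
    by rewrite (cov0 _ S0) finset.setC0.
  by rewrite prod_powR_sum// finset.setC0 mulrC -powR_subr1.
have cardSn : (#|S| <= n)%N by rewrite -[X in (_ <= X)%N](card_ord n) max_card.
have := pt_ge1 S0; rewrite le_eqVlt => /predU1P[pt1|pt1].
  have SjE j : Sj j = S.
    apply/eqP; rewrite finset.eqEsubset SjS/=; apply/fintype.subsetP => i iS.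
    apply: contraT => ij; have : \sum_(j < m) p j * (i \in Sj j)%:R < pt.
      rewrite /pt (bigD1 j)//= [ltRHS](bigD1 j)//= (negbTE ij) mulr0.
      apply: ltr_leD => //; apply: ler_sum => k _.
      by rewrite ler_piMr ?(ltW (p0 _))// lern1 leq_b1.
    by rewrite pS// -pt1 ltxx.
  rewrite -pt1 subrr !powRr0 mulr1 divr1 big1 => [|j _]; last first.
    by rewrite SjE binn powR1.
  rewrite mul1r (eq_bigr (fun j => v (~: S) `^ p j)) => [|j _]; last by rewrite SjE.
  by rewrite prod_powR_sum// -/pt -pt1 powRr1// ltW.
have r0 : 0 < pt - 1 by rewrite subr_gt0.
have covT : uniform_cover S (fun j => S :\: Sj j) (fun j => p j / (pt - 1)).
  split => // [j|j|i iS]; first exact: finset.subsetDl.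
    by rewrite divr_gt0.
  rewrite -[RHS](divff (lt0r_neq0 r0)) -[X in _ = (_ - X) / _](pS i iS) /pt.
  rewrite -sumrB mulr_suml; apply: eq_bigr => j _.
  by rewrite inE iS andbT; case: (_ \in _); rewrite /= ?mulr1 ?mulr0 ?subrr ?subr0 ?mul0r.
have := core covT S0; rewrite -mulr_suml -/pt.
have -> : pt / (pt - 1) - 1 = (pt - 1)^-1 by field; rewrite gt_eqF.
have binE j : 'C(n - #|S| + #|S :\: Sj j|, #|S :\: Sj j|) = 'C(n - #|Sj j|, n - #|S|).
  have jS : (#|Sj j| <= #|S|)%N by rewrite subset_leq_card.
  have cE : #|S :\: Sj j| = (#|S| - #|Sj j|)%N.
    by rewrite cardsD (finset.setIidPr (SjS j)).
  have -> : (n - #|S| + #|S :\: Sj j| = n - #|Sj j|)%N by rewrite cE addnBA// subnK.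
  rewrite -[RHS]bin_sub; last exact: leq_sub2l.
  by rewrite cE subnBA// addnC addnBA ?(leq_trans jS)// subnAC addnK.
have setE j : ~: S :|: S :\: Sj j = ~: Sj j.
  apply/setP => i; rewrite !inE; have /fintype.subsetP/(_ i) := SjS j.
  by case: (i \in S); case: (i \in Sj j) => //= /(_ isT).
under eq_bigr do rewrite binE.
under [X in _ <= _ * X]eq_bigr do rewrite setE.
set lhs := (X in X <= _); set rhs := (X in _ <= X) => H.
have lhs0 : 0 <= lhs by rewrite mulr_ge0 ?powR_ge0// ltW.
have : lhs `^ (pt - 1) <= rhs `^ (pt - 1).
  by apply: ge0_ler_powR; rewrite ?nnegrE ?(ltW r0)// (le_trans lhs0).
have Cpos j : 0 < 'C(n - #|Sj j|, n - #|S|)%:R :> R.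
  by rewrite ltr0n bin_gt0 leq_sub2l// subset_leq_card.
have Cn : 0 < 'C(n, #|S|)%:R :> R by rewrite ltr0n bin_gt0.
have prodE (F : 'I_m -> R) : (forall j, 0 <= F j) ->
    (\prod_(j < m) F j `^ (p j / (pt - 1))) `^ (pt - 1) = \prod_(j < m) F j `^ p j.
  move=> F0.
  suff [_ ->] : 0 <= \prod_(j < m) F j `^ (p j / (pt - 1)) /\
      (\prod_(j < m) F j `^ (p j / (pt - 1))) `^ (pt - 1) = \prod_(j < m) F j `^ p j by [].
  elim/big_ind2 : _ => [|x x' y y' [x0 xE] [y0 yE]|j _].
  - by rewrite powR1.
  - by rewrite mulr_ge0// powRM// xE yE.
  - by rewrite powR_ge0 -powRrM divfK// gt_eqF.
rewrite /lhs /rhs powRM ?powR_ge0 ?(ltW (v_gt0 _))//.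
rewrite -powRrM mulVf ?gt_eqF// powRr1 ?(ltW (v_gt0 _))//.
move=> /le_trans; apply.
have A0 : 0 <= \prod_(j < m) 'C(n - #|Sj j|, n - #|S|)%:R `^ (p j / (pt - 1)) :> R.
  by apply: prodr_ge0 => j _; exact: powR_ge0.
have B0 : 0 <= \prod_(j < m) v (~: Sj j) `^ (p j / (pt - 1)).
  by apply: prodr_ge0 => j _; exact: powR_ge0.
rewrite powRM ?divr_ge0 ?(ltW Cn)// powR_div ?(ltW Cn)//.
by rewrite !prodE => [|j|j]; [|exact: ltW|exact: ltW].
Qed.

End cover_forms.

Section convex_body_volumes.
Context (R : realType) (n : nat) (w : n.-tuple 'rV[R]_n).
Local Notation V := 'rV[R]_n.
Hypothesis wb : basis_of fullv w.
Variable K : set V.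
Hypothesis Kbody : convex_body K.

Let W := seqmx n w.
Let K' := coord_body w K.
Let v (A : {set 'I_n}) : R := fine (flatvol (enum A) (cyl A K') 0).

Let uW : W \in unitmx. Proof. exact: basis_unitmx. Qed.

Let K'E : K' = [set x *m invmx W | x in K].
Proof.
apply/seteqP; split=> z /=.
  by move=> Kz; exists (z *m W) => //; rewrite mulmxK.
by move=> [x Kx <-]; rewrite /K' /coord_body/= mulmxKV.
Qed.

Let cK' : compact K'.
Proof. by rewrite K'E; apply: compact_mulmxr; case: Kbody. Qed.

Lemma convex_set_seg (A : set V) : convex_set A -> seg_convex A.
Proof.
move=> cA x y t Ax Ay /andP[t0 t1].
have := cA y x (Itv01 (ltW t0) (ltW t1)) (mem_set Ay) (mem_set Ax).
move=> /set_mem; congr A; exact: addrC.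
Qed.

Let K'conv : seg_convex K'.
Proof.
have [_ /convex_set_seg cK _] := Kbody.
move=> x y t Kx Ky t01; rewrite /K' /coord_body/= mulmxDl -!scalemxAl.
exact: cK.
Qed.

Let K'box : exists z0 : V, exists2 e : R, 0 < e &
  forall y : V, (forall i, `|y 0 i - z0 0 i| < e) -> K' y.
Proof.
have [_ _ [x0 x0K]] := Kbody.
exists (x0 *m invmx W).
have : nbhs (x0 *m invmx W *m W) K by rewrite mulmxKV.
move=> /(@continuous_mulmxr R n n W (x0 *m invmx W))/nbhs_ballP[e /= e0 eK].
exists e => // y ye; apply: eK; split => // i j.
by rewrite (ord1 i) /ball/= distrC ye.
Qed.

Let mK' A : measurable (cyl A K').
Proof. exact: compact_measurable_cyl. Qed.

Let vE (A : {set 'I_n}) : flatvol (enum A) (cyl A K') 0 = (v A)%:E.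
Proof.
have [c c0 Kc] := compact_coord_bounded cK'.
rewrite /v fineK// ge0_fin_numE ?flatvol_ge0//.
apply: le_lt_trans (@flatvol_le_box R n (enum A) _ c 0 (enum_uniq _) c0 (mK' A) _) (ltry _).
by move=> y Ky j; rewrite mem_enum; exact: (cyl_bounded Kc Ky).
Qed.

Let v_gt0 (A : {set 'I_n}) : 0 < v A.
Proof.
have [z0 [e e0 eK]] := K'box.
rewrite -lte_fin -vE; apply: lt_le_trans (@flatvol_ge_box R n (enum A) _ z0 0 e (enum_uniq _) e0 (mK' A) _).
  by rewrite lte_fin exprn_gt0// mulrn_wgt0.
move=> y _ yA; exists (\row_i (if i \in A then y 0 i else z0 0 i)).
  apply: eK => i; rewrite mxE; case: ifPn => iA; first by apply: yA; rewrite mem_enum.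
  by rewrite subrr normr0.
by move=> i iA; rewrite mxE iA.
Qed.

Let core : cylinder_inequality v.
Proof.
move=> m S Sj p cov S0.
have [c c0 Kc] := compact_coord_bounded cK'.
exact: (projection_inequality K'conv c0 Kc mK' vE v_gt0 cov S0).
Qed.

Local Notation omega A := (wedge_norm (subfam w A)).
Local Notation Horth A := (orthoc (span (subfam w A))).
Local Notation volP F := (vol F (orthoproj F @` K)).

Let D := wedge_norm w.
Let D0 : 0 < D. Proof. by apply: wedge_norm_gt0; exact: basis_free wb. Qed.
Let omega0 A : 0 < omega A. Proof. by apply: wedge_norm_gt0; exact: free_subfam. Qed.

Let volPE B : volP (Horth B) = D / omega B * v (~: B).
Proof. by apply: vol_orthoc_subfam => //; case: Kbody. Qed.

Let volKE : vol fullv K = D * v [set: 'I_n]%SET.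
Proof.
have nilE : subfam w finset.set0 = [::].
  by apply: size0nil; rewrite size_subfam cards0.
have := volPE finset.set0; rewrite nilE.
have -> : wedge_norm ([::] : seq V) = 1.
  by rewrite wedge_normE ?nil_free// gramdet_nil sqrtr1.
rewrite divr1 finset.setC0 => <-.
have -> : orthoc (span [::]) = fullv :> {vspace V}.
  apply/eqP; rewrite eqEsubv subvf; apply/subvP => u _.
  by apply/orthoc_spanP => y; rewrite in_nil.
congr vol; apply/seteqP; split=> [x Kx|_ [x Kx <-]].
  by exists x => //; rewrite orthoproj_id// memvf.
by rewrite orthoproj_id// memvf.
Qed.

Variables (m : nat) (S : {set 'I_n}) (Sj : 'I_m -> {set 'I_n}) (p : 'I_m -> R).
Hypothesis cov : uniform_cover S Sj p.
Let pt := \sum_(j < m) p j.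

Let prod_scale (B : 'I_m -> {set 'I_n}) (u : 'I_m -> R) : (forall j, 0 < u j) ->
  \prod_(j < m) (D / omega (B j) * u j) `^ p j =
  D `^ pt / (\prod_(j < m) omega (B j) `^ p j) * \prod_(j < m) u j `^ p j.
Proof.
move=> u0; rewrite -(prod_powR_sum _ _ D0) -prodf_div -big_split/=.
by apply: eq_bigr => j _; rewrite powRM ?divr_ge0 ?ltW// powR_div ?ltW.
Qed.

(** By [vol_orthoc_subfam] every volume is a multiple of some v A; the powers
    of D on the two sides agree. *)
Lemma cover_projection_inequality :
  volP (Horth S) `^ (pt - 1) * vol fullv K <=
  ((\prod_(j < m) omega (S :\: Sj j) `^ p j) / omega S `^ (pt - 1)) *
  ((\prod_(j < m) 'C(n - #|S| + #|Sj j|, #|Sj j|)%:R `^ p j) / 'C(n, #|S|)%:R) *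
  \prod_(j < m) volP (Horth (S :\: Sj j)) `^ p j.
Proof.
have [_ SjS _ _] := cov.
rewrite volPE volKE.
under [X in _ <= _ * X]eq_bigr do rewrite volPE.
rewrite prod_scale//.
have setE j : ~: (S :\: Sj j) = ~: S :|: Sj j.
  by apply/setP => i; rewrite !inE negb_and negbK orbC.
under [X in _ <= _ * (_ * X)]eq_bigr do rewrite setE.
have := cover_inequality v_gt0 core cov; rewrite -/pt.
have vE10 := v_gt0 (~: S); move: vE10; set vE1 := v (~: S) => vE10; set P := \prod_(j < m) v _ `^ _.
set C := \prod_(j < m) _ / _ => H.
set Om := \prod_(j < m) _ `^ _.
have Om0 : 0 < Om by apply: prodr_gt0 => j _; rewrite powR_gt0.
have oS0 : 0 < omega S `^ (pt - 1) by rewrite powR_gt0.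
rewrite [leRHS](_ : _ = D `^ pt / omega S `^ (pt - 1) * (C * P)); last first.
  by field; rewrite !gt_eqF.
rewrite [leLHS](_ : _ = D `^ pt / omega S `^ (pt - 1) * (vE1 `^ (pt - 1) * v [set: 'I_n]%SET)).
  by rewrite ler_pM2l// divr_gt0// powR_gt0.
rewrite powRM ?divr_ge0 ?ltW// powR_div ?ltW// (powR_subr1 pt D0).
by field; rewrite gt_eqF.
Qed.

Lemma complement_cover_projection_inequality :
  volP (Horth S) * vol fullv K `^ (pt - 1) <=
  ((\prod_(j < m) omega (Sj j) `^ p j) / omega S) *
  ((\prod_(j < m) 'C(n - #|Sj j|, n - #|S|)%:R `^ p j) / 'C(n, #|S|)%:R `^ (pt - 1)) *
  \prod_(j < m) volP (Horth (Sj j)) `^ p j.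
Proof.
rewrite volPE volKE.
under [X in _ <= _ * X]eq_bigr do rewrite volPE.
rewrite prod_scale//.
have := complement_cover_inequality v_gt0 core cov; rewrite -/pt.
have vE10 := v_gt0 (~: S); move: vE10; set vE1 := v (~: S) => vE10; set P := \prod_(j < m) v _ `^ _.
set C := \prod_(j < m) _ / _ => H.
set Om := \prod_(j < m) _ `^ _.
have Om0 : 0 < Om by apply: prodr_gt0 => j _; rewrite powR_gt0.
rewrite [leRHS](_ : _ = D `^ pt / omega S * (C * P)); last first.
  by field; rewrite !gt_eqF.
rewrite [leLHS](_ : _ = D `^ pt / omega S * (vE1 * v [set: 'I_n]%SET `^ (pt - 1))).
  by rewrite ler_pM2l// divr_gt0// powR_gt0.
rewrite powRM ?ltW// (powR_subr1 pt D0).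
by field; rewrite gt_eqF.
Qed.

End convex_body_volumes.

(** * The dual basis *)

Section dual_basis.
Context (R : realType) (n : nat) (w : n.-tuple 'rV[R]_n).
Local Notation V := 'rV[R]_n.
Hypothesis wb : basis_of fullv w.
Variable S : {set 'I_n}.
Local Notation spanw A := (span (subfam w A)).

Let W := seqmx n w.
Let Z := (invmx W)^T.

(** The rows of Z are dual to w. Projecting those with index in S to the span
    of w_S keeps their products with the w_l, l \in S, so that every u_k is
    orthogonal to the w_l with l \in S and l <> k. *)
Definition dual_basis : n.-tuple V :=
  [tuple if k \in S then orthoproj (spanw S) (row k Z) else row k Z | k < n].

Local Notation u := dual_basis.
Local Notation spanu A := (span (subfam u A)).

Let dotZ k l : dotv (row k Z) (tnth w l) = (k == l)%:R.
Proof.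
have -> : tnth w l = row l W by rewrite rowK -tnth_nth.
by rewrite -mulmx_tr_dotv /Z -trmx_mul mulmxV ?basis_unitmx// trmx1 mxE.
Qed.

Let uZ k : k \notin S -> tnth u k = row k Z.
Proof. by move=> kS; rewrite tnth_mktuple (negbTE kS). Qed.

Lemma dual_basis_mem k : k \in S -> tnth u k \in spanw S.
Proof. by move=> kS; rewrite tnth_mktuple kS orthoproj_mem. Qed.

Lemma dotv_dual_basis k l : l \in S -> dotv (tnth u k) (tnth w l) = (k == l)%:R.
Proof.
move=> lS; rewrite tnth_mktuple -dotZ; case: ifPn => // kS.
apply/eqP; rewrite -subr_eq0 -linearBl -opprB linearNl oppr_eq0; apply/eqP.
have /orthocP := orthoproj_sub (spanw S) (row k Z); apply.
by apply/memv_span/mem_subfam.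
Qed.

Lemma dual_basis_free : free u.
Proof.
have H : row_inj (seqmx n u).
  move=> x x0.
  have dx l : \sum_k x 0 k * dotv (tnth u k) (tnth w l) = 0.
    have : dotv (x *m seqmx n u) (tnth w l) = 0 by rewrite x0 linear0l.
    rewrite mulmx_seqmx linear_sumlz => e; rewrite -[RHS]e; apply: eq_bigr => k _.
    by rewrite linearZl_LR/= (tnth_nth 0).
  have xS l : l \in S -> x 0 l = 0.
    move=> lS; rewrite -[RHS](dx l) (bigD1 l)//= dotv_dual_basis// eqxx mulr1 big1 ?addr0//.
    by move=> k kl; rewrite dotv_dual_basis// (negbTE kl) mulr0.
  apply/rowP => l; rewrite mxE; have [/xS//|lS] := boolP (l \in S).
  rewrite -[RHS](dx l) (bigD1 l)//= uZ// dotZ eqxx mulr1 big1 ?addr0// => k kl.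
  have [kS|kS] := boolP (k \in S); first by rewrite xS ?mul0r.
  by rewrite uZ// dotZ (negbTE kl) mulr0.
apply/freeP => c c0 i; suff /rowP/(_ i) : \row_k c k = 0 by rewrite !mxE.
apply: H; rewrite mulmx_seqmx; by rewrite -[RHS]c0; apply: eq_bigr => k _; rewrite mxE.
Qed.

Lemma dual_basis_basis : basis_of fullv u.
Proof.
by rewrite basisEfree dual_basis_free subvf size_tuple dimvf /dim/= mul1n leqnn.
Qed.

Let ub := dual_basis_basis.

Lemma subset_span_subfam (A B : {set 'I_n}) : A \subset B -> (spanw A <= spanw B)%VS.
Proof.
move=> AB; apply: sub_span => _ /mapP[k kA ->]; apply: mem_subfam.
by apply: (fintype.subsetP AB); rewrite -mem_enum.
Qed.

Lemma span_dual_basis : spanu S = spanw S.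
Proof.
apply/eqP; rewrite eqEdim !dim_span_subfam// leqnn andbT.
by apply/span_subvP => _ /mapP[k kS ->]; apply: dual_basis_mem; rewrite -mem_enum.
Qed.

(** The right side is orthogonal to the u_k with k \in S :\: A, and both sides
    have dimension n - #|S| + #|A|. *)
Lemma orthoc_span_dual (A : {set 'I_n}) : A \subset S ->
  orthoc (spanu (S :\: A)) = (spanw A + orthoc (spanw S))%VS.
Proof.
move=> AS; apply/eqP; rewrite eq_sym eqEdim; apply/andP; split.
  rewrite subv_add; apply/andP; split.
    apply/span_subvP => _ /mapP[k kA ->]; rewrite mem_enum in kA.
    apply/orthoc_spanP => _ /mapP[l lSA ->]; rewrite mem_enum inE in lSA.
    rewrite dotv_sym dotv_dual_basis ?(fintype.subsetP AS)//.
    by case: eqP lSA => // ->; rewrite kA.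
  apply/subvP => v /orthocP vS; apply/orthoc_spanP => _ /mapP[l lSA ->].
  by apply: vS; apply: dual_basis_mem; move: lSA; rewrite mem_enum inE => /andP[].
rewrite dimv_disjoint_sum; last first.
  apply/eqP; rewrite -subv0 -(capv_orthoc (spanw S)).
  by apply: capvS => //; exact: subset_span_subfam.
rewrite -(leq_add2l (\dim (spanu (S :\: A)))) dim_orthoc !dim_span_subfam//.
rewrite addnA cardsD (finset.setIidPr AS) subnK ?subset_leq_card//.
by rewrite -(dim_span_subfam wb S) dim_orthoc.
Qed.

(** Project the w_k with k \in S :\: A along the span of w_A. The results s and
    the u_k with the same indices are dual bases of the same space, so that
    their Gram determinants are inverse to each other; and gramdet s is the
    quotient of the determinants for w_S and w_A, by [gramdet_subfam]. *)
Lemma gramdet_dual (A : {set 'I_n}) : A \subset S ->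
  gramdet (subfam u (S :\: A)) * gramdet (subfam w S) = gramdet (subfam w A).
Proof.
move=> AS; pose k := #|S :\: A|.
pose Q := orthoproj (orthoc (spanw A)).
pose s := [seq Q v | v <- subfam w (S :\: A)].
have gS : gramdet (subfam w S) = gramdet (subfam w A) * gramdet s.
  rewrite -gramdet_subfam; last by apply/fintype.subsetP => i iA; rewrite !inE iA.
  congr (gramdet (subfam w _)); apply/setP => i; rewrite !inE.
  by have /fintype.subsetP/(_ i) := AS; case: (i \in A) => //= ->.
pose MA := seqmx k s; pose MB := seqmx k (subfam u (S :\: A)).
have szw : size (subfam w (S :\: A)) = k by rewrite size_subfam.
have szu : size (subfam u (S :\: A)) = k by rewrite size_subfam.
have szs : size s = k by rewrite size_map.
have memk (t : n.-tuple V) (i : 'I_k) : exists2 j : 'I_n, j = enum_val i &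
    (subfam t (S :\: A))`_i = tnth t j.
  exists (enum_val i) => //.
  by rewrite (nth_map (enum_val i)) -?cardE//; congr tnth; apply/esym/(enum_val_nth (enum_val i)).
have sE (i : 'I_k) : s`_i = Q (subfam w (S :\: A))`_i by rewrite (nth_map 0) ?szw.
have AB1 : MA *m MB^T = 1%:M.
  apply/matrixP => i j; rewrite mulmx_tr_dotv !rowK mxE sE.
  have [a aE ->] := memk w i; have [b bE ->] := memk u j.
  have : b \in S :\: A by rewrite bE enum_valP.
  rewrite inE => /andP[bA bS].
  have aSA : a \in S :\: A by rewrite aE enum_valP.
  have aS : a \in S by move: aSA; rewrite inE => /andP[].
  have -> : dotv (Q (tnth w a)) (tnth u b) = dotv (tnth w a) (tnth u b).
    apply/eqP; rewrite eq_sym -subr_eq0 -dotvBl; apply/eqP.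
    have : tnth u b \in orthoc (spanw A).
      apply/orthoc_spanP => _ /mapP[l lA ->]; rewrite mem_enum in lA.
      rewrite dotv_dual_basis ?(fintype.subsetP AS)//.
      by case: eqP => // bl; move: bA; rewrite bl lA.
    by move=> /orthocP; rewrite dotv_sym; apply; exact: orthoc_projC.
  by rewrite dotv_sym dotv_dual_basis// aE bE (inj_eq enum_val_inj) eq_sym.
have MAin i : row i MA \in spanu (S :\: A).
  rewrite rowK sE -(orthocK (spanu (S :\: A))) orthoc_span_dual//.
  have [a aE ->] := memk w i.
  have : a \in S :\: A by rewrite aE enum_valP.
  rewrite inE => /andP[aA aS].
  apply/orthocP => _ /memv_addP[x xA [y yS ->]].
  rewrite linearDr/= (orthocP _ _ (orthoproj_mem _ _))// add0r dotv_sym.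
  apply: (orthocP _ _ yS).
  rewrite -(subKr (tnth w a) (Q _)) rpredB//; first exact/memv_span/mem_subfam.
  by apply: (subvP (subset_span_subfam AS)); exact: orthoc_projC.
pose C : 'M[R]_k := \matrix_(i, j) coord (tcast szu (in_tuple (subfam u (S :\: A)))) j (row i MA).
have MAE : MA = C *m MB.
  apply/row_matrixP => i; rewrite row_mul mulmx_seqmx.
  rewrite [LHS](coord_span (X := tcast szu (in_tuple (subfam u (S :\: A))))); last first.
    by rewrite val_tcast; exact: MAin.
  by apply: eq_bigr => j _; rewrite !mxE val_tcast.
have gs : gramdet s = \det C.
  rewrite (@gramdetE _ _ k)// -/MA {1}MAE -mulmxA.
  by rewrite (_ : MB *m MA^T = 1%:M) ?mulmx1// -[RHS]trmx1 -AB1 trmx_mul trmxK.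
have gu : \det C * gramdet (subfam u (S :\: A)) = 1.
  by rewrite (@gramdetE _ _ k)// -/MB -det_mulmx mulmxA -MAE AB1 det1.
by rewrite gS gs mulrCA (mulrC _ (\det C)) gu mulr1.
Qed.

Lemma wedge_norm_dual (A : {set 'I_n}) : A \subset S ->
  wedge_norm (subfam u (S :\: A)) = wedge_norm (subfam w A) / wedge_norm (subfam w S).
Proof.
move=> AS; have wS0 : 0 < wedge_norm (subfam w S) by rewrite wedge_norm_gt0 ?free_subfam.
apply: (mulIf (lt0r_neq0 wS0)); rewrite divfK ?gt_eqF//.
rewrite !wedge_normE ?free_subfam// -sqrtrM ?gramdet_dual//.
by rewrite ltW// gramdet_gt0// free_subfam.
Qed.

End dual_basis.

Section dual_inequalities.
Context (R : realType) (n : nat) (w : n.-tuple 'rV[R]_n).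
Local Notation V := 'rV[R]_n.
Hypothesis wb : basis_of fullv w.
Variable K : set V.
Hypothesis Kbody : convex_body K.
Variables (m : nat) (S : {set 'I_n}) (Sj : 'I_m -> {set 'I_n}) (p : 'I_m -> R).
Hypothesis cov : uniform_cover S Sj p.

Let pt := \sum_(j < m) p j.
Let u := dual_basis w S.
Let ub : basis_of fullv u. Proof. exact: dual_basis_basis. Qed.

Local Notation omega A := (wedge_norm (subfam w A)).
Local Notation H := (span (subfam w S)).
Local Notation volP F := (vol F (orthoproj F @` K)).

Let omega_gt0 A : 0 < omega A.
Proof. by rewrite wedge_norm_gt0 ?free_subfam. Qed.

Let SjS j : Sj j \subset S. Proof. by case: cov. Qed.

Let SjE j : S :\: (S :\: Sj j) = Sj j.
Proof. by rewrite finset.setDDr finset.setDv finset.set0U (finset.setIidPr (SjS j)). Qed.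

Let omega_dualS : wedge_norm (subfam u S) = (omega S)^-1.
Proof.
rewrite -[X in subfam u X]finset.setD0 wedge_norm_dual ?finset.sub0set//.
rewrite (_ : subfam w finset.set0 = [::]).
  by rewrite wedge_normE ?nil_free// gramdet_nil sqrtr1 mul1r.
by apply: size0nil; rewrite size_subfam cards0.
Qed.

Let prod_div_omega (a : 'I_m -> R) : (forall j, 0 < a j) ->
  \prod_(j < m) (a j / omega S) `^ p j = (\prod_(j < m) a j `^ p j) / omega S `^ pt.
Proof.
move=> a0; rewrite -(prod_powR_sum _ _ (omega_gt0 S)) -prodf_div.
by apply: eq_bigr => j _; rewrite powR_div ?ltW.
Qed.

(** The first inequality for the dual basis, where the wedge norms become
    quotients by the norm of w_S. *)
Lemma dual_cover_projection_inequality :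
  volP (orthoc H) `^ (pt - 1) * vol fullv K <=
  ((\prod_(j < m) omega (Sj j) `^ p j) / omega S) *
  ((\prod_(j < m) 'C(n - #|S| + #|Sj j|, #|Sj j|)%:R `^ p j) / 'C(n, #|S|)%:R) *
  \prod_(j < m) volP (span (subfam w (Sj j)) + orthoc H)%VS `^ p j.
Proof.
have := cover_projection_inequality ub Kbody cov; rewrite span_dual_basis// omega_dualS.
under [X in X / _ * _ * _]eq_bigr do rewrite wedge_norm_dual//.
under [X in _ <= _ * X]eq_bigr do rewrite orthoc_span_dual//.
rewrite prod_div_omega// -/pt (powR_subr1 pt (omega_gt0 S)) => /le_trans; apply.
rewrite le_eqVlt; apply/orP; left; apply/eqP; congr (_ * _ * _).
rewrite powR_inv ?ltW//.
by field; rewrite !gt_eqF ?powR_gt0.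
Qed.

Lemma dual_complement_cover_projection_inequality :
  volP (orthoc H) * vol fullv K `^ (pt - 1) <=
  ((\prod_(j < m) omega (S :\: Sj j) `^ p j) / omega S `^ (pt - 1)) *
  ((\prod_(j < m) 'C(n - #|Sj j|, n - #|S|)%:R `^ p j) / 'C(n, #|S|)%:R `^ (pt - 1)) *
  \prod_(j < m) volP (span (subfam w (S :\: Sj j)) + orthoc H)%VS `^ p j.
Proof.
have SDS j : S :\: Sj j \subset S by exact: finset.subsetDl.
have := complement_cover_projection_inequality ub Kbody cov; rewrite span_dual_basis// omega_dualS.
under [X in X / _ * _ * _]eq_bigr do rewrite -[in subfam u _]SjE wedge_norm_dual//.
under [X in _ <= _ * X]eq_bigr do rewrite -[in subfam u _]SjE orthoc_span_dual//.
rewrite prod_div_omega// (powR_subr1 pt (omega_gt0 S)) => /le_trans; apply.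
rewrite le_eqVlt; apply/orP; left; apply/eqP; congr (_ * _ * _).
by field; rewrite !gt_eqF ?powR_gt0.
Qed.

End dual_inequalities.

Theorem theorem1p5 (R : realType) (n : nat) (w : n.-tuple 'rV[R]_n)
    (S : {set 'I_n}) (m : nat) (Sj : 'I_m -> {set 'I_n}) (p : 'I_m -> R) :
  basis_of fullv w ->
  uniform_cover S Sj p ->
  let ws (A : {set 'I_n}) := [seq tnth w k | k <- enum A] in
  let d := #|S| in
  let dj j := #|Sj j| in
  let H := span (ws S) in
  let Hj j := span (ws (Sj j)) in
  let Htj j := span (ws (S :\: Sj j)) in
  let pt := \sum_(j < m) p j in
  let BL1 := (\prod_(j < m) wedge_norm (ws (S :\: Sj j)) `^ p j) /
             wedge_norm (ws S) `^ (pt - 1) in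
  let BL2 := (\prod_(j < m) wedge_norm (ws (Sj j)) `^ p j) /
             wedge_norm (ws S) in
  forall K : set 'rV[R]_n, convex_body K ->
  let volP (F : {vspace 'rV[R]_n}) := vol F (orthoproj F @` K) in
  let volK := vol fullv K in
  [/\ volP (orthoc H) `^ (pt - 1) * volK <=
        BL1 * ((\prod_(j < m) 'C(n - d + dj j, dj j)%:R `^ p j) / 'C(n, d)%:R) *
        \prod_(j < m) volP (orthoc (Htj j)) `^ p j,
      volP (orthoc H) * volK `^ (pt - 1) <=
        BL2 * ((\prod_(j < m) 'C(n - dj j, n - d)%:R `^ p j) /
               'C(n, d)%:R `^ (pt - 1)) *
        \prod_(j < m) volP (orthoc (Hj j)) `^ p j,
      volP (orthoc H) `^ (pt - 1) * volK <=
        BL2 * ((\prod_(j < m) 'C(n - d + dj j, dj j)%:R `^ p j) / 'C(n, d)%:R) *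
        \prod_(j < m) volP (Hj j + orthoc H)%VS `^ p j
    & volP (orthoc H) * volK `^ (pt - 1) <=
        BL1 * ((\prod_(j < m) 'C(n - dj j, n - d)%:R `^ p j) /
               'C(n, d)%:R `^ (pt - 1)) *
        \prod_(j < m) volP (Htj j + orthoc H)%VS `^ p j].
Proof.
move=> wb cov ws d dj H Hj Htj pt BL1 BL2 K Kbody volP volK; split.
- exact: (cover_projection_inequality wb Kbody cov).
- exact: (complement_cover_projection_inequality wb Kbody cov).
- exact: (dual_cover_projection_inequality wb Kbody cov).
- exact: (dual_complement_cover_projection_inequality wb Kbody cov).
Qed.
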